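(* Let $\alpha_N:=\frac{3N-14-4\sqrt6}{4+2\sqrt6}$. Assume that either $1\le N\le7$ and $\alpha\ge0$, or $N\ge8$ and $\alpha>\alpha_N$. Let $U$ be a solution of $$\Delta U=\frac{|y|^\alpha}{U^2}\ \text{ in }\mathbb{R}^N,\qquad U(y)\ge C>0\ \text{ in }\mathbb{R}^N,$$ for some constant $C>0$. Then $U$ is linearly unstable in the sense that $$\mu_1(U)=\inf\Big\{\int_{\mathbb{R}^N}\Big(|\nabla\phi|^2-\frac{2|y|^\alpha}{U^3}\phi^2\Big)dy:\ \phi\in C_0^\infty(\mathbb{R}^N),\ \int_{\mathbb{R}^N}\phi^2\,dy=1\Big\}<0.$$ Moreover, if $N\ge8$ and $0\le\alpha\le\alpha_N$, then there exists at least one solution $U$ of $$\Delta U=\frac{|y|^\alpha}{U^2}\ \text{ in }\mathbb{R}^N,\qquad U(y)\ge C\ \text{ in }\mathbb{R}^N\ \text{ for some constant } C>0,$$ such that $\mu_1(U)\ge0$.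
   Context: Solutions are understood in the classical sense. *)

(* Defs.v *)
From HB Require Import structures.
From mathcomp Require Import all_boot all_order all_algebra.
From mathcomp Require Import all_classical all_reals all_analysis.

Set Implicit Arguments.
Unset Strict Implicit.
Unset Printing Implicit Defensive.

Import Order.TTheory GRing.Theory Num.Theory.
Import numFieldNormedType.Exports.

Local Open Scope classical_set_scope.
Local Open Scope ring_scope.

(* Finite powers of a sigma-finite measure, on n-tuples equipped with their
   product sigma-algebra: the 0-th power is the point mass at [tuple], and the
   (n+1)-st is the image of mu \x mu^n under (x, t) |-> x :: t. *)
Section tuple_power_measure.
Local Open Scope ereal_scope.
Context d (T : measurableType d) (R : realType).

Definition tuple_cons n (p : T * n.-tuple T) : n.+1.-tuple T :=
  [tuple of p.1 :: p.2].

Lemma measurable_tuple_cons n : measurable_fun setT (@tuple_cons n).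
Proof. exact: measurable_cons. Qed.

Section step.
Variable mu : {sigma_finite_measure set T -> \bar R}.
Variables (n : nat) (nu : {sigma_finite_measure set (n.-tuple T) -> \bar R}).

Definition cons_measure : set (n.+1.-tuple T) -> \bar R :=
  pushforward (mu \x nu) (@tuple_cons n).

Let cons_measure0 : cons_measure set0 = 0.
Proof. by rewrite /cons_measure /pushforward preimage_set0 measure0. Qed.

Let cons_measure_ge0 A : 0 <= cons_measure A.
Proof. by rewrite /cons_measure /pushforward measure_ge0. Qed.

Let cons_measure_sigma_additive : semi_sigma_additive cons_measure.
Proof.
move=> F mF tF mUF; rewrite /cons_measure /pushforward preimage_bigcup.
have mpre A : measurable A -> measurable (@tuple_cons n @^-1` A).
  by rewrite -[X in _ -> measurable X]setTI => /(measurable_tuple_cons measurableT).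
apply: measure_semi_sigma_additive.
- by move=> k; exact: mpre.
- apply/trivIsetP => /= i j _ _ ij; rewrite -preimage_setI.
  by move/trivIsetP : tF => /(_ _ _ _ _ ij) ->//; rewrite preimage_set0.
- by rewrite -preimage_bigcup; exact: mpre.
Qed.

HB.instance Definition _ := isMeasure.Build _ _ _ cons_measure
  cons_measure0 cons_measure_ge0 cons_measure_sigma_additive.

Let cons_measure_sigma_finite : sigma_finite setT cons_measure.
Proof.
have /sigma_finiteP[F [TF ndF Foo]] := sigma_finiteT mu.
have /sigma_finiteP[G [TG ndG Goo]] := sigma_finiteT nu.
pose g (t : n.+1.-tuple T) : T * n.-tuple T := (thead t, [tuple of behead t]).
have mg : measurable_fun setT g.
  apply/measurable_fun_pair; first exact: measurable_tnth.
  exact: measurable_behead.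
have gK : cancel (@tuple_cons n) g.
  by case=> x t; rewrite /g theadE; congr pair; exact/val_inj.
exists (fun k => g @^-1` (F k `*` G k)).
  rewrite -preimage_bigcup -[LHS](preimage_setT g); congr (_ @^-1` _).
  apply/esym/seteqP; split=> // -[x t] _.
  have [a _ Fx] : (\bigcup_i F i) x by rewrite -TF.
  have [b _ Gt] : (\bigcup_i G i) t by rewrite -TG.
  exists (maxn a b) => //; split => /=.
  - by move: x Fx; exact/subsetPset/ndF/leq_maxl.
  - by move: t Gt; exact/subsetPset/ndG/leq_maxr.
move=> k; have [mF Fk] := Foo k; have [mG Gk] := Goo k; split.
  by rewrite -[X in measurable X]setTI; apply: mg => //; exact: measurableX.
rewrite /cons_measure /pushforward -comp_preimage (_ : g \o _ = id); last first.
  exact/funext.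
by rewrite preimage_id product_measure1E// lte_mul_pinfty// ge0_fin_numE.
Qed.

HB.instance Definition _ := Measure_isSigmaFinite.Build _ _ _ cons_measure
  cons_measure_sigma_finite.

End step.

Fixpoint tuple_power_measure (mu : {sigma_finite_measure set T -> \bar R}) n :
    {sigma_finite_measure set (n.-tuple T) -> \bar R} :=
  match n with
  | 0 => \d_ ([tuple] : 0.-tuple T)
  | m.+1 => cons_measure mu (tuple_power_measure mu m)
  end.

End tuple_power_measure.

Section euclidean.
Variables (R : realType) (N : nat).
Implicit Types y : 'rV[R]_N.

Definition lebesgue_RN :
    {sigma_finite_measure set (N.-tuple (measurableTypeR R)) -> \bar R} :=
  tuple_power_measure (@lebesgue_measure R) N.

(* The integral of f over R^N; f is read on tuples of coordinates because
   row vectors carry a topology but no measurable structure. *)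
Definition integral_RN (f : 'rV[R]_N -> R) : \bar R :=
  (\int[lebesgue_RN]_t (f (\row_i tnth t i))%:E)%E.

(* The library norm `|y| on row vectors is the sup norm. *)
Definition enorm y : R := Num.sqrt (\sum_i y ord0 i ^+ 2).

Definition partial (i : 'I_N) (f : 'rV[R]_N -> R) : 'rV[R]_N -> R :=
  'D_(delta_mx ord0 i) f.

Definition laplacian (f : 'rV[R]_N -> R) y : R :=
  \sum_i partial i (partial i f) y.

Definition grad_sqr (f : 'rV[R]_N -> R) y : R := \sum_i partial i f y ^+ 2.

(* 'D_v f is a total function, with a junk value where the limit does not
   exist, so the existence of partial derivatives is required separately. *)
Fixpoint Ck (k : nat) (f : 'rV[R]_N -> R) : Prop :=
  continuous f /\
  if k is k'.+1 then
    forall i, (forall y, derivable f y (delta_mx ord0 i)) /\ Ck k' (partial i f)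
  else True.

Definition compact_support (f : 'rV[R]_N -> R) :=
  compact (closure [set y | f y != 0]).

Definition test_function (phi : 'rV[R]_N -> R) :=
  (forall k, Ck k phi) /\ compact_support phi.

(* Since 0 `^ 0 = 1, the weight |y|^alpha is identically 1 for alpha = 0. *)
Definition positive_solution (alpha : R) (U : 'rV[R]_N -> R) :=
  [/\ Ck 2 U,
      exists2 C : R, 0 < C & forall y, C <= U y
    & forall y, laplacian U y = enorm y `^ alpha / U y ^+ 2].

Definition energy (alpha : R) (U phi : 'rV[R]_N -> R) : \bar R :=
  integral_RN (fun y =>
    grad_sqr phi y - 2 * enorm y `^ alpha / U y ^+ 3 * phi y ^+ 2).

Definition mu1 (alpha : R) (U : 'rV[R]_N -> R) : \bar R :=
  ereal_inf [set energy alpha U phi | phi in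
    [set phi | test_function phi /\ integral_RN (fun y => phi y ^+ 2) = 1%E]].

Definition alphaN : R :=
  (3 * N%:R - 14 - 4 * Num.sqrt 6) / (4 + 2 * Num.sqrt 6).

End euclidean.

Arguments alphaN : clear implicits.

(* Main.v *)
Require Import Defs.
From mathcomp Require Import all_boot all_order all_algebra.
From mathcomp Require Import all_classical all_reals all_analysis.
From mathcomp Require Import measurable_realfun ring lra.
Import Order.TTheory GRing.Theory Num.Theory.
Import numFieldNormedType.Exports.
Set Implicit Arguments.
Unset Strict Implicit.
Unset Printing Implicit Defensive.
Local Open Scope classical_set_scope.
Local Open Scope ring_scope.

(* Instability. Suppose U is stable. Testing stability with U^(-q) psi and the equation with
   U^(-2q-1) psi^2 gives, for q < 2 + sqrt 6,
     \int |y|^alpha U^(-2q-3) psi^2 <= C \int U^(-2q) |grad psi|^2.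
   For psi = eta^4, eta a cutoff between the balls of radii R and sqrt 2 R, the right-hand side is
   at most half of the left-hand side plus C R^(N-2-2q(alpha+2)/3). When alpha > alpha_N some
   q < 2 + sqrt 6 makes this exponent negative, and R -> oo contradicts the positivity of the
   left-hand side. As U^(-q) psi is only C^2, stability is first extended from smooth to C^1 test
   functions by mollification.

   Existence. In the variable x = |y|^(alpha+2) the radial equation becomes
   x v'' + a v' = c v^-2, solved with v(0) = 1 by Picard iteration. For alpha <= alpha_N the
   solution stays above the singular solution of order x^(1/3), so that
   2 |y|^alpha / U^3 <= (N-2)^2 / (4 |y|^2), and stability is Hardy's inequality. *)

(** * Integration of compactly supported functions *)

(** The number alpha_N arises twice. For q > 0, some l < 2 with q^2 < l (2 q + 1) exists exactly
    when q^2 - 4 q - 2 < 0, that is q < 2 + sqrt 6; and N - 2 < 2 q (alpha + 2) / 3 at q = 2 + sqrt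
    6 reads alpha > alpha_N. For existence put n = N - 2, g = (alpha + 2) / 3 and Q = g (g + n). The
    singular solution has potential 2 Q / |y|^2, so Hardy asks for 8 Q <= n^2. The same inequality
    makes the characteristic roots of the linearisation there real, which keeps v above it. It
    amounts to n >= g (4 + 2 sqrt 6), that is alpha <= alpha_N.

    The gradient term is absorbed pointwise, without Hoelder's inequality: where U^3 is small
    against r^(alpha+2) eta^2 the left integrand dominates it, and elsewhere U^(-2q) eta^6 is at
    most a power of r.

    Differentiability is only known for partial derivatives, so calculus in R^N is reduced to
    functions of one variable along lines, and every integration by parts rests on one fact: a
    partial derivative of a compactly supported function has integral 0. *)

Lemma rV_norm_ler (R : realType) N (y : 'rV[R]_N) (e : R) : 0 <= e ->
  (forall i, `|y ord0 i| <= e) -> `|y| <= e.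
Proof.
move=> e0 h; rewrite [leLHS]/Num.norm /= mx_normrE; apply/bigmax_leP; split=> //.
by move=> [i j] _ /=; rewrite ord1.
Qed.

Lemma rV_coord_le (R : realType) N (y : 'rV[R]_N) i : `|y ord0 i| <= `|y|.
Proof.
rewrite [leRHS]/Num.norm /= mx_normrE.
exact: (le_bigmax _ (fun x : 'I_1 * 'I_N => `|y x.1 x.2|) (ord0, i)).
Qed.

Definition row_of_tuple (R : realType) N (t : N.-tuple R) : 'rV[R]_N :=
  \row_i tnth t i.

(* Rounding the coordinates down to multiples of 1/(k+1) leaves countably many values, so f
   composed with the rounding is measurable; let k -> oo. *)
Lemma continuous_measurable_tuple (R : realType) N (f : 'rV[R]_N -> R) :
  continuous f ->
  measurable_fun setT
    (fun t : N.-tuple (measurableTypeR R) => f (row_of_tuple t)).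
Proof.
move=> cf.
pose d (k : nat) (t : N.-tuple R) : N.-tuple int :=
  [tuple Num.floor (k.+1%:R * tnth t i) | i < N].
pose g (k : nat) (z : N.-tuple int) : 'rV[R]_N :=
  \row_i ((tnth z i)%:~R / k.+1%:R).
apply: (@measurable_fun_cvg _ _ _ _ (fun k t => f (g k (d k t)))).
- move=> k _ Y mY; rewrite setTI.
  rewrite [X in measurable X](_ : _ =
    \bigcup_(z : N.-tuple int) (if `[< Y (f (g k z)) >] then
      [set t : N.-tuple (measurableTypeR R) | d k t = z] else set0)); last first.
    apply/seteqP; split=> [t /= Yt|t [z _]].
      by exists (d k t) => //; rewrite ifT//; exact/asboolP.
    by case: asboolP => // Yz /= ->.
  apply: countable_bigcupT_measurable; first exact: countableP.
  move=> z; case: ifP => // _.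
  rewrite [X in measurable X](_ : _ = \bigcap_(i in [set: 'I_N])
     [set t : N.-tuple (measurableTypeR R) |
        Num.floor (k.+1%:R * tnth t i) = tnth z i]); last first.
    apply/seteqP; split=> [t /= <- i _ /=|t h]; first by rewrite tnth_mktuple.
    by apply: eq_from_tnth => i; rewrite tnth_mktuple; exact: h.
  apply: fin_bigcap_measurable => // i _.
  rewrite [X in measurable X](_ : _ = (fun t : N.-tuple (measurableTypeR R) => tnth t i) @^-1`
    `[((tnth z i)%:~R / k.+1%:R : R), ((tnth z i + 1)%:~R / k.+1%:R : R)[%classic).
    have := @measurable_tnth _ (measurableTypeR R) N i measurableT _
      (measurable_itv `[(tnth z i)%:~R / k.+1%:R, (tnth z i + 1)%:~R / k.+1%:R[).
    by rewrite setTI.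
  apply/seteqP; split=> t /=; rewrite in_itv /= ler_pdivrMr// ltr_pdivlMr// (mulrC _ k.+1%:R).
    by move=> <-; exact: floor_itv.
  by move=> h; apply/floor_def.
- move=> t _ /=.
  apply: (@continuous_cvg _ _ _ _ _ (fun k => g k (d k t)) f); first exact: cf.
  apply/cvgrPdist_le => e e0.
  near=> k.
  apply: rV_norm_ler; first exact: ltW.
  move=> i; rewrite !mxE tnth_mktuple.
  apply: (@le_trans _ _ (k.+1%:R^-1)); last first.
    by apply: ltW; near: k; exact: (near_infty_natSinv_lt (PosNum e0)).
  set x := tnth t i.
  have k0 : (0 : R) < k.+1%:R by [].
  have /andP[h1 h2] := floor_itv (k.+1%:R * x).
  rewrite [X in _ <= X]mulrC in h1; rewrite [X in X < _]mulrC intrD in h2.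
  rewrite ler_norml; apply/andP; split.
    by rewrite lerNl opprB lerBlDr ler_pdivrMr// mulrDl mulVf ?gt_eqF//; lra.
  by rewrite lerBlDr -[X in X + _]mul1r -mulrDl ler_pdivlMr//; lra.
Unshelve. all: by end_near.
Qed.

(** An explicit radius, in the sup norm, is easier to transport through sums, products and
    translations than compactness of a closure. [K] may be negative. *)
Definition bounded_support (R : realType) N (f : 'rV[R]_N -> R) :=
  exists K, forall y, K < `|y| -> f y = 0.

Definition Cc (R : realType) N (f : 'rV[R]_N -> R) :=
  continuous f /\ bounded_support f.

Definition tuple_box (R : realType) N (a b : R) :
    set (N.-tuple (measurableTypeR R)) :=
  [set t | forall i, a <= tnth t i <= b].
Arguments tuple_box {R} N a b _ /.

Lemma measurable_tuple_box (R : realType) N (a b : R) :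
  measurable (tuple_box N a b).
Proof.
rewrite [X in measurable X](_ : _ = \bigcap_(i in [set: 'I_N])
     (fun t : N.-tuple (measurableTypeR R) => tnth t i) @^-1` `[a, b]); last first.
  by apply/seteqP; split=> [t /= h i _ /=|t h i];
    [rewrite in_itv /= h|have := h i Logic.I; rewrite /= in_itv].
apply: fin_bigcap_measurable => // i _.
have := @measurable_tnth _ (measurableTypeR R) N i measurableT _
      (measurable_itv `[a, b]).
by rewrite setTI.
Qed.

Lemma tuple_box_volume (R : realType) N (a b : R) : a <= b ->
  lebesgue_RN R N (tuple_box N a b) = ((b - a) ^+ N)%:E.
Proof.
move=> ab; rewrite /lebesgue_RN; elim: N => [|n IH].
  rewrite /= expr0 /dirac indicE mem_set//.
  by move=> [].
rewrite [LHS](_ : _ = (@lebesgue_measure R \x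
  tuple_power_measure (@lebesgue_measure R) n)%E
  (`[a, b] `*` tuple_box n a b)); last first.
  rewrite /= /cons_measure /pushforward; congr (_ _).
  apply/seteqP; split=> [[x t] /= h|[x t] /= [x1 h] i].
    split; first by have := h ord0; rewrite tnth0 in_itv.
    by move=> i; have := h (lift ord0 i); rewrite tnthS.
  by case: (unliftP ord0 i) => [j|] ->; rewrite ?tnthS ?tnth0//; move: x1; rewrite in_itv.
rewrite product_measure1E//; last exact: measurable_tuple_box.
rewrite [X in (_ * X)%E]IH /= lebesgue_measure_itv /= lte_fin.
case: ltP => ab'; first by rewrite -EFinB -EFinM exprS.
have -> : a = b by apply/eqP; rewrite eq_le ab.
by rewrite subrr exprS !mul0r mul0e.
Qed.

Lemma integrable_tuple_box (R : realType) N (a b c : R) : a <= b ->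
  (lebesgue_RN R N).-integrable setT
    (EFin \o (fun t => c * \1_(tuple_box N a b) t)).
Proof.
move=> ab; have mB := @measurable_tuple_box R N a b.
rewrite [X in _.-integrable _ X](_ : _ =
  (fun t => c%:E * (\1_(tuple_box N a b) t)%:E)%E)//.
apply: integrableZl => //; apply/integrableP; split.
  by apply/measurable_EFinP; exact: measurable_indic.
under eq_integral do rewrite /= ger0_norm//.
by rewrite integral_indic// setIT [X in (X < _)%E]tuple_box_volume// ltry.
Qed.

Lemma RN_int_tuple_box (R : realType) N (a b c : R) : a <= b ->
  \int[lebesgue_RN R N]_t (c * \1_(tuple_box N a b) t) = c * (b - a) ^+ N.
Proof.
move=> ab; have mB := @measurable_tuple_box R N a b.
rewrite RintegralZl//.
  by congr (_ * _); rewrite /Rintegral integral_indic// setIT [X in fine X]tuple_box_volume.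
have := @integrable_tuple_box R N a b 1 ab.
by congr (_.-integrable _ _); apply/funext => t /=; rewrite mul1r.
Qed.

Lemma norm_ball_compact (R : realType) N (K : R) :
  compact [set y : 'rV[R]_N | `|y| <= K].
Proof.
apply: bounded_closed_compact.
  exists K; split=> [|x xK y /= yK]; first exact: num_real.
  by rewrite (le_trans yK)// ltW.
by apply: (@closed_comp _ _ (fun y : 'rV[R]_N => `|y|) [set x | x <= K]);
  [move=> y _; exact: norm_continuous|exact: closed_le].
Qed.

Lemma continuous_bounded_ball (R : realType) N (f : 'rV[R]_N -> R) (K : R) :
  continuous f -> exists2 M, 0 <= M & forall y, `|y| <= K -> `|f y| <= M.
Proof.
move=> cf.
have : compact (f @` [set y : 'rV[R]_N | `|y| <= K]).
  apply: continuous_compact; last exact: norm_ball_compact.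
  exact: continuous_subspaceT.
move=> /compact_bounded [M0 [_ hM]].
exists (`|M0| + 1) => [|y yK]; first by rewrite addr_ge0.
apply: hM; first by rewrite (le_lt_trans (ler_norm _))// ltrDl.
by exists y.
Qed.

Lemma Cc_bounded (R : realType) N (f : 'rV[R]_N -> R) : Cc f ->
  exists2 M, 0 <= M & forall y, `|f y| <= M.
Proof.
move=> [cf [K fK]]; have [M M0 hM] := continuous_bounded_ball K cf.
exists M => // y; have [yK|yK] := leP `|y| K; first exact: hM.
by rewrite fK// normr0.
Qed.

Lemma Cc_integrable (R : realType) N (f : 'rV[R]_N -> R) : Cc f ->
  (lebesgue_RN R N).-integrable setT
    (EFin \o (fun t : N.-tuple (measurableTypeR R) => f (row_of_tuple t))).
Proof.
move=> /[dup] /Cc_bounded [M M0 hM] [cf [K fK]].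
pose B := tuple_box N (- `|K|) `|K|.
apply: (@le_integrable _ _ _ _ _ _ _
  (EFin \o (fun t => M * \1_B t))) => //.
- by apply/measurable_EFinP; exact: continuous_measurable_tuple.
- move=> t _ /=; rewrite lee_fin [X in _ <= X]ger0_norm ?mulr_ge0//.
  rewrite indicE; case: (boolP (t \in B)) => [_|/negP]; first by rewrite mulr1 hM.
  rewrite inE => tB; rewrite fK ?normr0 ?mulr0//.
  rewrite ltNge; apply/negP => tK; apply: tB => i.
  rewrite -ler_norml; apply: (le_trans _ (ler_norm _)); apply: le_trans tK.
  by have := rV_coord_le (row_of_tuple t) i; rewrite mxE.
- by apply: integrable_tuple_box; rewrite ge0_cp.
Qed.

(** A real-valued integral, so that linear arithmetic applies; it agrees with [integral_RN] on the
    class [Cc], where everything is integrable. *)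
Definition RN_int (R : realType) N (f : 'rV[R]_N -> R) : R :=
  \int[lebesgue_RN R N]_t f (row_of_tuple t).

Lemma integral_RN_EFin (R : realType) N (f : 'rV[R]_N -> R) : Cc f ->
  integral_RN f = (RN_int f)%:E.
Proof.
move=> cf; rewrite /RN_int /Rintegral fineK//.
exact/integrable_fin_num/Cc_integrable.
Qed.

Lemma le_RN_int (R : realType) N (f g : 'rV[R]_N -> R) : Cc f -> Cc g ->
  (forall y, f y <= g y) -> RN_int f <= RN_int g.
Proof. by move=> cf cg fg; apply: le_Rintegral => //; exact: Cc_integrable. Qed.

Lemma RN_intD (R : realType) N (f g : 'rV[R]_N -> R) : Cc f -> Cc g ->
  RN_int (fun y => f y + g y) = RN_int f + RN_int g.
Proof. by move=> cf cg; apply: RintegralD => //; exact: Cc_integrable. Qed.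

Lemma RN_intZ (R : realType) N (f : 'rV[R]_N -> R) k : Cc f ->
  RN_int (fun y => k * f y) = k * RN_int f.
Proof. by move=> cf; apply: RintegralZl => //; exact: Cc_integrable. Qed.

(** The bounds are one-sided because the function integrated later has a negative part that is not
    controlled. *)
Lemma RN_int_le_box (R : realType) N (f : 'rV[R]_N -> R) M K : Cc f ->
  0 <= M -> 0 <= K -> (forall y, `|y| <= K -> f y <= M) ->
  (forall y, K < `|y| -> f y <= 0) -> RN_int f <= M * (2 * K) ^+ N.
Proof.
move=> cf M0 K0 fM fK.
have KK : - K <= K by rewrite ge0_cp.
rewrite (_ : 2 * K = K - - K); last by rewrite opprK mulr2n mulrDl mul1r.
rewrite -RN_int_tuple_box//; apply: le_Rintegral => //.
- exact: Cc_integrable.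
- exact: integrable_tuple_box.
move=> t _; rewrite indicE.
have [tK|tK] := leP `|row_of_tuple t| K.
  rewrite mem_set ?mulr1 ?fM// => i; rewrite -ler_norml; apply: le_trans tK.
  by have := rV_coord_le (row_of_tuple t) i; rewrite mxE.
by rewrite (le_trans (fK _ tK))// mulr_ge0.
Qed.

Lemma RN_int_ge_box (R : realType) N (f : 'rV[R]_N -> R) (c a b : R) : Cc f ->
  a <= b -> (forall y, 0 <= f y) ->
  (forall y : 'rV[R]_N, (forall i, a <= y ord0 i <= b) -> c <= f y) ->
  c * (b - a) ^+ N <= RN_int f.
Proof.
move=> cf ab f0 fc.
rewrite -RN_int_tuple_box//; apply: le_Rintegral => //.
- exact: integrable_tuple_box.
- exact: Cc_integrable.
- move=> t _; rewrite indicE; case: (boolP (t \in _)) => [|_]; last by rewrite mulr0.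
  by rewrite inE mulr1 => tB; apply: fc => i; rewrite mxE; exact: tB.
Qed.

(** Both difference quotients are the same function. The one-variable chain rule, mean value theorem
    and fundamental theorem of calculus thus apply to directional derivatives without Frechet
    differentiability. *)
Lemma derive_line (R : realType) (V : normedModType R) (F : V -> R) (y v : V) (t : R) :
  derivable F (y + t *: v) v ->
  is_derive t 1 (fun s : R => F (y + s *: v)) ('D_v F (y + t *: v)).
Proof.
have E : (fun h : R => h^-1 *: (((fun s : R => F (y + s *: v)) \o shift t)
    (h *: (1 : R)) - (fun s : R => F (y + s *: v)) t)) =
  (fun h : R => h^-1 *: ((F \o shift (y + t *: v)) (h *: v) - F (y + t *: v))).
  apply/funext => h /=; congr (_ *: (F _ - _)).
  by rewrite /shift /= [h *: 1]mulr1 scalerDl addrCA.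
by move=> dF; split; rewrite /derivable /derive E.
Qed.

Lemma line_derive (R : realType) (V : normedModType R) (F : V -> R) (y v : V) (d : R) :
  is_derive (0 : R) 1 (fun s : R => F (y + s *: v)) d -> is_derive y v F d.
Proof.
have E : (fun h : R => h^-1 *: (((fun s : R => F (y + s *: v)) \o shift (0 : R))
    (h *: (1 : R)) - (fun s : R => F (y + s *: v)) 0)) =
  (fun h : R => h^-1 *: ((F \o shift y) (h *: v) - F y)).
  apply/funext => h /=.
  by rewrite /shift /= [h *: 1]mulr1 addr0 scale0r addr0 (addrC y).
by move=> [+ +]; rewrite /derivable /derive E => h1 h2; split.
Qed.

Lemma lip1_continuous (R : realType) (V W : normedModType R) (phi : V -> W) :
  (forall u v, `|phi u - phi v| <= `|u - v|) -> continuous phi.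
Proof.
move=> h u; apply/cvgrPdist_le => e e0; near=> v.
apply: (le_trans (h _ _)); near: v.
by move/cvgrPdist_le: (@cvg_id _ (nbhs u)); exact.
Unshelve. all: by end_near.
Qed.

(** The counterpart on row vectors of [tuple_cons], through which the product measure is built; it
    carries the induction on the dimension. *)
Definition row_cons (R : realType) n (x : R) (v : 'rV[R]_n) : 'rV[R]_n.+1 :=
  \row_i if unlift ord0 i is Some j then v ord0 j else x.

Lemma row_cons0 (R : realType) n (x : R) (v : 'rV[R]_n) : row_cons x v ord0 ord0 = x.
Proof. by rewrite mxE unlift_none. Qed.

Lemma row_consS (R : realType) n (x : R) (v : 'rV[R]_n) j :
  row_cons x v ord0 (lift ord0 j) = v ord0 j.
Proof. by rewrite mxE liftK. Qed.

Lemma row_of_tuple_cons (R : realType) n (x : measurableTypeR R)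
    (t : n.-tuple (measurableTypeR R)) :
  row_of_tuple (tuple_cons (x, t)) = row_cons x (row_of_tuple t) :> 'rV[R]_n.+1.
Proof.
apply/rowP => i; rewrite mxE; case: (unliftP ord0 i) => [j|] ->.
  by rewrite tnthS row_consS mxE.
by rewrite tnth0 row_cons0.
Qed.

Lemma row_consB (R : realType) n (x y : R) (v w : 'rV[R]_n) :
  row_cons x v - row_cons y w = row_cons (x - y) (v - w).
Proof.
apply/rowP => i; rewrite !mxE; case: (unliftP ord0 i) => [j|] _ //.
by rewrite !mxE.
Qed.

Lemma row_cons_le (R : realType) n (x : R) (v : 'rV[R]_n) e :
  `|x| <= e -> `|v| <= e -> `|row_cons x v| <= e.
Proof.
move=> xe ve; apply: rV_norm_ler; first exact: le_trans xe.
move=> i; case: (unliftP ord0 i) => [j|] ->; rewrite ?row_cons0 ?row_consS//.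
exact: le_trans (rV_coord_le _ _) ve.
Qed.

Lemma row_cons_continuousl (R : realType) n (v : 'rV[R]_n) :
  continuous (fun x : R => row_cons x v).
Proof.
apply: lip1_continuous => x y; rewrite row_consB subrr.
by apply: row_cons_le; rewrite ?normr0.
Qed.

Lemma row_cons_continuousr (R : realType) n (x : R) :
  continuous (@row_cons R n x).
Proof.
apply: lip1_continuous => v w; rewrite row_consB subrr.
by apply: row_cons_le; rewrite ?normr0.
Qed.

Lemma row_cons_ge_l (R : realType) n (x : R) (v : 'rV[R]_n) : `|x| <= `|row_cons x v|.
Proof. by have := rV_coord_le (row_cons x v) ord0; rewrite row_cons0. Qed.

Lemma row_cons_ge_r (R : realType) n (x : R) (v : 'rV[R]_n) : `|v| <= `|row_cons x v|.
Proof.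
apply: rV_norm_ler => // j.
by have := rV_coord_le (row_cons x v) (lift ord0 j); rewrite row_consS.
Qed.

Lemma Cc_slice (R : realType) n (F : 'rV[R]_n.+1 -> R) x : Cc F ->
  Cc (fun v => F (row_cons x v)).
Proof.
move=> [cF [K FK]]; split; last first.
  by exists K => y Ky; apply: FK; apply: (lt_le_trans Ky); exact: row_cons_ge_r.
by move=> v; apply: continuous_comp; [exact: row_cons_continuousr|exact: cF].
Qed.

Lemma row_cons_addl (R : realType) n (x s : R) (v : 'rV[R]_n) :
  row_cons (x + s) v = row_cons x v + s *: delta_mx ord0 ord0.
Proof.
apply/rowP => k; case: (unliftP ord0 k) => [l|] ->.
  by rewrite [RHS]mxE !row_consS !mxE eqxx /= mulr0 addr0.
by rewrite [RHS]mxE !row_cons0 !mxE !eqxx mulr1.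
Qed.

Lemma row_cons_addr (R : realType) n (x s : R) (v : 'rV[R]_n) j :
  row_cons x (v + s *: delta_mx ord0 j) =
  row_cons x v + s *: delta_mx ord0 (lift ord0 j).
Proof.
apply/rowP => k; case: (unliftP ord0 k) => [l|] ->.
  by rewrite [RHS]mxE !row_consS !mxE (inj_eq lift_inj).
by rewrite [RHS]mxE !row_cons0 !mxE (negbTE (neq_lift _ _)) andbF mulr0 addr0.
Qed.

Lemma integral_continuous_primitive (R : realType) (h g : R -> R) (K : R) :
  (forall x : R, is_derive x 1 h (g x)) -> continuous g ->
  (forall x : R, K < `|x| -> h x = 0 /\ g x = 0) ->
  (\int[@lebesgue_measure R]_x (g x)%:E = 0)%E.
Proof.
move=> dh cg hK.
pose L : R := `|K| + 1.
have KL : K < L by rewrite (le_lt_trans (ler_norm _))// ltrDl.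
have L0 : 0 < L by rewrite ltr_wpDl.
have LL : - L < L by rewrite gtrN.
have ch : continuous h.
  by move=> x; apply: differentiable_continuous; apply/derivable1_diffP; case: (dh x).
transitivity (\int[@lebesgue_measure R]_(x in `[(- L)%R, L]) (g x)%:E)%E.
  rewrite [RHS]integral_mkcond; apply: eq_integral => x _; rewrite patchE.
  case: ifPn => // /negP xL; rewrite (hK x _).2//.
  rewrite ltNge; apply/negP => xK; apply: xL; rewrite inE /= in_itv /=.
  by rewrite -ler_norml (le_trans xK)// ltW.
rewrite (@continuous_FTC2 _ g h)//.
- rewrite (hK L _).1 ?(hK (- L) _).1 ?subee//.
    by rewrite normrN ger0_norm// ltW.
  by rewrite ger0_norm// ltW.
- exact: continuous_subspaceT.
- split.
  + by move=> x _; case: (dh x).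
  + by apply: cvg_at_right_filter; exact: ch.
  + by apply: cvg_at_left_filter; exact: ch.
- by move=> x _; rewrite derive1E; case: (dh x).
Qed.


Lemma integral_cons_measure d (T : measurableType d) (R : realType)
    (mu : {sigma_finite_measure set T -> \bar R}) n
    (nu : {sigma_finite_measure set (n.-tuple T) -> \bar R})
    (G : n.+1.-tuple T -> \bar R) :
  (cons_measure mu nu).-integrable setT G ->
  (mu \x nu)%E.-integrable setT (G \o @tuple_cons _ _ n) /\
  (\int[cons_measure mu nu]_t G t = \int[(mu \x nu)%E]_p G (tuple_cons p))%E.
Proof.
move=> /[dup] iG /integrableP[mG fG].
have iGt : (mu \x nu)%E.-integrable setT (G \o @tuple_cons _ _ n).
  apply/integrableP; split.
    by apply: measurableT_comp => //; exact: measurable_tuple_cons.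
  move: fG; rewrite [X in (X < _)%E](@ge0_integral_pushforward _ _ _ _ _ _
    (@measurable_tuple_cons _ T n) (mu \x nu)%E setT (fun t => `|G t|%E))//.
  exact: measurableT_comp.
split=> //.
rewrite [LHS](@integral_pushforward _ _ _ _ _ _
  (@measurable_tuple_cons _ T n) (mu \x nu)%E setT G)//.
Qed.

(** Induction on the dimension with Fubini. The inner integral, over the first coordinate or over
    the others according to [i], already vanishes. *)
Lemma RN_int_partial_eq0 (R : realType) N (F : 'rV[R]_N -> R) i : Cc F ->
  (forall y, derivable F y (delta_mx ord0 i)) -> Cc (partial i F) ->
  RN_int (partial i F) = 0.
Proof.
move=> cF dF cdF; suff : integral_RN (partial i F) = 0%E.
  by rewrite integral_RN_EFin// => -[].
elim: N F i cF dF cdF => [F []//|n IH] F i cF dF cdF.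
pose mu : {sigma_finite_measure set (measurableTypeR R) -> \bar R} :=
  @lebesgue_measure R.
pose nu := tuple_power_measure mu n.
pose f (p : measurableTypeR R * n.-tuple (measurableTypeR R)) :=
  (partial i F (row_cons p.1 (row_of_tuple p.2)))%:E.
pose G (t : n.+1.-tuple (measurableTypeR R)) := (partial i F (row_of_tuple t))%:E.
have fE : f = G \o @tuple_cons _ _ n.
  by apply/funext => -[x t] /=; rewrite /f /G row_of_tuple_cons.
have [If IE] := @integral_cons_measure _ _ _ mu n nu G (Cc_integrable cdF).
have -> : integral_RN (partial i F) = (\int[(mu \x nu)%E]_p f p)%E.
  by rewrite fE; exact: IE.
rewrite -fE in If.
case: (unliftP ord0 i) => [j|] iE.
  (* [i] is not the first coordinate: the slice at fixed [x] falls under the induction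
     hypothesis. *)
  rewrite -integral12_prod_meas1//; apply: integral0_eq => x _.
  pose Fx v := F (row_cons x v).
  have E v : is_derive v (delta_mx ord0 j) Fx (partial i F (row_cons x v)).
    apply: line_derive.
    have -> : (fun s : R => Fx (v + s *: delta_mx ord0 j)) =
      (fun s : R => F (row_cons x v + s *: delta_mx ord0 i)).
      by apply/funext => s; rewrite /Fx row_cons_addr iE.
    have := @derive_line _ _ F (row_cons x v) (delta_mx ord0 i) 0.
    by rewrite scale0r addr0; apply.
  have pE : partial j Fx = fun v => partial i F (row_cons x v).
    by apply/funext => v; case: (E v).
  rewrite /fubini_F /f /=.
  have := IH Fx j (Cc_slice _ cF); rewrite pE; apply => [y|].
    by case: (E y).
  exact: Cc_slice.
(* [i] is the first coordinate: it is integrated first, and the integrand is the derivative of a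
   compactly supported function of one variable. *)
rewrite -integral21_prod_meas1//; apply: integral0_eq => t _.
rewrite /fubini_G /f /=; set v := row_of_tuple t.
have [K FK] := cF.2; have [K' FK'] := cdF.2.
apply: (@integral_continuous_primitive _ (fun x => F (row_cons x v)) _
  (Num.max K K')).
- move=> x.
  have -> : (fun x => F (row_cons x v)) =
     (fun s => F (row_cons 0 v + s *: delta_mx ord0 i)).
    by apply/funext => s; rewrite -[in LHS](add0r s) row_cons_addl iE.
  have -> : row_cons x v = row_cons 0 v + x *: delta_mx ord0 i.
    by rewrite -[in LHS](add0r x) row_cons_addl iE.
  exact: derive_line.
- move=> x; apply: (continuous_comp (@row_cons_continuousl _ _ v x)).
  exact: cdF.1.
- move=> x; rewrite gt_max => /andP[K1 K2]; split.
    by apply: FK; apply: (lt_le_trans K1); exact: row_cons_ge_l.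
  by apply: FK'; apply: (lt_le_trans K2); exact: row_cons_ge_l.
Qed.

(** * Calculus of C^k functions *)

Lemma is_derive_continuous (R : realType) (f : R -> R) (x d : R) :
  is_derive x 1 f d -> {for x, continuous f}.
Proof.
by move=> [df _]; apply: differentiable_continuous; apply/derivable1_diffP.
Qed.

Lemma is_derive_comp_dir (R : realType) (V : normedModType R) (h : R -> R)
    (f : V -> R) (y v : V) (dh df : R) :
  is_derive (f y) 1 h dh -> is_derive y v f df ->
  is_derive y v (h \o f) (dh * df).
Proof.
move=> hh [hf fE]; apply: line_derive.
have := @derive_line _ _ f y v 0; rewrite scale0r addr0 fE => /(_ hf) h0.
have hh' : is_derive (f (y + (0 : R) *: v)) 1 h dh by rewrite scale0r addr0.
exact: (@is_derive1_comp _ h (fun s => f (y + s *: v)) 0 dh df).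
Qed.

Lemma Ck_continuous (R : realType) N k (f : 'rV[R]_N -> R) :
  Ck k f -> continuous f.
Proof. by case: k => [|k] []. Qed.

Lemma Ck_derivable (R : realType) N k (f : 'rV[R]_N -> R) i y : Ck k.+1 f ->
  derivable f y (delta_mx ord0 i).
Proof. by move=> [_ /(_ i) []]. Qed.

Lemma Ck_partial (R : realType) N k (f : 'rV[R]_N -> R) i : Ck k.+1 f ->
  Ck k (partial i f).
Proof. by move=> [_ /(_ i) []]. Qed.

Lemma Ck_is_derive (R : realType) N k (f : 'rV[R]_N -> R) i y : Ck k.+1 f ->
  is_derive y (delta_mx ord0 i) f (partial i f y).
Proof. by move=> /Ck_derivable df; split. Qed.

(** Membership in C^k is shown by exhibiting formulas for the partial derivatives. *)
Lemma CkS (R : realType) N k (f : 'rV[R]_N -> R) (g : 'I_N -> 'rV[R]_N -> R) :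
  continuous f -> (forall i y, is_derive y (delta_mx ord0 i) f (g i y)) ->
  (forall i, Ck k (g i)) -> Ck k.+1 f.
Proof.
move=> cf df cg; split=> // i; split=> [y|]; first by case: (df i y).
rewrite (_ : partial i f = g i)//.
by apply/funext => y; case: (df i y).
Qed.

Lemma partialE (R : realType) N (f : 'rV[R]_N -> R) i y (d : R) :
  is_derive y (delta_mx ord0 i) f d -> partial i f y = d.
Proof. by case. Qed.

Lemma CkW (R : realType) N k (f : 'rV[R]_N -> R) : Ck k.+1 f -> Ck k f.
Proof.
elim: k f => [f [cf _]//|k IH f [cf h]]; split=> // i.
by have [df /IH] := h i.
Qed.

Lemma Ck_cst (R : realType) N k (c : R) : Ck k (fun _ : 'rV[R]_N => c).
Proof.
elim: k c => [c|k IH c]; first by split=> // y; exact: cst_continuous.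
apply: (@CkS _ _ _ _ (fun _ _ => 0)) => //; first by move=> y; exact: cst_continuous.
Qed.

Lemma CkD (R : realType) N k (f g : 'rV[R]_N -> R) : Ck k f -> Ck k g ->
  Ck k (fun y => f y + g y).
Proof.
have cD (f0 g0 : 'rV[R]_N -> R) k0 : Ck k0 f0 -> Ck k0 g0 ->
    continuous (fun y => f0 y + g0 y).
  by move=> /Ck_continuous cf /Ck_continuous cg y; exact: cvgD (cf y) (cg y).
elim: k f g => [f g cf cg|k IH f g cf cg]; first by split=> //; exact: cD cf cg.
apply: (@CkS _ _ _ _ (fun i y => partial i f y + partial i g y)).
- exact: cD cf cg.
- move=> i y.
  exact: (@is_deriveD _ _ _ f g y _ _ _ (Ck_is_derive i y cf) (Ck_is_derive i y cg)).
- by move=> i; apply: IH; exact: Ck_partial.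
Qed.

Lemma CkM (R : realType) N k (f g : 'rV[R]_N -> R) : Ck k f -> Ck k g ->
  Ck k (fun y => f y * g y).
Proof.
have cM (f0 g0 : 'rV[R]_N -> R) k0 : Ck k0 f0 -> Ck k0 g0 ->
    continuous (fun y => f0 y * g0 y).
  by move=> /Ck_continuous cf /Ck_continuous cg y; exact: cvgM (cf y) (cg y).
elim: k f g => [f g cf cg|k IH f g cf cg]; first by split=> //; exact: cM cf cg.
apply: (@CkS _ _ _ _ (fun i y => f y * partial i g y + g y * partial i f y)).
- exact: cM cf cg.
- move=> i y.
  exact: (@is_deriveM _ _ f g y _ _ _ (Ck_is_derive i y cf) (Ck_is_derive i y cg)).
- move=> i; apply: CkD; apply: IH; solve [exact: CkW | exact: Ck_partial].
Qed.

Lemma Ck_sum (R : realType) N k n (f : 'I_n -> 'rV[R]_N -> R) :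
  (forall j, Ck k (f j)) -> Ck k (fun y => \sum_j f j y).
Proof.
elim: n f => [f _|n IH f h].
  by under eq_fun do rewrite big_ord0; exact: Ck_cst.
under eq_fun do rewrite big_ord_recl.
by apply: CkD => //; apply: IH.
Qed.

Lemma CkX (R : realType) N k (f : 'rV[R]_N -> R) n : Ck k f ->
  Ck k (fun y => f y ^+ n).
Proof.
move=> cf; elim: n => [|n IH]; first by under eq_fun do rewrite expr0; exact: Ck_cst.
by under eq_fun do rewrite exprS; exact: CkM.
Qed.

Lemma is_derive_coord (R : realType) N (i j : 'I_N) (y : 'rV[R]_N) :
  is_derive y (delta_mx ord0 i) (fun z : 'rV[R]_N => z ord0 j) (i == j)%:R.
Proof.
apply: line_derive.
rewrite (_ : (fun s : R => _) = (fun s : R => y ord0 j + s * (i == j)%:R)); last first.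
  by apply/funext => s; rewrite !mxE eqxx eq_sym.
set c : R := (i == j)%:R; set a := y ord0 j.
rewrite (_ : (fun s : R => _) = cst a + (c \*: (@id R))); last first.
  by apply/funext => s; rewrite fctE /= mulrC.
by apply: is_derive_eq; rewrite add0r; exact: mulr1.
Qed.

Lemma Ck_coord (R : realType) N k (j : 'I_N) : Ck k (fun z : 'rV[R]_N => z ord0 j).
Proof.
have cc : continuous (fun z : 'rV[R]_N => z ord0 j) by exact: coord_continuous.
case: k => [//|k]; apply: (@CkS _ _ _ _ (fun i _ => (i == j)%:R)) => //.
  by move=> i y; exact: is_derive_coord.
by move=> i; exact: Ck_cst.
Qed.

(** [d] lists a function followed by its successive derivatives on [D]. The index [j] varies in the
    induction because the chain rule turns [d j] into [d j.+1]. *)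
Lemma Ck_comp (R : realType) N k (D : R -> Prop) (d : nat -> R -> R) j
    (f : 'rV[R]_N -> R) :
  (forall n x, D x -> is_derive x 1 (d n) (d n.+1 x)) -> (forall y, D (f y)) ->
  Ck k f -> Ck k (fun y => d j (f y)).
Proof.
move=> dd fD; have cc m k0 : Ck k0 f -> continuous (fun y => d m (f y)).
  move=> /Ck_continuous cf y; apply: (continuous_comp (cf y)).
  exact: is_derive_continuous (dd _ _ (fD y)).
elim: k j => [|k IH] j cf; first by split=> //; exact: cc cf.
apply: (@CkS _ _ _ _ (fun i y => d j.+1 (f y) * partial i f y)).
- exact: cc cf.
- move=> i y; apply: is_derive_comp_dir; [exact: dd|exact: Ck_is_derive cf].
- by move=> i; apply: CkM; [apply: IH; exact: CkW|exact: Ck_partial].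
Qed.

Lemma partial_eq0_out (R : realType) N (f : 'rV[R]_N -> R) K i :
  (forall y, K < `|y| -> f y = 0) -> forall y, K < `|y| -> partial i f y = 0.
Proof.
move=> fK y Ky; rewrite /partial.
rewrite (@near_eq_derive _ _ _ _ (cst 0)) ?derive_cst//.
have oK : open [set z : 'rV[R]_N | K < `|z|].
  by apply: (@open_comp _ _ (fun z : 'rV[R]_N => `|z|) [set x | K < x]);
    [move=> z _; exact: norm_continuous|exact: open_gt].
by have := open_nbhs_nbhs (conj oK Ky); apply: filterS => z; exact: fK.
Qed.

Lemma bounded_support_partial (R : realType) N (f : 'rV[R]_N -> R) i :
  bounded_support f -> bounded_support (partial i f).
Proof. by move=> [K fK]; exists K; exact: partial_eq0_out. Qed.

(** * A smooth flat function, cutoffs and mollifiers *)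

Lemma scaler_mul (R : realType) (a b : R) : a *: b = a * b.
Proof. by []. Qed.

(* [flat_poly n] is the polynomial P with (exp(-1/x))^(n) = P(1/x) exp(-1/x). *)
Fixpoint flat_poly (R : realType) (n : nat) : {poly R} :=
  if n is m.+1 then 'X^2 * (flat_poly R m - (flat_poly R m)^`()) else 1.

Definition flat (R : realType) (n : nat) (x : R) : R :=
  if 0 < x then (flat_poly R n).[x^-1] * expR (- x^-1) else 0.

Lemma exprn_le_expR (R : realType) n (t : R) : 0 <= t ->
  t ^+ n <= n%:R ^+ n * expR t.
Proof.
move=> t0; case: n => [|n]; first by rewrite !expr0 mul1r -expR0 ler_expR.
have -> : t = n.+1%:R * (t / n.+1%:R) by rewrite mulrCA mulfV ?mulr1.
rewrite exprMn ler_wpM2l ?exprn_ge0// expRM_natl lerXn2r ?nnegrE ?expR_ge0 ?divr_ge0//.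
by apply: le_trans (expR_ge1Dx _); rewrite lerDr.
Qed.

Lemma poly_expR_bound (R : realType) (Q : {poly R}) :
  exists2 C, 0 <= C & forall t, 0 < t -> t * `|Q.[t]| * expR (- t) <= C.
Proof.
exists (\sum_(i < size Q) `|Q`_i| * i.+1%:R ^+ i.+1).
  by apply: sumr_ge0 => i _; rewrite mulr_ge0// exprn_ge0.
move=> t t0; rewrite expRN ler_pdivrMr ?expR_gt0// mulr_suml horner_coef.
apply: (@le_trans _ _ (t * (\sum_(i < size Q) `|Q`_i * t ^+ i|))).
  by apply: ler_wpM2l; [exact: ltW|exact: ler_norm_sum].
rewrite mulr_sumr; apply: ler_sum => i _.
rewrite normrM [`|t ^+ i|]ger0_norm ?(exprn_ge0 _ (ltW t0))// mulrCA -exprS -mulrA.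
by apply: ler_wpM2l => //; apply: exprn_le_expR; exact: ltW.
Qed.

Lemma flat_pos (R : realType) n (x : R) : 0 < x ->
  flat n x = (flat_poly R n).[x^-1] * expR (- x^-1).
Proof. by rewrite /flat => ->. Qed.

Lemma flat_neg (R : realType) n (x : R) : x <= 0 -> flat n x = 0.
Proof. by rewrite /flat leNgt; case: ifP. Qed.

Lemma is_derive_flat (R : realType) n (x : R) :
  is_derive x 1 (@flat R n) (flat n.+1 x).
Proof.
have [x0|x0|->] := ltgtP x 0.
- rewrite flat_neg ?ltW//; apply: (@near_eq_is_derive _ _ _ (cst 0)).
  by near=> z; rewrite /= flat_neg// ltW//; near: z; exact: lt_nbhsl.
- apply: (@near_eq_is_derive _ R R (fun z : R => (flat_poly R n).[z^-1] * expR (- z^-1))).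
  + by near=> z; rewrite flat_pos//; near: z; exact: lt_nbhsr.
  + have iV : is_derive x 1 (fun z : R => z^-1) (- (x ^-2)).
      have x1 : (@id R) x != 0 by rewrite /= gt_eqF.
      split; first exact: (@derivableV _ _ (@id R) x 1 x1).
      by rewrite (@deriveV _ _ (@id R) x 1 x1)// derive_id; exact: mulr1.
    have h1 := @is_derive1_comp _ _ _ x _ _ (is_derive_poly (flat_poly R n) x^-1) iV.
    have h2 : is_derive x 1 (fun z : R => expR (- z^-1)) (expR (- x^-1) * - - (x ^-2)).
      exact: (@is_derive1_comp _ expR (fun z : R => - z^-1) x _ _ (is_derive_expR _)
        (@is_deriveN _ _ _ (fun z : R => z^-1) x 1 _ iV)).
    apply: (is_derive_eq (is_deriveM h1 h2)).
    rewrite flat_pos// /= !hornerE /=.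
    rewrite ![_ *: _]mulrC -exprVn; ring.
- rewrite flat_neg//.
  (* With t = 1/h, the extra factor 'X gives t^2 |P(t)| exp(-t) <= C, so the difference quotient at
     0 is at most C h. *)
  have [C C0 hC] := poly_expR_bound ('X * flat_poly R n).
  have C1 : 0 < C + 1 by lra.
  have H : (fun h : R => h^-1 *: ((flat n \o shift (0 : R)) (h *: (1 : R)) - flat n 0)) @ 0^' --> (0 : R).
    apply/cvgr0Pnorm_le => e e0; near=> h.
    rewrite /shift /= addr0 [h *: 1]mulr1 [flat n 0]flat_neg// subr0.
    have [h0|h0] := ltP 0 h; last by rewrite (flat_neg _ h0) scaler0 normr0 ltW.
    rewrite flat_pos// [_ *: _]mulrA.
    have hi : 0 < h^-1 by rewrite invr_gt0.
    have := hC _ hi; rewrite hornerM hornerX -mulrA mulrC -ler_pdivlMr// invrK => H.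
    rewrite normrM [`|expR _|]ger0_norm ?expR_ge0//; apply: (le_trans H).
    have hC1 : `|h| < e / (C + 1) by near: h; apply: dnbhs0_lt; exact: divr_gt0.
    by move: hC1; rewrite ltr_pdivlMr// gtr0_norm//; nra.
  split; [by apply/cvg_ex; exists 0|exact: cvg_lim H].
Unshelve. all: by end_near.
Qed.

Lemma flat0_pos (R : realType) (x : R) : 0 < x -> flat 0 x = expR (- x^-1).
Proof. by move=> x0; rewrite flat_pos//= hornerC mul1r. Qed.

Lemma flat0_ge0 (R : realType) (x : R) : 0 <= flat 0 x.
Proof.
have [x0|x0] := ltP 0 x; last by rewrite flat_neg.
by rewrite flat0_pos// expR_ge0.
Qed.

Lemma flat0_gt0 (R : realType) (x : R) : 0 < x -> 0 < flat 0 x.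
Proof. by move=> x0; rewrite flat0_pos// expR_gt0. Qed.

Lemma le_flat0 (R : realType) (x y : R) : x <= y -> flat 0 x <= flat 0 y.
Proof.
move=> xy; have [x0|x0] := ltP 0 x; last by rewrite flat_neg// flat0_ge0.
have y0 := lt_le_trans x0 xy.
by rewrite !flat0_pos// ler_expR lerN2 lef_pV2.
Qed.

(** The function is x^-2 exp(-1/x) for x > 0, and 4 is the constant 2^2 of [exprn_le_expR]. *)
Lemma flat1_bound (R : realType) (x : R) : 0 <= flat 1 x <= 4.
Proof.
have [x0|x0] := ltP 0 x; last by rewrite flat_neg//; lra.
have xi : 0 < x^-1 by rewrite invr_gt0.
rewrite flat_pos//= derivC subr0 mulr1 hornerXn mulr_ge0 ?expR_ge0 ?exprn_ge0 ?(ltW xi)//=.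
rewrite expRN ler_pdivrMr ?expR_gt0//.
by have := exprn_le_expR 2 (ltW xi); rewrite -natrX.
Qed.

(** The squared Euclidean norm is a polynomial, whereas [enorm] is not differentiable at 0. *)
Definition sqn (R : realType) N (y : 'rV[R]_N) : R := \sum_i y ord0 i ^+ 2.

Lemma sqn_ge0 (R : realType) N (y : 'rV[R]_N) : 0 <= sqn y.
Proof. by apply: sumr_ge0 => i _; exact: sqr_ge0. Qed.

Lemma enorm_sqr (R : realType) N (y : 'rV[R]_N) : enorm y ^+ 2 = sqn y.
Proof. by rewrite sqr_sqrtr// sqn_ge0. Qed.

Lemma coord_sqr_le (R : realType) N (y : 'rV[R]_N) i : y ord0 i ^+ 2 <= sqn y.
Proof.
by rewrite /sqn (bigD1 i)//= lerDl; apply: sumr_ge0 => j _; exact: sqr_ge0.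
Qed.

Lemma norm_sqr_le_sqn (R : realType) N (y : 'rV[R]_N) : `|y| ^+ 2 <= sqn y.
Proof.
rewrite -enorm_sqr ler_sqr ?nnegrE// ?sqrtr_ge0//.
apply: rV_norm_ler => [|i]; first exact: sqrtr_ge0.
by rewrite -ler_sqr ?nnegrE ?sqrtr_ge0// enorm_sqr real_normK ?num_real// coord_sqr_le.
Qed.

Lemma Ck_sqn (R : realType) N k : Ck k (@sqn R N).
Proof. by apply: Ck_sum => j; apply: CkX; exact: Ck_coord. Qed.

Lemma is_derive_sqn (R : realType) N i (y : 'rV[R]_N) :
  is_derive y (delta_mx ord0 i) (@sqn R N) (2 * y ord0 i).
Proof.
have -> : @sqn R N = \sum_j (fun y : 'rV[R]_N => y ord0 j ^+ 2).
  by apply/funext => z; rewrite fct_sumE.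
have h j : is_derive y (delta_mx ord0 i) (fun y : 'rV[R]_N => y ord0 j ^+ 2)
   (2 * y ord0 j * (i == j)%:R).
  have := @is_deriveX _ _ (fun z : 'rV[R]_N => z ord0 j) 2 y _ _ (is_derive_coord i j y).
  by rewrite expr1 /= mulr_natl => H; exact: H.
apply: (is_derive_eq (is_derive_sum h)).
rewrite (bigD1 i)//= eqxx mulr1 big1 ?addr0// => j /negbTE.
by rewrite eq_sym => ->; rewrite mulr0.
Qed.

Lemma partial_sqn (R : realType) N i (y : 'rV[R]_N) : partial i (@sqn R N) y = 2 * y ord0 i.
Proof. exact/partialE/is_derive_sqn. Qed.

(** The inner [flat] vanishes for |y| <= r and reaches [flat 0 1] at |y| = sqrt 2 r, from where the
    argument of the outer one is nonpositive. The cutoff is thus 1 on the ball of radius r and 0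
    outside that of radius sqrt 2 r, and the nesting keeps the denominator constant. *)
Definition cutoff (R : realType) N (r : R) (y : 'rV[R]_N) : R :=
  flat 0 (flat 0 1 - flat 0 (sqn y / r ^+ 2 - 1)) / flat 0 (flat 0 1).

Lemma Ck_cutoff (R : realType) N (r : R) k : Ck k (@cutoff R N r).
Proof.
apply: CkM; last exact: Ck_cst.
have dF n (x : R) : True -> is_derive x 1 (@flat R n) (flat n.+1 x).
  by move=> _; exact: is_derive_flat.
apply: (Ck_comp 0 dF) => //.
have := @CkD R N k (cst (flat 0 1)) (fun y => (- 1) * flat 0 (sqn y / r ^+ 2 - 1)).
under [X in _ -> _ -> Ck _ X]eq_fun do rewrite mulN1r.
apply; first exact: Ck_cst.
apply: CkM; first exact: Ck_cst.
apply: (Ck_comp 0 dF) => //.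
by apply: CkD; [apply: CkM; [exact: Ck_sqn|exact: Ck_cst]|exact: Ck_cst].
Qed.

Lemma flat00_gt0 (R : realType) : 0 < flat 0 (flat 0 (1 : R)).
Proof. by do 2 apply: flat0_gt0. Qed.

Lemma cutoff_ge0 (R : realType) N (r : R) (y : 'rV[R]_N) : 0 <= cutoff r y.
Proof. by rewrite divr_ge0// flat0_ge0. Qed.

Lemma cutoff_le1 (R : realType) N (r : R) (y : 'rV[R]_N) : cutoff r y <= 1.
Proof.
rewrite ler_pdivrMr ?flat00_gt0// mul1r le_flat0// gerBl.
exact: flat0_ge0.
Qed.

Lemma cutoff_eq1 (R : realType) N (r : R) (y : 'rV[R]_N) : 0 < r ->
  sqn y <= r ^+ 2 -> cutoff r y = 1.
Proof.
move=> r0 yr; rewrite /cutoff (@flat_neg _ _ (_ - 1)); last first.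
  by rewrite subr_le0 ler_pdivrMr ?mul1r// exprn_gt0.
by rewrite subr0 mulfV// gt_eqF// flat00_gt0.
Qed.

Lemma cutoff_arg_neg (R : realType) N (r : R) (y : 'rV[R]_N) : 0 < r ->
  2 * r ^+ 2 <= sqn y -> flat 0 1 - flat 0 (sqn y / r ^+ 2 - 1) <= 0.
Proof.
by move=> r0 yr; rewrite subr_le0 le_flat0// lerBrDr ler_pdivlMr ?exprn_gt0//.
Qed.

Lemma cutoff_eq0 (R : realType) N (r : R) (y : 'rV[R]_N) : 0 < r ->
  2 * r ^+ 2 <= sqn y -> cutoff r y = 0.
Proof. by move=> r0 yr; rewrite /cutoff flat_neg ?mul0r// cutoff_arg_neg. Qed.

Lemma partial_cutoff (R : realType) N (r : R) (y : 'rV[R]_N) i :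
  partial i (cutoff r) y =
  - (flat 1 (flat 0 1 - flat 0 (sqn y / r ^+ 2 - 1)) / flat 0 (flat 0 1) *
   flat 1 (sqn y / r ^+ 2 - 1) * (2 / r ^+ 2)) * y ord0 i.
Proof.
apply: partialE.
have h1 : is_derive y (delta_mx ord0 i) (fun z : 'rV[R]_N => sqn z / r ^+ 2 - 1)
    ((r ^+ 2)^-1 * (2 * y ord0 i)).
  apply: (@is_derive_comp_dir _ _ (fun s : R => s / r ^+ 2 - 1) (@sqn R N)); last exact: is_derive_sqn.
  rewrite (_ : (fun s : R => _) = ((r ^+ 2)^-1 \*: (@id R)) + cst (-1)); last first.
    by apply/funext => s; rewrite fctE /= mulrC.
  by apply: is_derive_eq; rewrite subr0; exact: mulr1.
have h2 := is_derive_comp_dir (is_derive_flat 0 _) h1.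
have h3 : is_derive y (delta_mx ord0 i) (fun z : 'rV[R]_N =>
    flat 0 1 - flat 0 (sqn z / r ^+ 2 - 1))
    (- (flat 1 (sqn y / r ^+ 2 - 1) * ((r ^+ 2)^-1 * (2 * y ord0 i)))).
  have := @is_deriveB _ _ _ (cst (flat 0 1)) _ y (delta_mx ord0 i) _ _
     (is_derive_cst _ _ _) h2.
  by rewrite sub0r.
have h4 := is_derive_comp_dir (is_derive_flat 0 _) h3.
have := @is_deriveZ _ _ _ _ (flat 0 (flat 0 1))^-1 _ _ _ h4.
rewrite (_ : _ \*: _ = cutoff r); last first.
  by apply/funext => z; exact: mulrC.
move=> h5; apply: (is_derive_eq h5); rewrite scaler_mul; ring.
Qed.

Lemma partial_cutoff_inner (R : realType) N (r : R) (y : 'rV[R]_N) i : 0 < r ->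
  sqn y <= r ^+ 2 -> partial i (cutoff r) y = 0.
Proof.
move=> r0 yr; rewrite partial_cutoff (@flat_neg _ 1 (_ - 1)).
  by rewrite mulr0 mul0r oppr0 mul0r.
by rewrite subr_le0 ler_pdivrMr ?mul1r// exprn_gt0.
Qed.

(** 32 is 4 * 4 * 2: two bounds [flat1_bound] and the factor 2 from the derivative of |y|^2. The
    remaining |y|^2 is at most 2 r^2 where the gradient does not vanish. *)
Lemma grad_sqr_cutoff_le (R : realType) N (r : R) (y : 'rV[R]_N) : 0 < r ->
  grad_sqr (cutoff r) y <= 2 * (32 / flat 0 (flat 0 1)) ^+ 2 / r ^+ 2.
Proof.
move=> r0; have rr : 0 < r ^+ 2 by rewrite exprn_gt0.
have c0 := flat00_gt0 R.
rewrite /grad_sqr; under eq_bigr do rewrite partial_cutoff exprMn sqrrN.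
rewrite -mulr_sumr -/(sqn y).
have [yr|yr] := leP (2 * r ^+ 2) (sqn y).
  rewrite (flat_neg _ (cutoff_arg_neg r0 yr)) !mul0r expr0n /= mul0r.
  by rewrite divr_ge0 ?(ltW rr)// mulr_ge0// sqr_ge0.
set a := flat 1 _; set b := flat 1 _; set c := flat 0 _ in c0 *.
have /andP[a0 a4] : 0 <= a <= 4 by exact: flat1_bound.
have /andP[b0 b4] : 0 <= b <= 4 by exact: flat1_bound.
have H : a / c * b * (2 / r ^+ 2) <= 32 / c / r ^+ 2.
  rewrite (_ : a / c * b * (2 / r ^+ 2) = a * b * 2 / c / r ^+ 2); last by ring.
  by rewrite ler_pM2r ?invr_gt0// ler_pM2r ?invr_gt0//; nra.
have H0 : 0 <= a / c * b * (2 / r ^+ 2).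
  by rewrite !mulr_ge0 ?invr_ge0 ?(ltW c0) ?(ltW rr).
apply: (@le_trans _ _ ((32 / c / r ^+ 2) ^+ 2 * (2 * r ^+ 2))).
  by apply: ler_pM; rewrite ?sqr_ge0 ?sqn_ge0 ?(ltW yr)// lerXn2r ?nnegrE ?(le_trans H0).
rewrite le_eqVlt; apply/orP; left; apply/eqP; field.
by rewrite !gt_eqF.
Qed.

(** Not normalised: convolutions are divided by the mass [convol (cst 1) (mollifier e) 0]. *)
Definition mollifier (R : realType) N (e : R) (y : 'rV[R]_N) : R :=
  flat 0 (1 - sqn y / e ^+ 2).

Lemma Ck_mollifier (R : realType) N (e : R) k : Ck k (@mollifier R N e).
Proof.
have dF n (x : R) : True -> is_derive x 1 (@flat R n) (flat n.+1 x).
  by move=> _; exact: is_derive_flat.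
apply: (Ck_comp 0 dF) => //.
have := @CkD R N k (cst 1) (fun y => (- 1) * (sqn y / e ^+ 2)).
under [X in _ -> _ -> Ck _ X]eq_fun do rewrite mulN1r.
apply; first exact: Ck_cst.
by apply: CkM; [exact: Ck_cst|apply: CkM; [exact: Ck_sqn|exact: Ck_cst]].
Qed.

Lemma mollifier_ge0 (R : realType) N (e : R) (y : 'rV[R]_N) : 0 <= mollifier e y.
Proof. exact: flat0_ge0. Qed.

Lemma mollifier_eq0 (R : realType) N (e : R) (y : 'rV[R]_N) : 0 < e ->
  e <= `|y| -> mollifier e y = 0.
Proof.
move=> e0 ey; apply: flat_neg.
rewrite subr_le0 ler_pdivlMr ?exprn_gt0// mul1r (le_trans _ (norm_sqr_le_sqn y))//.
by rewrite lerXn2r ?nnegrE ?(ltW e0)//.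
Qed.

Lemma bounded_support_cutoff (R : realType) N (r : R) : 0 < r ->
  bounded_support (@cutoff R N r).
Proof.
move=> r0; exists (2 * r) => y ry; apply: cutoff_eq0 => //.
apply: le_trans (norm_sqr_le_sqn y); have := normr_ge0 y; nra.
Qed.

(** * Mollification *)

Lemma MVT_everywhere (R : realType) (f df : R -> R) (a b : R) :
  (forall x : R, is_derive x 1 f (df x)) ->
  exists2 c, `|c - a| <= `|b - a| & f b - f a = df c * (b - a).
Proof.
move=> h; have ct x : {for x, continuous f} by exact: is_derive_continuous (h x).
have [ab|ba] := leP a b.
  have [c] := @MVT_segment _ f df a b ab (fun x _ => h x) (continuous_subspaceT ct).
  rewrite in_itv /= => /andP[ac cb] E; exists c => //.
  by rewrite !ger0_norm ?subr_ge0// lerB.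
have [c] := @MVT_segment _ f df b a (ltW ba) (fun x _ => h x) (continuous_subspaceT ct).
rewrite in_itv /= => /andP[bc ca] E; exists c.
  by rewrite distrC (distrC b) !ger0_norm ?subr_ge0// ?(ltW ba)// lerB.
by rewrite -opprB E -mulrN opprB.
Qed.

Lemma MVT_dir (R : realType) (V : normedModType R) (F : V -> R) (y v : V) (h : R) :
  (forall z, derivable F z v) ->
  exists2 t, `|t| <= `|h| & F (y + h *: v) - F y = h * 'D_v F (y + t *: v).
Proof.
move=> dF.
have [t] := @MVT_everywhere _ (fun s : R => F (y + s *: v))
  (fun s => 'D_v F (y + s *: v)) 0 h (fun s => derive_line (dF _)).
rewrite !subr0 scale0r addr0 => th E; exists t => //.
by rewrite E mulrC.
Qed.

Lemma Cc_uniform_continuous (R : realType) N (f : 'rV[R]_N -> R) (e : R) : Cc f ->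
  0 < e -> exists2 d, 0 < d & forall y z, `|y - z| <= d -> `|f y - f z| <= e.
Proof.
move=> [cf [K fK]] e0.
have cB := @norm_ball_compact R N (K + 1).
move/compact_near_coveringP: cB => /(_ R (0^'+)
  (fun d y => forall z, `|y - z| <= d -> `|f y - f z| <= e)) H.
have {H} : \forall d \near 0^'+, [set y : 'rV[R]_N | `|y| <= K + 1] `<=`
    (fun y => forall z, `|y - z| <= d -> `|f y - f z| <= e).
  apply: H => x _.
  have e2 : 0 < e / 2 by rewrite divr_gt0.
  have /cvgrPdist_le /(_ _ e2) /nbhs_ballP [r /= r0 hr] := cf x.
  have r2 : 0 < r / 2 by rewrite divr_gt0.
  exists (ball x (r / 2), [set d | d < r / 2]) => /=.
    split; first exact: nbhsx_ballx.
    exact: nbhs_right_lt.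
  move=> [y d] /= [yx dr] z yz.
  rewrite -ball_normE /= in yx.
  have h1 : `|f x - f y| <= e / 2.
    by apply: hr; rewrite -ball_normE /=; apply: lt_trans yx _; rewrite ltr_pdivrMr//; lra.
  have h2 : `|f x - f z| <= e / 2.
    apply: hr; rewrite -ball_normE /= (le_lt_trans (ler_distD y _ _))//.
    by rewrite [ltRHS]splitr ltrD// (le_lt_trans yz).
  apply: (le_trans (ler_distD (f x) _ _)).
  by rewrite [leRHS]splitr lerD// distrC.
move=> H.
near (0 : R)^'+ => d.
exists d; first by near: d; exact: nbhs_right_gt.
(* Since d <= 1, a point y outside the ball of radius K + 1 has all its neighbours z outside that of
   radius K, and f vanishes at both. *)
have d1 : d <= 1 by near: d; apply: nbhs_right_le.
move=> y z yz; have [yK|yK] := leP `|y| (K + 1).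
  by apply: (near H d) => //.
rewrite !fK ?subrr ?normr0 ?ltW//.
  have := ler_distD z y 0; rewrite !subr0; lra.
by apply: le_lt_trans yK; lra.
Unshelve. all: by end_near.
Qed.

Lemma CcM (R : realType) N (f g : 'rV[R]_N -> R) : continuous f -> Cc g ->
  Cc (fun y => f y * g y).
Proof.
move=> cf [cg [K gK]]; split; last by exists K => y /gK ->; rewrite mulr0.
by move=> y; exact: cvgM (cf y) (cg y).
Qed.

Lemma CcD (R : realType) N (f g : 'rV[R]_N -> R) : Cc f -> Cc g ->
  Cc (fun y => f y + g y).
Proof.
move=> [cf [K fK]] [cg [K' gK]]; split; first by move=> y; exact: cvgD (cf y) (cg y).
by exists (Num.max K K') => y; rewrite gt_max => /andP[/fK -> /gK ->]; rewrite addr0.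
Qed.

Lemma CcZ (R : realType) N (f : 'rV[R]_N -> R) (k : R) : Cc f -> Cc (fun y => k * f y).
Proof. by move=> cf; apply: CcM => // y; exact: cst_continuous. Qed.

Lemma RN_int_norm_le (R : realType) N (f : 'rV[R]_N -> R) (M K : R) : Cc f ->
  0 <= M -> 0 <= K -> (forall y, `|y| <= K -> `|f y| <= M) ->
  (forall y, K < `|y| -> f y = 0) -> `|RN_int f| <= M * (2 * K) ^+ N.
Proof.
move=> cf M0 K0 fM fK; rewrite ler_norml; apply/andP; split; last first.
  apply: RN_int_le_box => // y yK; last by rewrite fK.
  by apply: le_trans (fM _ yK); exact: ler_norm.
rewrite lerNl -mulN1r -RN_intZ//; apply: RN_int_le_box => //.
- exact: CcZ.
- by move=> y yK; apply: le_trans (fM _ yK); rewrite mulN1r -[leRHS]normrN ler_norm.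
- by move=> y yK; rewrite fK// mulr0.
Qed.

Lemma CcB (R : realType) N (f g : 'rV[R]_N -> R) : Cc f -> Cc g ->
  Cc (fun y => f y - g y).
Proof.
move=> cf cg; have := CcD cf (CcZ (-1) cg).
by congr Cc; apply/funext => z; rewrite mulN1r.
Qed.

Lemma RN_intB (R : realType) N (f g : 'rV[R]_N -> R) : Cc f -> Cc g ->
  RN_int (fun y => f y - g y) = RN_int f - RN_int g.
Proof.
move=> cf cg; rewrite -mulN1r -RN_intZ// -RN_intD//; last exact: CcZ.
by congr RN_int; apply/funext => y; rewrite mulN1r.
Qed.

Lemma Cc_reflect (R : realType) N (g : 'rV[R]_N -> R) y : Cc g ->
  Cc (fun z => g (y - z)).
Proof.
move=> [cg [K gK]]; split.
  have cB : continuous (fun z : 'rV[R]_N => y - z).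
    by apply: lip1_continuous => u v; rewrite opprD opprK addrACA subrr add0r addrC distrC.
  by move=> z; apply: (continuous_comp (cB z)); exact: cg.
exists (`|y| + K) => z yz; apply: gK.
by rewrite -ltrBrDl in yz; apply: (lt_le_trans yz); rewrite distrC lerB_dist.
Qed.

Definition convol (R : realType) N (f g : 'rV[R]_N -> R) y : R :=
  RN_int (fun z => f z * g (y - z)).

Lemma Cc_convol_arg (R : realType) N (f g : 'rV[R]_N -> R) y : continuous f ->
  Cc g -> Cc (fun z => f z * g (y - z)).
Proof. by move=> cf cg; apply: CcM => //; exact: Cc_reflect. Qed.

(** [C] does not depend on [G] and [e]. It is applied to small differences of translated kernels,
    all supported in one ball. *)
Lemma convol_norm_le (R : realType) N (f : 'rV[R]_N -> R) (y : 'rV[R]_N) (K : R) :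
  continuous f -> exists2 C, 0 < C &
   forall (e : R) (G : 'rV[R]_N -> R), 0 <= e -> Cc G ->
     (forall z, `|G z| <= e) -> (forall z, K < `|z| -> G z = 0) ->
     `|RN_int (fun z => f z * G z)| <= C * e.
Proof.
move=> cf; have [M M0 fM] := continuous_bounded_ball `|K| cf.
exists (M * (2 * `|K|) ^+ N + 1) => [|e G e0 cG Ge GK].
  by rewrite ltr_wpDl// mulr_ge0// exprn_ge0// mulr_ge0.
apply: (@le_trans _ _ ((M * e) * (2 * `|K|) ^+ N)); last first.
  have : 0 <= (2 * `|K|) ^+ N by rewrite exprn_ge0// mulr_ge0.
  by nra.
apply: RN_int_norm_le => //; first exact: CcM.
- exact: mulr_ge0.
- by move=> z zK; rewrite normrM ler_pM// fM.
- by move=> z zK; rewrite GK ?mulr0// (le_lt_trans (ler_norm K)).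
Qed.

Lemma reflect_eq0 (R : realType) N (g : 'rV[R]_N -> R) (K : R) y z :
  (forall w, K < `|w| -> g w = 0) -> `|y| + K < `|z| -> g (y - z) = 0.
Proof.
move=> gK; rewrite -ltrBrDl => yz; apply: gK; apply: (lt_le_trans yz).
by rewrite distrC lerB_dist.
Qed.

Lemma norm_delta_mx_le1 (R : realType) N (i : 'I_N) :
  `|delta_mx ord0 i : 'rV[R]_N| <= 1.
Proof.
apply: rV_norm_ler => // j; rewrite mxE eqxx /=.
by case: (_ == _); rewrite ?normr1 ?normr0.
Qed.

Lemma near_norm_le (R : realType) (V : normedModType R) (y : V) (d : R) : 0 < d ->
  \forall z \near y, `|y - z| <= d.
Proof. by move: d; apply/cvgrPdist_le; exact: cvg_id. Qed.

Lemma continuous_norm_le (R : realType) (V W : normedModType R) (f : V -> W) :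
  (forall y e, 0 < e -> \forall z \near y, `|f y - f z| <= e) -> continuous f.
Proof. by move=> h y; apply/cvgrPdist_le => e; exact: h. Qed.

Lemma convol_continuous (R : realType) N (f g : 'rV[R]_N -> R) : continuous f ->
  Cc g -> continuous (convol f g).
Proof.
move=> cf cg; apply: continuous_norm_le => y e e0.
have [K gK] := cg.2.
have [C C0 hC] := convol_norm_le y (`|y| + 1 + K) cf.
have eC : 0 < e / C by rewrite divr_gt0.
have [d d0 hd] := Cc_uniform_continuous cg eC.
near=> y'.
have yd : `|y - y'| <= d by near: y'; exact: (near_norm_le y d0).
have y1 : `|y - y'| <= 1 by near: y'; exact: (near_norm_le y ltr01).
rewrite -RN_intB; [|exact: Cc_convol_arg..].
rewrite (_ : (fun z => _) = (fun z => f z * (g (y - z) - g (y' - z)))); last first.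
  by apply/funext => z; rewrite mulrBr.
rewrite -[leRHS](divfK (lt0r_neq0 C0)) mulrC; apply: hC.
- exact: ltW.
- by apply: CcB; exact: Cc_reflect.
- by move=> z; apply: hd; rewrite opprB addrA subrK.
- move=> z Kz; rewrite !(reflect_eq0 gK) ?subrr//.
    apply: le_lt_trans Kz; rewrite lerD2r.
    have := ler_distD y y' 0; rewrite !subr0 distrC; lra.
  by apply: le_lt_trans Kz; lra.
Unshelve. all: by end_near.
Qed.

(** By the mean value theorem the difference quotient of g is its partial derivative at a nearby
    point; uniform continuity of that derivative gives uniform convergence under the integral. *)
Lemma convol_is_derive (R : realType) N (f g : 'rV[R]_N -> R) i y : continuous f ->
  Ck 1 g -> bounded_support g ->
  is_derive y (delta_mx ord0 i) (convol f g) (convol f (partial i g) y).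
Proof.
move=> cf cg sg.
have Cg : Cc g by split=> //; exact: Ck_continuous cg.
have Cdg : Cc (partial i g).
  by split; [exact: Ck_continuous (Ck_partial i cg)|exact: bounded_support_partial].
have H : (fun h : R => h^-1 *: ((convol f g \o shift y) (h *: delta_mx ord0 i) -
    convol f g y)) @ 0^' --> convol f (partial i g) y.
  apply/cvgrPdist_le => e e0.
  have [K0 gK0] := Cg.2; have [K1 gK1] := Cdg.2.
  pose K := Num.max K0 K1.
  have [C C0 hC] := convol_norm_le y (`|y| + 1 + K) cf.
  have eC : 0 < e / C by rewrite divr_gt0.
  have [d d0 hd] := Cc_uniform_continuous Cdg eC.
  near=> h.
  have h0 : h != 0 by near: h; exact: nbhs_dnbhs_neq.
  have hd1 : `|h| < d by near: h; exact: dnbhs0_lt.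
  have h1 : `|h| < 1 by near: h; exact: dnbhs0_lt.
  have hE : `|h *: (delta_mx ord0 i : 'rV[R]_N)| <= `|h|.
    by rewrite normrZ ler_piMr// norm_delta_mx_le1.
  rewrite /convol /= scaler_mul -RN_intB; [|exact: Cc_convol_arg..].
  rewrite -RN_intZ; last by apply: CcB; exact: Cc_convol_arg.
  have C1 : Cc (fun z => h^-1 * (g (h *: delta_mx ord0 i + y - z) - g (y - z))).
    by apply: CcZ; apply: CcB; exact: Cc_reflect.
  rewrite -RN_intB; [|exact: Cc_convol_arg|]; last first.
    have := CcM cf C1.
    by congr Cc; apply/funext => z; ring.
  rewrite (_ : (fun z => _) = (fun z => f z * (partial i g (y - z) -
     h^-1 * (g (h *: delta_mx ord0 i + y - z) - g (y - z))))); last first.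
    by apply/funext => z; ring.
  rewrite -[leRHS](divfK (lt0r_neq0 C0)) mulrC; apply: hC.
  - exact: ltW.
  - by apply: CcB => //; exact: Cc_reflect.
  - move=> z.
    have [t th] := @MVT_dir _ _ g (y - z) (delta_mx ord0 i) h
      (fun w => Ck_derivable cg).
    rewrite (_ : h *: delta_mx ord0 i + y - z = y - z + h *: delta_mx ord0 i); last first.
      by rewrite -addrA addrC.
    move=> ->; rewrite mulKf//; apply: hd.
    rewrite opprD addrA subrr add0r normrN normrZ.
    apply: (@le_trans _ _ `|t|); last by rewrite (le_trans th)// ltW.
    by rewrite ler_piMr// norm_delta_mx_le1.
  - move=> z Kz.
    have KK : K0 <= K /\ K1 <= K by rewrite /K !le_max !lexx orbT.
    rewrite (reflect_eq0 gK1); last by apply: le_lt_trans Kz; lra.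
    rewrite !(reflect_eq0 gK0) ?subrr ?mulr0 ?subr0//.
      by apply: le_lt_trans Kz; lra.
    apply: le_lt_trans Kz; have := ler_normD (h *: (delta_mx ord0 i : 'rV[R]_N)) y.
    lra.
split; [by apply/cvg_ex; exists (convol f (partial i g) y)|exact: cvg_lim H].
Unshelve. all: by end_near.
Qed.

Definition smooth (R : realType) N (f : 'rV[R]_N -> R) := forall k, Ck k f.

Lemma smooth_partial (R : realType) N (f : 'rV[R]_N -> R) i : smooth f ->
  smooth (partial i f).
Proof. by move=> sf k; exact: Ck_partial (sf k.+1). Qed.

Lemma convol_smooth (R : realType) N (f g : 'rV[R]_N -> R) : continuous f ->
  smooth g -> bounded_support g -> smooth (convol f g).
Proof.
move=> cf sg bg k; elim: k g sg bg => [|k IH] g sg bg.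
  by split=> //; apply: convol_continuous => //; split=> //; exact: (sg 0%N).1.
apply: (@CkS _ _ _ _ (fun i => convol f (partial i g))).
- by apply: convol_continuous => //; split=> //; exact: (sg 0%N).1.
- by move=> i y; exact: convol_is_derive.
- move=> i; apply: IH; [exact: smooth_partial|exact: bounded_support_partial].
Qed.

(** Integration by parts: the partial derivative of z |-> f z * g (y - z) has integral 0. *)
Lemma convol_partial_swap (R : realType) N (f g : 'rV[R]_N -> R) i y : Ck 1 f ->
  Ck 1 g -> bounded_support g ->
  convol f (partial i g) y = convol (partial i f) g y.
Proof.
move=> cf cg bg.
have Cg : Cc g by split=> //; exact: Ck_continuous cg.
have Cdg : Cc (partial i g).
  by split; [exact: Ck_continuous (Ck_partial i cg)|exact: bounded_support_partial].
have df := Ck_continuous (Ck_partial i cf).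
have cf0 := Ck_continuous cf.
pose G z := f z * g (y - z).
have dG z : is_derive z (delta_mx ord0 i) G
    (partial i f z * g (y - z) - f z * partial i g (y - z)).
  have h1 : is_derive z (delta_mx ord0 i) (fun w => g (y - w)) (- partial i g (y - z)).
    apply: line_derive.
    have := @derive_line _ _ g (y - z) (- delta_mx ord0 i) 0.
    have dgN : is_derive (y - z) (- delta_mx ord0 i) g (- partial i g (y - z)).
      apply: line_derive.
      have := @derive_line _ _ g (y - z) (delta_mx ord0 i) 0.
      rewrite scale0r addr0 => /(_ (Ck_derivable cg)) h.
      have h' : is_derive (- (0 : R)) 1 (fun s : R => g (y - z + s *: delta_mx ord0 i)) (partial i g (y - z)).
        by rewrite oppr0.
      have := @is_derive1_comp _ _ (fun s : R => - s) 0 _ _ h' (is_deriveN (is_derive_id _ _)).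
      rewrite mulrN1; congr is_derive.
      by apply/funext => s /=; rewrite scaleNr scalerN.
    rewrite scale0r addr0 => /(_ (@ex_derive _ _ _ _ _ _ _ dgN)).
    rewrite (@derive_val _ _ _ _ _ _ _ dgN); congr is_derive.
    by apply/funext => s; rewrite scalerN opprD addrA.
  apply: (is_derive_eq (is_deriveM (Ck_is_derive i z cf) h1)).
  by rewrite !scaler_mul; ring.
have pG : partial i G = fun z => partial i f z * g (y - z) - f z * partial i g (y - z).
  by apply/funext => z; apply: partialE.
have CA := Cc_convol_arg y df Cg; have CB := Cc_convol_arg y cf0 Cdg.
have := @RN_int_partial_eq0 _ _ G i (Cc_convol_arg y cf0 Cg) (fun z => @ex_derive _ _ _ _ _ _ _ (dG z)).
rewrite pG RN_intB// => h; apply/eqP; rewrite eq_sym -subr_eq0; apply/eqP; apply: h.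
exact: CcB.
Qed.

Lemma partials0_const (R : realType) N (c : 'rV[R]_N -> R) :
  (forall i y, is_derive y (delta_mx ord0 i) c 0) -> forall y, c y = c 0.
Proof.
move=> h y.
have step i w t : c (w + t *: delta_mx ord0 i) = c w.
  have [s _] := @MVT_dir _ _ c w (delta_mx ord0 i) t (fun z => @ex_derive _ _ _ _ _ _ _ (h i z)).
  by rewrite (@derive_val _ _ _ _ _ _ _ (h i _)) mulr0 => /eqP; rewrite subr_eq0 => /eqP.
have H (s : seq 'I_N) w : c (w + \sum_(j <- s) y ord0 j *: delta_mx ord0 j) = c w.
  elim: s w => [|i s IH] w; first by rewrite big_nil addr0.
  by rewrite big_cons addrA IH step.
have := H (index_enum _) 0; rewrite add0r => <-; congr c; exact: row_sum_delta.
Qed.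

Lemma Cc_mollifier (R : realType) N (e : R) : 0 < e -> Cc (@mollifier R N e).
Proof.
move=> e0; split; first exact: Ck_continuous (@Ck_mollifier R N e 0).
by exists e => y ey; rewrite mollifier_eq0// ltW.
Qed.

(** The mass is differentiable in y, and after swapping the derivative falls on the constant 1. This
    replaces translation invariance of the measure. *)
Lemma mollifier_mass_const (R : realType) N (e : R) (y : 'rV[R]_N) : 0 < e ->
  convol (cst 1) (mollifier e) y = convol (cst 1) (mollifier e) (0 : 'rV[R]_N).
Proof.
move=> e0; move: y; apply: partials0_const => i y.
have C1 : Ck 1 (cst 1 : 'rV[R]_N -> R) by exact: Ck_cst.
have bK := (Cc_mollifier N e0).2.
have := @convol_is_derive _ _ _ _ i y (Ck_continuous C1) (Ck_mollifier N e 1) bK.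
rewrite convol_partial_swap//; last exact: Ck_mollifier.
congr is_derive.
rewrite /convol (_ : (fun z => _) = (fun z => 0 * mollifier e (y - z))).
  by rewrite RN_intZ ?mul0r//; apply: Cc_reflect; exact: Cc_mollifier.
apply/funext => z; congr (_ * _); apply: partialE; exact: is_derive_cst.
Qed.

Lemma mollifier_mass_gt0 (R : realType) N (e : R) : 0 < e ->
  0 < convol (cst 1) (mollifier e) (0 : 'rV[R]_N).
Proof.
move=> e0.
(* On the cube of half-side b, |z|^2 <= N b^2 <= e^2 / (4 (N + 1)) <= e^2 / 2, so the kernel is at
   least [flat 0 2^-1]. Using N + 1 covers N = 0. *)
pose b := e / (2 * N.+1%:R).
have N1 : (1 : R) <= N.+1%:R by rewrite ler1n.
have N0 : (0 : R) < N.+1%:R by [].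
have b0 : 0 < b by rewrite divr_gt0// mulr_gt0.
have f0 : 0 < flat 0 (2^-1 : R) by rewrite flat0_gt0.
have H : flat 0 2^-1 * (b - - b) ^+ N <= convol (cst 1) (mollifier e) (0 : 'rV[R]_N).
  apply: RN_int_ge_box.
  - apply: Cc_convol_arg; last exact: Cc_mollifier.
    by move=> z; exact: cst_continuous.
  - by rewrite ge0_cp// ltW.
  - by move=> z; rewrite mul1r mollifier_ge0.
  - move=> z zb; rewrite mul1r sub0r; apply: le_flat0.
    rewrite lerBrDr -lerBrDl ler_pdivrMr ?exprn_gt0//.
    have zz i : (- z) ord0 i ^+ 2 <= b ^+ 2.
      by rewrite mxE sqrrN; have /andP[] := zb i; nra.
    have : sqn (- z) <= \sum_(i < N) b ^+ 2 by exact: ler_sum.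
    rewrite sumr_const card_ord => /le_trans; apply.
    apply: (@le_trans _ _ (N.+1%:R * b ^+ 2)).
      by rewrite -[leLHS]mulr_natl; apply: ler_wpM2r; rewrite ?sqr_ge0// ler_nat.
    have -> : N.+1%:R * b ^+ 2 = e ^+ 2 / (4 * N.+1%:R).
      by rewrite /b; field; rewrite gt_eqF.
    rewrite ler_pdivrMr ?mulr_gt0//.
    have := exprn_gt0 2 e0; nra.
by apply: lt_le_trans H; rewrite mulr_gt0// exprn_gt0// opprK addr_gt0.
Qed.

Lemma convol_close (R : realType) N (f : 'rV[R]_N -> R) (e d : R) y :
  0 < e -> continuous f -> 0 <= d ->
  (forall z, `|y - z| <= e -> `|f z - f y| <= d) ->
  `|convol f (mollifier e) y / convol (cst 1) (mollifier e) (0 : 'rV[R]_N) - f y| <= d.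
Proof.
move=> e0 cf d0 hd.
have c0 := mollifier_mass_gt0 N e0.
have Ck0 := Cc_mollifier N e0.
have CR := Cc_reflect y Ck0.
have C1 : Cc (fun z => (f z - f y) * mollifier e (y - z)).
  by apply: CcM => // z; exact: (cvgB (cf z) (@cst_continuous _ _ (f y) z)).
have mE : RN_int (fun z => mollifier e (y - z)) = convol (cst 1) (mollifier e) (0 : 'rV[R]_N).
  rewrite -(mollifier_mass_const y e0).
  by congr RN_int; apply/funext => z; rewrite mul1r.
move: (convol (cst 1) (mollifier e) (0 : 'rV[R]_N)) c0 mE => c c0 mE.
have E : convol f (mollifier e) y - f y * c =
    RN_int (fun z => (f z - f y) * mollifier e (y - z)).
  rewrite -mE -RN_intZ// /convol -RN_intB//; [|exact: Cc_convol_arg|exact: CcZ].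
  by congr RN_int; apply/funext => z; rewrite mulrBl.
rewrite -[X in _ - X](mulfK (lt0r_neq0 c0)) -mulrBl E normrM normfV.
rewrite [`|c|]gtr0_norm// ler_pdivrMr// -mE -RN_intZ//.
have P z : `|f z - f y| * mollifier e (y - z) <= d * mollifier e (y - z).
  have [yz|yz] := leP `|y - z| e; first by rewrite ler_wpM2r ?mollifier_ge0// hd.
  by rewrite mollifier_eq0 ?mulr0// ltW.
rewrite ler_norml; apply/andP; split.
  rewrite -mulN1r -RN_intZ//; last exact: CcZ.
  apply: le_RN_int => //; first by apply: CcZ; exact: CcZ.
  move=> z; have := P z; have := mollifier_ge0 e (y - z).
  have := ler_norm (- (f z - f y)); rewrite normrN; nra.
apply: le_RN_int => //; first exact: CcZ.
by move=> z; apply: le_trans (P z); rewrite ler_wpM2r ?mollifier_ge0// ler_norm.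
Qed.

Lemma smooth_approx (R : realType) N (f : 'rV[R]_N -> R) (K d : R) :
  Ck 1 f -> (forall y, K < `|y| -> f y = 0) -> 0 < d ->
  exists g : 'rV[R]_N -> R, [/\ smooth g, forall y, K + 1 < `|y| -> g y = 0,
    forall y, `|g y - f y| <= d &
    forall i y, `|partial i g y - partial i f y| <= d].
Proof.
move=> cf fK d0.
have bf : bounded_support f by exists K.
have Cf : Cc f by split=> //; exact: Ck_continuous cf.
have Cdf i : Cc (partial i f).
  by split; [exact: Ck_continuous (Ck_partial i cf)|exact: bounded_support_partial].
have [e e0 he] : exists2 e, 0 < e & forall y z, `|y - z| <= e ->
   `|f y - f z| <= d /\ forall i, `|partial i f y - partial i f z| <= d.
  have [e0 e00 h0] := Cc_uniform_continuous Cf d0.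
  have /choice [e1 h1] : forall i, exists e : R, 0 < e /\ forall y z, `|y - z| <= e ->
      `|partial i f y - partial i f z| <= d.
    by move=> i; have [e1 e10 h1] := Cc_uniform_continuous (Cdf i) d0; exists e1.
  exists (\big[Num.min/e0]_i e1 i).
    by apply: lt_bigmin => // i _; case: (h1 i).
  move=> y z yz; split.
    by apply: h0; apply: (le_trans yz); exact: bigmin_le_id.
  by move=> i; apply: (h1 i).2; apply: (le_trans yz); exact: bigmin_le.
(* A kernel radius of at most 1 keeps the support within radius K + 1. *)
pose e' := Num.min e 1.
have e'0 : 0 < e' by rewrite lt_min e0 ltr01.
have e'e : e' <= e by rewrite ge_min lexx.
have e'1 : e' <= 1 by rewrite ge_min lexx orbT.
have bK := (Cc_mollifier N e'0).2.
have cf0 := Ck_continuous cf.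
pose c := convol (cst 1) (mollifier e') (0 : 'rV[R]_N).
exists (fun y => convol f (mollifier e') y / c).
have sg : smooth (convol f (mollifier e')).
  by apply: convol_smooth => // k; exact: Ck_mollifier.
split.
- by move=> k; apply: CkM; [exact: sg|exact: Ck_cst].
- move=> y yK; rewrite /convol (_ : (fun z => _) = (fun z => 0 * f z)).
    by rewrite RN_intZ// !mul0r.
  apply/funext => z; rewrite mul0r.
  have [zK|zK] := leP `|z| K; last by rewrite fK// mul0r.
  rewrite mollifier_eq0 ?mulr0//.
  have := ler_distD z y 0; rewrite !subr0; lra.
- move=> y; apply: convol_close => //; first exact: ltW.
  by move=> z yz; apply: (he _ _ _).1; rewrite distrC (le_trans yz).
- move=> i y.
  rewrite (_ : partial i _ y = convol (partial i f) (mollifier e') y / c).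
    apply: convol_close => //; [exact: (Cdf i).1|exact: ltW|].
    by move=> z yz; apply: (he _ _ _).2; rewrite distrC (le_trans yz).
  rewrite -(convol_partial_swap i y cf (Ck_mollifier N e' 1) bK).
  apply: partialE.
  have h := convol_is_derive i y cf0 (Ck_mollifier N e' 1) bK.
  have := @is_deriveZ _ _ _ _ c^-1 _ _ _ h.
  rewrite scaler_mul mulrC; congr is_derive.
  by apply/funext => z; exact: mulrC.
Qed.

(** * Stability tested on C^1 functions *)

Lemma powR_norm_continuous (R : realType) (a : R) : 0 < a ->
  continuous (fun x : R => `|x| `^ a).
Proof.
move=> a0 x; have [->|x0] := eqVneq x 0.
  apply/cvgrPdist_le => e e0.
  have h : 0 < e `^ a^-1 by rewrite powR_gt0.
  near=> z.
  rewrite normr0 powR0 ?gt_eqF// sub0r normrN ger0_norm ?powR_ge0//.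
  have ze : `|z| <= e `^ a^-1.
    by near: z; move: (near_norm_le (0 : R) h); apply: filterS => z; rewrite sub0r normrN.
  rewrite -[leRHS](powRr1 (ltW e0)) -(mulVf (lt0r_neq0 a0)) powRrM.
  by apply: ge0_ler_powR; rewrite ?nnegrE ?powR_ge0// ltW.
apply: (@continuous_comp _ _ _ (fun x : R => `|x|) (fun x => x `^ a)).
  exact: norm_continuous.
by apply: (is_derive_continuous (is_derive1_powR a _)); rewrite normr_gt0.
Unshelve. all: by end_near.
Qed.

Lemma enorm_continuous (R : realType) N : continuous (@enorm R N).
Proof.
move=> y; apply: (@continuous_comp _ _ _ (@sqn R N) Num.sqrt).
  exact: (Ck_continuous (@Ck_sqn R N 0)).
exact: sqrt_continuous.
Qed.

Lemma enorm_powR_continuous (R : realType) N (a : R) : 0 <= a ->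
  continuous (fun y : 'rV[R]_N => enorm y `^ a).
Proof.
rewrite le_eqVlt => /predU1P[<-|a0].
  by under eq_fun do rewrite powRr0; move=> y; exact: cst_continuous.
rewrite (_ : (fun y => _) = (fun x : R => `|x| `^ a) \o @enorm R N).
  move=> y; apply: (continuous_comp (@enorm_continuous _ _ y)).
  exact: powR_norm_continuous.
by apply/funext => y /=; rewrite ger0_norm// sqrtr_ge0.
Qed.

Definition powR_coef (R : realType) (p : R) (n : nat) : R :=
  \prod_(k < n) (p - k%:R).

Lemma is_derive_powR_iter (R : realType) (p : R) n (x : R) : 0 < x ->
  is_derive x 1 (fun x => powR_coef p n * x `^ (p - n%:R))
    (powR_coef p n.+1 * x `^ (p - n.+1%:R)).
Proof.
move=> x0; have := @is_deriveZ _ _ _ _ (powR_coef p n) x 1 _ (is_derive1_powR (p - n%:R) x0).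
congr is_derive; rewrite /powR_coef big_ord_recr /= scaler_mul mulrA -addrA -opprD.
by rewrite -natr1.
Qed.

Lemma Ck_powR (R : realType) N k (p : R) (U : 'rV[R]_N -> R) : Ck k U ->
  (forall y, 0 < U y) -> Ck k (fun y => U y `^ p).
Proof.
move=> cU U0; have := Ck_comp 0 (@is_derive_powR_iter R p) U0 cU.
by congr Ck; apply/funext => y; rewrite /powR_coef big_ord0 mul1r subr0.
Qed.

Lemma is_derive_powR_dir (R : realType) N (p : R) (U : 'rV[R]_N -> R) i y :
  Ck 1 U -> 0 < U y ->
  is_derive y (delta_mx ord0 i) (fun y => U y `^ p)
    (p * U y `^ (p - 1) * partial i U y).
Proof.
move=> cU U0.
exact: (is_derive_comp_dir (is_derive1_powR p U0) (Ck_is_derive i y cU)).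
Qed.

Lemma grad_sqr_continuous (R : realType) N (f : 'rV[R]_N -> R) : Ck 1 f ->
  continuous (grad_sqr f).
Proof.
move=> cf; apply: (@Ck_continuous _ _ 0); apply: Ck_sum => i; apply: CkX.
exact: Ck_partial.
Qed.

Lemma Cc_grad_sqr (R : realType) N (f : 'rV[R]_N -> R) : Ck 1 f ->
  bounded_support f -> Cc (grad_sqr f).
Proof.
move=> cf bf; split; first exact: grad_sqr_continuous.
have [K fK] := bf; exists K => y yK.
rewrite /grad_sqr big1// => i _.
by rewrite (partial_eq0_out i fK)// expr0n.
Qed.

Lemma CcX2 (R : realType) N (f : 'rV[R]_N -> R) : Cc f -> Cc (fun y => f y ^+ 2).
Proof. by move=> cf; under eq_fun do rewrite expr2; apply: CcM => //; exact: cf.1. Qed.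

Lemma test_function_bounded_support (R : realType) N (f : 'rV[R]_N -> R) :
  test_function f -> bounded_support f.
Proof.
move=> [_ /compact_bounded [M [_ hM]]]; exists (`|M| + 1) => y yM.
apply: contrapT => /eqP fy.
have fc : closure [set y | f y != 0] y by apply: subset_closure.
have := hM (`|M| + 1) _ y fc.
rewrite (le_lt_trans (ler_norm _)) ?ltrDl// => /(_ isT).
by move=> /=; rewrite leNgt yM.
Qed.

Lemma smooth_test_function (R : realType) N (f : 'rV[R]_N -> R) :
  smooth f -> bounded_support f -> test_function f.
Proof.
move=> sf [K fK]; split=> //.
have cl : closed [set y : 'rV[R]_N | `|y| <= K].
  by apply: (@closed_comp _ _ (fun y : 'rV[R]_N => `|y|) [set x | x <= K]);
    [move=> y _; exact: norm_continuous|exact: closed_le].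
apply: bounded_closed_compact; last exact: closed_closure.
exists K; split=> [|x Kx y]; first exact: num_real.
have sub : closure [set y | f y != 0] `<=` [set y : 'rV[R]_N | `|y| <= K].
  rewrite [X in _ `<=` X](closure_id _).1//; apply: closure_subset.
  by move=> z /=; apply: contraNT; rewrite -ltNge => /fK ->.
by move=> /sub /= /le_trans -> //; exact: ltW.
Qed.

Lemma partialZ (R : realType) N (f : 'rV[R]_N -> R) (k : R) i y :
  derivable f y (delta_mx ord0 i) ->
  partial i (fun z => k * f z) y = k * partial i f y.
Proof. by move=> df; apply: partialE; apply: is_deriveZ; exact: derivableP. Qed.

Definition rayleigh (R : realType) N (V f : 'rV[R]_N -> R) (y : 'rV[R]_N) : R :=
  grad_sqr f y - V y * f y ^+ 2.

Lemma Cc_rayleigh (R : realType) N (V f : 'rV[R]_N -> R) : continuous V ->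
  Ck 1 f -> bounded_support f -> Cc (rayleigh V f).
Proof.
move=> cV cf bf; apply: CcB; first exact: Cc_grad_sqr.
by apply: CcM => //; apply: CcX2; split=> //; exact: Ck_continuous cf.
Qed.

(** A negative energy would survive an approximation of f and of its gradient within d, since the
    energy moves by at most C d vol < - A. *)
Lemma stable_C1 (R : realType) N (V : 'rV[R]_N -> R) : continuous V ->
  (forall f, smooth f -> bounded_support f -> 0 <= RN_int (rayleigh V f)) ->
  forall f, Ck 1 f -> bounded_support f -> 0 <= RN_int (rayleigh V f).
Proof.
move=> cV hV f cf /[dup] bf [K0 fK0]; rewrite leNgt; apply/negP => A0.
set A := RN_int (rayleigh V f) in A0.
pose K := `|K0|.
have fK y : K < `|y| -> f y = 0.
  by move=> Ky; apply: fK0; apply: le_lt_trans Ky; exact: ler_norm.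
have Cf : Cc f by split=> //; exact: Ck_continuous cf.
have [Mf Mf0 hMf] := Cc_bounded Cf.
have Cdf i : Cc (partial i f).
  by split; [exact: Ck_continuous (Ck_partial i cf)|exact: bounded_support_partial].
have /choice [Md hMd] : forall i, exists M, forall y, `|partial i f y| <= M.
  by move=> i; have [M _ h] := Cc_bounded (Cdf i); exists M.
have [MV MV0 hMV] := continuous_bounded_ball (K + 1) cV.
(* From |a^2 - b^2| <= (2 M + 1) d when |b| <= M and |a - b| <= d <= 1, used for each partial
   derivative and for f itself. *)
pose C := \sum_i (2 * `|Md i| + 1) + MV * (2 * Mf + 1).
have C0 : 0 <= C.
  apply: addr_ge0; last by apply: mulr_ge0 => //; lra.
  by apply: sumr_ge0 => i _; have := normr_ge0 (Md i); lra.
pose vol : R := (2 * (K + 1)) ^+ N.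
have K0' : 0 <= K + 1 by rewrite /K addr_ge0.
have vol0 : 0 <= vol by rewrite exprn_ge0// mulr_ge0.
have Cv : 0 < C * vol + 1 by rewrite ltr_wpDl// mulr_ge0.
pose d := Num.min 1 (- A / (C * vol + 1)).
have d0 : 0 < d by rewrite lt_min ltr01/= divr_gt0// oppr_gt0.
have d1 : d <= 1 by rewrite ge_min lexx.
have dA : d * (C * vol + 1) <= - A by rewrite -ler_pdivlMr// ge_min lexx orbT.
have [g [sg gK gf dgf]] := smooth_approx cf fK d0.
have bg : bounded_support g by exists (K + 1).
have Cg := Cc_rayleigh cV (sg 1%N) bg.
have Cff := Cc_rayleigh cV cf bf.
have key : `|RN_int (fun y => rayleigh V g y - rayleigh V f y)| <= (C * d) * vol.
  apply: RN_int_norm_le => //; [exact: CcB|by rewrite mulr_ge0// ltW| |].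
  - move=> y yK.
    have sq (a b M : R) : `|a - b| <= d -> `|b| <= M -> `|a ^+ 2 - b ^+ 2| <= (2 * M + 1) * d.
      move=> ab bM; rewrite subr_sqr normrM mulrC ler_pM//.
      rewrite (_ : a + b = (a - b) + 2 * b); last by ring.
      apply: (le_trans (ler_normD _ _)); rewrite normrM ger0_norm//; lra.
    rewrite /rayleigh (_ : _ - _ = (grad_sqr g y - grad_sqr f y) -
      V y * (g y ^+ 2 - f y ^+ 2)); last by ring.
    apply: (le_trans (ler_normB _ _)); rewrite mulrDl lerD//.
      rewrite -sumrB mulr_suml; apply: (le_trans (ler_norm_sum _ _ _)).
      apply: ler_sum => i _; apply: sq; first exact: dgf.
      by apply: le_trans (hMd i y) _; exact: ler_norm.
    rewrite normrM -mulrA ler_pM//; first exact: hMV.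
    by apply: sq.
  - move=> y yK.
    have vanish h : (forall z, K + 1 < `|z| -> h z = 0) -> rayleigh V h y = 0.
      move=> hK; rewrite /rayleigh hK// expr0n mulr0 subr0 /grad_sqr big1// => i _.
      by rewrite (partial_eq0_out i hK)// expr0n.
    rewrite !vanish ?subrr// => z Kz; apply: fK.
    by apply: lt_trans Kz; rewrite ltrDl.
move: key; rewrite RN_intB//.
have := hV g sg bg; have := ler_norm (RN_int (rayleigh V g) - RN_int (rayleigh V f)).
rewrite -/A; lra.
Qed.

Lemma Ck1_partial_bounded_support (R : realType) N (f : 'rV[R]_N -> R) i :
  Ck 1 f -> bounded_support f -> Cc (partial i f).
Proof.
by move=> cf bf; split; [exact: Ck_continuous (Ck_partial i cf)|exact: bounded_support_partial].
Qed.

Lemma rayleigh_ge0_normalize (R : realType) N (V f : 'rV[R]_N -> R) :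
  continuous V -> smooth f -> bounded_support f ->
  (forall g, smooth g -> bounded_support g -> RN_int (fun y => g y ^+ 2) = 1 ->
    0 <= RN_int (rayleigh V g)) -> 0 <= RN_int (rayleigh V f).
Proof.
move=> cV sf bf h.
have Cf : Cc f by split=> //; exact: Ck_continuous (sf 0%N).
have C2 := CcX2 Cf.
set s := RN_int (fun y => f y ^+ 2).
have C0 : Cc (fun _ : 'rV[R]_N => 0 : R).
  by split; [move=> y; exact: cst_continuous|exists 0].
have RN0 : RN_int (fun _ : 'rV[R]_N => 0 : R) = 0.
  rewrite (_ : (fun _ => _) = (fun y => 0 * f y ^+ 2)); first by rewrite RN_intZ// mul0r.
  by apply/funext => y; rewrite mul0r.
have s0 : 0 <= s by rewrite -RN0; apply: le_RN_int => // y; exact: sqr_ge0.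
have CR := Cc_rayleigh cV (sf 1%N) bf.
have [s00|s00] := eqVneq s 0.
  (* When f^2 has integral 0, no normalisation is possible, but the energy density is at least - M
     f^2, whose integral is 0. *)
  have [K fK] := bf; have [M M0 hM] := continuous_bounded_ball K cV.
  apply: (@le_trans _ _ (RN_int (fun y => (- M) * f y ^+ 2))).
    by rewrite RN_intZ// -/s s00 mulr0.
  apply: le_RN_int => //; first exact: CcZ.
  move=> y; rewrite /rayleigh.
  have g0 : 0 <= grad_sqr f y by apply: sumr_ge0 => i _; exact: sqr_ge0.
  have [yK|yK] := leP `|y| K; last by rewrite fK// expr0n/= !mulr0 subr0.
  have := hM y yK; have := ler_norm (V y); have := sqr_ge0 (f y); nra.
have sp : 0 < s by rewrite lt_neqAle eq_sym s00.
pose k := (Num.sqrt s)^-1.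
have k0 : 0 < k by rewrite invr_gt0 sqrtr_gt0.
have k2 : k ^+ 2 = s^-1 by rewrite exprVn sqr_sqrtr.
have sg : smooth (fun y => k * f y) by move=> n; apply: CkM => //; exact: Ck_cst.
have bg : bounded_support (fun y => k * f y).
  by have [K fK] := bf; exists K => y /fK ->; rewrite mulr0.
have := h _ sg bg; under eq_fun do rewrite exprMn k2.
rewrite RN_intZ// mulVf// => /(_ erefl).
rewrite (_ : rayleigh V _ = (fun y => s^-1 * rayleigh V f y)).
  by rewrite RN_intZ// pmulr_rge0// invr_gt0.
apply/funext => y; rewrite /rayleigh /grad_sqr.
under eq_bigr do rewrite (partialZ _ (Ck_derivable (sf 1%N))) exprMn k2.
by rewrite -mulr_sumr exprMn k2; ring.
Qed.

(** * Instability above the critical exponent *)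

Lemma sum_sqr_linear (R : realType) n (x y : R) (a b : 'I_n -> R) :
  \sum_i (x * a i + y * b i) ^+ 2 =
  x ^+ 2 * (\sum_i a i ^+ 2) + 2 * x * y * (\sum_i a i * b i) +
  y ^+ 2 * (\sum_i b i ^+ 2).
Proof.
rewrite !mulr_sumr -!big_split /=; apply: eq_bigr => i _; ring.
Qed.

Lemma RN_int_sum (R : realType) N n (f : 'I_n -> 'rV[R]_N -> R) :
  (forall j, Cc (f j)) ->
  Cc (fun y => \sum_j f j y) /\
  RN_int (fun y => \sum_j f j y) = \sum_j RN_int (f j).
Proof.
have C0 : Cc (fun _ : 'rV[R]_N => 0 : R).
  by split; [move=> y; exact: cst_continuous|exists 0].
elim: n f => [|n IH] f cf.
  under eq_fun do rewrite big_ord0; split=> //; rewrite big_ord0.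
  rewrite (_ : (fun _ => _) = (fun y : 'rV[R]_N => 0 * (0 : R))); last by apply/funext => y; rewrite mul0r.
  by rewrite RN_intZ// mul0r.
have [C1 E1] := IH (fun j => f (lift ord0 j)) (fun j => cf _).
under eq_fun do rewrite big_ord_recl.
split; first exact: CcD.
by rewrite RN_intD// E1 big_ord_recl.
Qed.

Lemma RN_int_divergence (R : realType) N (F : 'I_N -> 'rV[R]_N -> R) :
  (forall i, Ck 1 (F i)) -> (forall i, bounded_support (F i)) ->
  Cc (fun y => \sum_i partial i (F i) y) /\
  RN_int (fun y => \sum_i partial i (F i) y) = 0.
Proof.
move=> cF bF.
have [C E] := RN_int_sum (fun i => Ck1_partial_bounded_support i (cF i) (bF i)).
split=> //; rewrite E big1// => i _; apply: RN_int_partial_eq0.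
- by split=> //; exact: Ck_continuous (cF i).
- by move=> y; exact: Ck_derivable (cF i).
- exact: Ck1_partial_bounded_support.
Qed.

Lemma bounded_supportMl (R : realType) N (f g : 'rV[R]_N -> R) :
  bounded_support g -> bounded_support (fun y => f y * g y).
Proof. by move=> [K gK]; exists K => y /gK ->; rewrite mulr0. Qed.

Lemma bounded_supportMr (R : realType) N (f g : 'rV[R]_N -> R) :
  bounded_support f -> bounded_support (fun y => f y * g y).
Proof. by move=> [K fK]; exists K => y /fK ->; rewrite mul0r. Qed.

Definition potential (R : realType) N (alpha : R) (U : 'rV[R]_N -> R) y : R :=
  2 * enorm y `^ alpha / U y ^+ 3.

Lemma continuousM_V (R : realType) N (f g : 'rV[R]_N -> R) : continuous f ->
  continuous g -> (forall y, g y != 0) -> continuous (fun y => f y / g y).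
Proof.
by move=> cf cg g0 y; exact: cvgM (cf y) (cvgV (g0 y) (cg y)).
Qed.

Lemma continuousM_rV (R : realType) N (f g : 'rV[R]_N -> R) : continuous f ->
  continuous g -> continuous (fun y => f y * g y).
Proof. by move=> cf cg y; exact: cvgM (cf y) (cg y). Qed.

Lemma potential_continuous (R : realType) N (alpha : R) (U : 'rV[R]_N -> R) :
  0 <= alpha -> continuous U -> (forall y, 0 < U y) ->
  continuous (potential alpha U).
Proof.
move=> a0 cU U0; apply: continuousM_V.
- apply: continuousM_rV; first by move=> y; exact: cst_continuous.
  exact: enorm_powR_continuous.
- by under eq_fun do rewrite exprSr expr2; do 2 (apply: continuousM_rV => //).
- by move=> y; rewrite gt_eqF// exprn_gt0.
Qed.

(* With phi = U^(-q) psi, add lambda times the divergence of U^(-2q-1) psi^2 grad U to the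
   stability inequality for phi; completing the square absorbs the terms in grad U. *)
Lemma stable_weighted_estimate (R : realType) N (alpha q l : R) (U psi : 'rV[R]_N -> R) :
  0 <= alpha -> positive_solution alpha U ->
  (forall f, Ck 1 f -> bounded_support f ->
     0 <= RN_int (rayleigh (potential alpha U) f)) ->
  q ^+ 2 < l * (2 * q + 1) -> l < 2 -> smooth psi -> bounded_support psi ->
  (2 - l) * RN_int (fun y => enorm y `^ alpha / U y * (U y `^ (- q - 1) * psi y) ^+ 2) <=
  (1 + (l - q) ^+ 2 / (l * (2 * q + 1) - q ^+ 2)) *
    RN_int (fun y => (U y `^ (- q - 1) * U y) ^+ 2 * grad_sqr psi y).
Proof.
move=> a0 [cU [C0 C00 CU] eqU] stab hl l2 sp bp.
have U0 y : 0 < U y by exact: lt_le_trans (CU y).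
have cU1 := CkW cU; have cUc := Ck_continuous cU.
set k := l * (2 * q + 1) - q ^+ 2.
have k0 : 0 < k by rewrite subr_gt0.
(* With this X, the test function U^(-q) psi is X U psi, and all powers that occur are monomials in
   X and U, or their quotients, within reach of [field]. *)
pose X y := U y `^ (- q - 1).
have cX : Ck 1 X by exact: Ck_powR.
have dX i y : is_derive y (delta_mx ord0 i) X ((- q - 1) * (X y / U y) * partial i U y).
  apply: (is_derive_eq (is_derive_powR_dir (- q - 1) i cU1 (U0 y))).
  congr (_ * _ * _); rewrite powRB ?powRr1 ?(ltW (U0 y))//.
  by rewrite (gt_eqF (U0 y)) implybT.
pose phi y := X y * U y * psi y.
have cphi : Ck 1 phi by apply: CkM => //; exact: CkM.
have bphi : bounded_support phi by exact: bounded_supportMl.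
have dphi i y : partial i phi y =
   X y * (- q * psi y) * partial i U y + X y * U y * partial i psi y.
  apply: partialE; apply: (is_derive_eq (is_deriveM
    (is_deriveM (dX i y) (Ck_is_derive i y cU1)) (Ck_is_derive i y (sp 1%N)))).
  by rewrite !scaler_mul !fctE; field; rewrite gt_eqF.
pose F i y := X y * X y * U y * psi y * psi y * partial i U y.
have cF i : Ck 1 (F i).
  by apply: CkM; [do 4 (apply: CkM => //)|exact: Ck_partial cU].
have bF i : bounded_support (F i) by apply: bounded_supportMr; exact: bounded_supportMl.
have dF i y : partial i (F i) y =
   X y ^+ 2 * ((- (2 * q + 1)) * psi y ^+ 2 * partial i U y ^+ 2 +
     2 * U y * psi y * (partial i U y * partial i psi y) +
     U y * psi y ^+ 2 * partial i (partial i U) y).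
  apply: partialE; apply: (is_derive_eq (is_deriveM (is_deriveM (is_deriveM
    (is_deriveM (is_deriveM (dX i y) (dX i y)) (Ck_is_derive i y cU1))
    (Ck_is_derive i y (sp 1%N))) (Ck_is_derive i y (sp 1%N)))
    (Ck_is_derive i y (Ck_partial i cU)))).
  by rewrite !scaler_mul !fctE; field; rewrite gt_eqF.
have [CD ID] := RN_int_divergence cF bF.
set D := (fun y => \sum_i _) in CD ID.
have cV := potential_continuous a0 cUc U0.
have CR := Cc_rayleigh cV cphi bphi.
have S0 := stab _ cphi bphi.
set g := (fun y => enorm y `^ alpha / U y * _).
set d := (fun y => _ * grad_sqr psi y).
have cXc := Ck_continuous cX.
have Cg : Cc g.
  apply: CcM; first exact: (continuousM_V (enorm_powR_continuous a0) cUc (fun y => lt0r_neq0 (U0 y))).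
  by apply: CcX2; apply: CcM => //; split=> //; exact: Ck_continuous (sp 0%N).
have Cd : Cc d.
  apply: CcM; last exact: Cc_grad_sqr (sp 1%N) bp.
  by apply: (@Ck_continuous _ _ 1); apply: CkX; exact: CkM.
have key y : rayleigh (potential alpha U) phi y + l * D y <=
   (1 + (l - q) ^+ 2 / k) * d y - (2 - l) * g y.
  rewrite /rayleigh /grad_sqr; under eq_bigr do rewrite dphi.
  rewrite sum_sqr_linear.
  have -> : D y = X y ^+ 2 * ((- (2 * q + 1)) * psi y ^+ 2 * (\sum_i partial i U y ^+ 2) +
     2 * U y * psi y * (\sum_i partial i U y * partial i psi y) +
     U y * psi y ^+ 2 * (enorm y `^ alpha / U y ^+ 2)).
    rewrite -eqU /laplacian /D; under eq_bigr do rewrite dF.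
    by rewrite -mulr_sumr; congr (_ * _); rewrite !big_split /= -!mulr_sumr.
  (* In a = psi grad U and b = U grad psi, the difference of the two sides is X^2 times k |a|^2 - 2
     (l - q) a.b + ((l - q)^2 / k) |b|^2, that is X^2 |k a - (l - q) b|^2 / k. This dictates the
     constant in front of [d]. *)
  have := sum_sqr_linear (k * psi y) (- (l - q) * U y)
     (fun i => partial i U y) (fun i => partial i psi y).
  set A := \sum_i partial i U y ^+ 2; set B := \sum_i _ * _.
  set E := \sum_i partial i psi y ^+ 2 => H.
  have {H} : 0 <= (k * psi y) ^+ 2 * A + 2 * (k * psi y) * (- (l - q) * U y) * B +
     (- (l - q) * U y) ^+ 2 * E.
    by rewrite -H; apply: sumr_ge0 => i _; exact: sqr_ge0.
  rewrite -(pmulr_rge0 _ k0) => H.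
  have Y0 := sqr_ge0 (X y).
  rewrite /d /g /phi /potential -/(X y) -subr_ge0 /grad_sqr -/E.
  move: H; set w := enorm y `^ alpha; set u := U y; set x := X y; set p := psi y.
  have u0 : 0 < u by exact: U0.
  move=> H.
  have -> : (1 + (l - q) ^+ 2 / k) * ((x * u) ^+ 2 * E) -
     (2 - l) * (w / u * (x * p) ^+ 2) -
     ((x * (- q * p)) ^+ 2 * A + 2 * (x * (- q * p)) * (x * u) * B + (x * u) ^+ 2 * E -
       2 * w / u ^+ 3 * (x * u * p) ^+ 2 +
       l * (x ^+ 2 * (- (2 * q + 1) * p ^+ 2 * A + 2 * u * p * B + u * p ^+ 2 * (w / u ^+ 2)))) =
    x ^+ 2 / k ^+ 2 * (k * ((k * p) ^+ 2 * A + 2 * (k * p) * (- (l - q) * u) * B +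
      (- (l - q) * u) ^+ 2 * E)).
    rewrite /k; field; rewrite !gt_eqF//.
  by rewrite mulr_ge0// divr_ge0// sqr_ge0.
have CL : Cc (fun y => rayleigh (potential alpha U) phi y + l * D y).
  by apply: CcD => //; exact: CcZ.
have CRr : Cc (fun y => (1 + (l - q) ^+ 2 / k) * d y - (2 - l) * g y).
  exact: CcB (CcZ _ Cd) (CcZ _ Cg).
have := le_RN_int CL CRr key.
rewrite RN_intD//; last exact: CcZ.
rewrite RN_intZ// ID mulr0 addr0 (RN_intB (CcZ _ Cd) (CcZ _ Cg)).
rewrite !RN_intZ// => /(le_trans S0); rewrite subr_ge0; exact.
Qed.

(** For q slightly below 2 + sqrt 6 one has q^2 - 4 q - 2 < 0, which leaves room for l below 2. The
    bound 9 / 2 comes from sqrt 6 < 5 / 2 and lets eta^6 absorb a power of eta later. *)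
Lemma exponent_choice (R : realType) N (alpha : R) : 0 <= alpha ->
  alphaN R N < alpha ->
  exists q l : R, [/\ 0 < q, q <= 9 / 2, q ^+ 2 < l * (2 * q + 1), l < 2 &
    0 < 2 * q / 3 * (alpha + 2) + 2 - N%:R].
Proof.
move=> a0; rewrite /alphaN; set s := Num.sqrt 6 => aN.
have s0 : 0 <= s by exact: sqrtr_ge0.
have s2 : s ^+ 2 = 6 by rewrite sqr_sqrtr.
have sl : s < 5 / 2 by nra.
have sg : 2 < s by nra.
move: aN; rewrite ltr_pdivrMr; last by lra.
move=> aN.
(* Half of the amount by which q = 2 + s may decrease before 2 q (alpha + 2) = 3 N - 6; the bound 1
   keeps q away from 0. *)
pose e := Num.min 1 ((2 * (2 + s) * (alpha + 2) - (3 * N%:R - 6)) / (4 * (alpha + 2))).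
have a4 : 0 < 4 * (alpha + 2) by lra.
have e0 : 0 < e.
  by rewrite lt_min ltr01/= divr_gt0//; lra.
have e1 : e <= 1 by rewrite ge_min lexx.
have e2 : e * (4 * (alpha + 2)) <= 2 * (2 + s) * (alpha + 2) - (3 * N%:R - 6).
  by rewrite -ler_pdivlMr// ge_min lexx orbT.
pose q := 2 + s - e.
have qlo : 1 + s <= q by rewrite /q; lra.
have qhi : q < 2 + s by rewrite /q; lra.
have q2 : q ^+ 2 < 2 * (2 * q + 1) by nra.
have q1 : 0 < 2 * q + 1 by lra.
(* l is the midpoint of the admissible interval from q^2 / (2 q + 1) to 2. *)
exists q, ((q ^+ 2 / (2 * q + 1) + 2) / 2); split; [lra|lra| | |].
- rewrite (_ : _ * (2 * q + 1) = (q ^+ 2 + 2 * (2 * q + 1)) / 2); first by lra.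
  by field; rewrite gt_eqF.
- have : q ^+ 2 / (2 * q + 1) < 2 by rewrite ltr_pdivrMr.
  lra.
- have : 3 * N%:R - 6 < 2 * q * (alpha + 2) by rewrite /q; nra.
  lra.
Qed.

(** The weight is u^(-2q) = (u^3)^(-p) <= (t eta^2)^(-p) with p = 2 q / 3. Since p <= 3 and eta <=
    1, the factor eta^6 compensates eta^(-2p). *)
Lemma cutoff_powR_bound (R : realType) (q u t eta : R) : 0 < q -> q <= 9 / 2 ->
  0 < u -> 0 < t -> 0 < eta <= 1 -> t * eta ^+ 2 <= u ^+ 3 ->
  eta ^+ 6 * (u `^ (- q - 1) * u) ^+ 2 <= t `^ (- (2 * q / 3)).
Proof.
move=> q0 q9 u0 t0 /andP[n0 n1] H.
set p := 2 * q / 3.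
have p0 : 0 < p by rewrite /p; lra.
have u_ := ltW u0; have n_ := ltW n0.
have -> : u `^ (- q - 1) * u = (u `^ q)^-1.
  rewrite powRB ?(gt_eqF u0) ?implybT// powRr1// divfK ?(gt_eqF u0)//.
  exact: powRN.
have E : (u `^ q) ^+ 2 = (u ^+ 3) `^ p.
  rewrite -powR_mulrn ?powR_ge0// -powRrM -(powR_mulrn 3 u_) -powRrM.
  by congr (_ `^ _); rewrite /p; field.
have up : 0 < (u ^+ 3) `^ p by rewrite powR_gt0// exprn_gt0.
have tp : 0 < t `^ p by rewrite powR_gt0.
rewrite exprVn E powRN ler_pdivrMr// mulrC ler_pdivlMr//.
apply: (@le_trans _ _ ((t * eta ^+ 2) `^ p)); last first.
  apply: ge0_ler_powR; rewrite ?nnegrE ?exprn_ge0 ?(ltW p0)//.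
  by rewrite mulr_ge0 ?exprn_ge0 ?(ltW t0).
rewrite powRM ?exprn_ge0 ?(ltW t0)// mulrC ler_pM2l//.
rewrite -(powR_mulrn 2 n_) -powRrM -(powR_mulrn 6 n_).
by apply: ger_powR; rewrite ?n0// /p; lra.
Qed.

(** Let t = W r^2 / B with B = 16 C M / K1. If t eta^2 <= u^3, [cutoff_powR_bound] gives the last
    term. Otherwise 16 C M u^3 <= K1 w r^2 eta^2, and the first term on the right dominates, its
    eta^8 being the eta^6 of the gradient times eta^2. *)
Lemma cutoff_dichotomy (R : realType) (q u t eta G K1 C w W r M x : R) : 0 < q -> q <= 9 / 2 ->
  0 < u -> 0 < eta <= 1 -> 0 <= G -> G <= M / r ^+ 2 -> 0 < K1 -> 0 < C ->
  0 < W -> W <= w -> 0 < r -> 0 < M -> x = u `^ (- q - 1) ->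
  C * ((x * u) ^+ 2 * (16 * eta ^+ 6 * G)) <= K1 * (w / u * (x * eta ^+ 4) ^+ 2) +
    16 * C * M / r ^+ 2 * ((W * r ^+ 2) / (16 * C * M / K1)) `^ (- (2 * q / 3)).
Proof.
move=> q0 q9 u0 /andP[n0 n1] G0 GM K0 C0 W0 Ww r0 M0 xE.
have r2 : 0 < r ^+ 2 by rewrite exprn_gt0.
have n2 : 0 < eta ^+ 2 by rewrite exprn_gt0.
have n6 : 0 < eta ^+ 6 by rewrite exprn_gt0.
set B := 16 * C * M / K1.
have B0 : 0 < B by rewrite divr_gt0// !mulr_gt0.
have GE : C * ((x * u) ^+ 2 * (16 * eta ^+ 6 * G)) <=
    16 * C * M / r ^+ 2 * (eta ^+ 6 * (x * u) ^+ 2).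
  rewrite (_ : C * _ = (16 * C * (eta ^+ 6 * (x * u) ^+ 2)) * G); last by ring.
  rewrite (_ : 16 * C * M / r ^+ 2 * _ = (16 * C * (eta ^+ 6 * (x * u) ^+ 2)) * (M / r ^+ 2)); last by ring.
  apply: ler_wpM2l => //; apply: mulr_ge0; first by apply: ltW; rewrite mulr_gt0.
  by apply: mulr_ge0; [exact: ltW|exact: sqr_ge0].
apply: (le_trans GE).
have w0 : 0 < w by exact: lt_le_trans Ww.
have [h|h] := leP (W * r ^+ 2 / B * eta ^+ 2) (u ^+ 3).
  apply: (@le_trans _ _ (16 * C * M / r ^+ 2 * (W * r ^+ 2 / B) `^ (- (2 * q / 3)))).
    apply: ler_wpM2l; first by apply: ltW; rewrite divr_gt0// !mulr_gt0.
    rewrite xE; apply: cutoff_powR_bound => //; last by rewrite n0.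
    by rewrite divr_gt0// mulr_gt0.
  rewrite lerDr; apply: mulr_ge0; first exact: ltW.
  by apply: mulr_ge0; [rewrite divr_ge0 ?(ltW w0) ?(ltW u0)|exact: sqr_ge0].
apply: (@le_trans _ _ (K1 * (w / u * (x * eta ^+ 4) ^+ 2))); last first.
  rewrite lerDl mulr_ge0 ?powR_ge0//.
  by apply: ltW; rewrite divr_gt0// !mulr_gt0.
have h' : 16 * C * M * u ^+ 3 <= K1 * w * r ^+ 2 * eta ^+ 2.
  have h1 : u ^+ 3 * B <= w * r ^+ 2 * eta ^+ 2.
    apply: (@le_trans _ _ (W * r ^+ 2 / B * eta ^+ 2 * B)).
      by apply: ler_wpM2r; [exact: ltW|exact: ltW].
    rewrite (_ : _ * B = W * (r ^+ 2 * eta ^+ 2)); last by field; rewrite gt_eqF.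
    by rewrite -mulrA ler_wpM2r// mulr_ge0 ?(ltW r2) ?(ltW n2).
  rewrite (_ : 16 * C * M * u ^+ 3 = K1 * (u ^+ 3 * B)); last first.
    by rewrite /B; field; rewrite gt_eqF.
  rewrite (_ : K1 * w * r ^+ 2 * eta ^+ 2 = K1 * (w * r ^+ 2 * eta ^+ 2)); last by ring.
  by rewrite ler_pM2l.
rewrite (_ : 16 * C * M / r ^+ 2 * _ =
  (16 * C * M * u ^+ 3) * (eta ^+ 6 * x ^+ 2 / (r ^+ 2 * u))); last first.
  by field; rewrite ?(gt_eqF r0) ?(gt_eqF u0).
rewrite (_ : K1 * _ = (K1 * w * r ^+ 2 * eta ^+ 2) * (eta ^+ 6 * x ^+ 2 / (r ^+ 2 * u))); last first.
  by field; rewrite ?(gt_eqF r0) ?(gt_eqF u0).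
apply: ler_wpM2r => //.
apply: divr_ge0; first by apply: mulr_ge0; [exact: ltW|exact: sqr_ge0].
by apply: ltW; rewrite mulr_gt0.
Qed.

Lemma grad_sqr_cutoff_pow (R : realType) N (r : R) (y : 'rV[R]_N) :
  grad_sqr (fun z => cutoff r z ^+ 4) y =
  16 * cutoff r y ^+ 6 * grad_sqr (cutoff r) y.
Proof.
rewrite /grad_sqr mulr_sumr; apply: eq_bigr => i _.
rewrite (_ : partial i _ y = 4 * cutoff r y ^+ 3 * partial i (cutoff r) y); first by ring.
apply: partialE.
have h := Ck_is_derive i y (@Ck_cutoff R N r 1).
have := @is_deriveX _ _ (@cutoff R N r) 4 y _ _ h.
by rewrite scaler_mul -mulr_natl; congr is_derive.
Qed.

(** Half of the coefficient 2 - l absorbs the gradient term up to a constant E. The factor (4 r)^N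
    is the volume of the cube of half-side 2 r, outside which the cutoff vanishes. *)
Lemma cutoff_energy_estimate (R : realType) N (alpha q l r C M K : R) (U : 'rV[R]_N -> R) :
  0 <= alpha -> positive_solution alpha U ->
  (forall f, Ck 1 f -> bounded_support f ->
     0 <= RN_int (rayleigh (potential alpha U) f)) ->
  0 < q -> q <= 9 / 2 -> q ^+ 2 < l * (2 * q + 1) -> l < 2 -> 0 < r ->
  C = 1 + (l - q) ^+ 2 / (l * (2 * q + 1) - q ^+ 2) ->
  M = 2 * (32 / flat 0 (flat 0 1)) ^+ 2 -> K = (2 - l) / 2 ->
  K * RN_int (fun y : 'rV[R]_N => enorm y `^ alpha / U y *
        (U y `^ (- q - 1) * cutoff r y ^+ 4) ^+ 2) <=
    16 * C * M / r ^+ 2 *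
     ((r `^ alpha * r ^+ 2) / (16 * C * M / K)) `^ (- (2 * q / 3)) *
    (4 * r) ^+ N.
Proof.
move=> a0 sU stab q0 q9 hl l2 r0 CE ME KE.
have [cU [C0 C00 CU] _] := sU.
have U0 y : 0 < U y by exact: lt_le_trans (CU y).
have k0 : 0 < l * (2 * q + 1) - q ^+ 2 by rewrite subr_gt0.
have Cp : 0 < C by rewrite CE ltr_pwDl// divr_ge0 ?sqr_ge0// ltW.
have Mp : 0 < M by rewrite ME mulr_gt0// exprn_gt0// divr_gt0// flat00_gt0.
have Kp : 0 < K by rewrite KE divr_gt0// subr_gt0.
pose psi (y : 'rV[R]_N) := cutoff r y ^+ 4.
have sp : smooth psi by move=> k; apply: CkX; exact: Ck_cutoff.
have bp : bounded_support psi.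
  by have [L hL] := @bounded_support_cutoff R N r r0; exists L => y /hL; rewrite /psi => ->; rewrite expr0n.
have main := stable_weighted_estimate a0 sU stab hl l2 sp bp.
set g := (fun y => enorm y `^ alpha / U y * _) in main *.
set d := (fun y => _ * grad_sqr psi y) in main.
have cUc := Ck_continuous cU.
have cXc : continuous (fun y => U y `^ (- q - 1)).
  by apply: (@Ck_continuous _ _ 2); exact: Ck_powR.
have Cg : Cc g.
  apply: CcM; first exact: (continuousM_V (enorm_powR_continuous a0) cUc (fun y => lt0r_neq0 (U0 y))).
  by apply: CcX2; apply: CcM => //; split=> //; exact: Ck_continuous (sp 0%N).
have Cd : Cc d.
  apply: CcM; last exact: Cc_grad_sqr (sp 1%N) bp.
  apply: (@Ck_continuous _ _ 1); apply: CkX; apply: CkM; last exact: CkW.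
  by apply: Ck_powR => //; exact: CkW.
set E := 16 * C * M / r ^+ 2 * _.
have rr : 0 < r ^+ 2 by rewrite exprn_gt0.
have E0 : 0 <= E by apply: mulr_ge0; [apply: ltW; rewrite divr_gt0// !mulr_gt0|exact: powR_ge0].
have g0 y : 0 <= g y.
  by apply: mulr_ge0; [rewrite divr_ge0 ?powR_ge0 ?(ltW (U0 y))|exact: sqr_ge0].
have dE y : d y = (U y `^ (- q - 1) * U y) ^+ 2 *
    (16 * cutoff r y ^+ 6 * grad_sqr (cutoff r) y).
  by rewrite /d grad_sqr_cutoff_pow.
have P1 y : C * d y - K * g y <= E.
  rewrite lerBlDl dE.
  (* In the ball of radius r the gradient of the cutoff is 0; outside it |y|^alpha >= r^alpha, the
     lower bound W of the dichotomy. *)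
  have [yr|yr] := leP (sqn y) (r ^+ 2).
    have -> : grad_sqr (cutoff r) y = 0.
      by rewrite /grad_sqr big1// => i _; rewrite partial_cutoff_inner// expr0n.
    rewrite !mulr0; apply: addr_ge0 => //; apply: mulr_ge0 => //; exact: ltW.
  have [c0|c0] := ltP 0 (cutoff r y); last first.
    have -> : cutoff r y = 0 by apply/eqP; rewrite eq_le c0 cutoff_ge0.
    rewrite expr0n/= mulr0 mul0r !mulr0.
    by apply: addr_ge0 => //; apply: mulr_ge0 => //; exact: ltW.
  apply: cutoff_dichotomy => //.
  - by rewrite c0 cutoff_le1.
  - by apply: sumr_ge0 => i _; exact: sqr_ge0.
  - by rewrite ME; exact: grad_sqr_cutoff_le.
  - exact: powR_gt0.
  - apply: ge0_ler_powR; rewrite ?nnegrE ?sqrtr_ge0 ?(ltW r0)//.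
    by rewrite -ler_sqr ?nnegrE ?sqrtr_ge0 ?(ltW r0)// enorm_sqr ltW.
have P2 y : 2 * r < `|y| -> C * d y - K * g y <= 0.
  move=> yr.
  have yy : 2 * r ^+ 2 <= sqn y.
    by apply: le_trans (norm_sqr_le_sqn y); have := normr_ge0 y; nra.
  rewrite dE cutoff_eq0// expr0n/= mulr0 mul0r !mulr0 sub0r oppr_le0.
  by apply: mulr_ge0 => //; exact: ltW.
have CB := CcB (CcZ C Cd) (CcZ K Cg).
have r2 : 0 <= 2 * r by rewrite mulr_ge0// ltW.
have := RN_int_le_box CB E0 r2 (fun y _ => P1 y) P2.
rewrite (RN_intB (CcZ C Cd) (CcZ K Cg)) !RN_intZ// mulrA -natrM => H.
move: main; rewrite -CE (_ : 2 - l = 2 * K); last by rewrite KE; field.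
by move=> main; move: H; rewrite -/E; lra.
Qed.

(** On the cube [1, 2]^N the cutoff is 1 once r >= 4 N + 1, because |y|^2 <= 4 N, and |y|^alpha >= 1
    because some coordinate is at least 1. The bound is thus independent of r. *)
Lemma cutoff_energy_lower_bound (R : realType) N (alpha q : R) (U : 'rV[R]_N -> R) :
  (0 < N)%N -> 0 <= alpha -> continuous U -> (forall y, 0 < U y) ->
  exists2 c, 0 < c & forall r, 4 * N%:R + 1 <= r ->
   c <= RN_int (fun y : 'rV[R]_N => enorm y `^ alpha / U y *
        (U y `^ (- q - 1) * cutoff r y ^+ 4) ^+ 2).
Proof.
move=> N0 a0 cU U0.
have cX : continuous (fun y => U y `^ (- q - 1)).
  by apply: (@Ck_continuous _ _ 0); apply: Ck_powR.
have X0 y : 0 < U y `^ (- q - 1) by exact: powR_gt0.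
have ch : continuous (fun y => U y / (U y `^ (- q - 1) * U y `^ (- q - 1))).
  apply: continuousM_V => //; first exact: continuousM_rV.
  by move=> y; rewrite gt_eqF// mulr_gt0.
(* An upper bound for the reciprocal U / X^2, where X = U^(-q-1), is a lower bound for the
   integrand; M + 1 makes it positive. *)
have [M M0 hM] := continuous_bounded_ball 2 ch.
have M1 : 0 < M + 1 by lra.
exists (M + 1)^-1 => [|r rN]; first by rewrite invr_gt0.
have N1 : (1 : R) <= N%:R by rewrite ler1n.
have r0 : 0 < r by lra.
have := @RN_int_ge_box R N (fun y : 'rV[R]_N => enorm y `^ alpha / U y *
        (U y `^ (- q - 1) * cutoff r y ^+ 4) ^+ 2) (M + 1)^-1 1 2.
rewrite (_ : 2 - 1 = 1); last by lra.
rewrite expr1n mulr1; apply => //.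
- apply: CcM; first exact: (continuousM_V (enorm_powR_continuous a0) cU (fun y => lt0r_neq0 (U0 y))).
  apply: CcX2; apply: CcM => //; split.
    by apply: (@Ck_continuous _ _ 0); apply: CkX; exact: Ck_cutoff.
  by have [L hL] := @bounded_support_cutoff R N r r0; exists L => y /hL ->; rewrite expr0n.
- by rewrite ler1n.
- by move=> y; apply: mulr_ge0; [rewrite divr_ge0 ?powR_ge0 ?(ltW (U0 y))|exact: sqr_ge0].
move=> y yb.
have sN : sqn y <= 4 * N%:R.
  apply: (@le_trans _ _ (\sum_(i < N) 4)).
    by apply: ler_sum => i _; have /andP[] := yb i; nra.
  by rewrite sumr_const card_ord mulr_natr.
rewrite cutoff_eq1 ?expr1n ?mulr1//; last by apply: (le_trans sN); nra.
have w1 : 1 <= enorm y `^ alpha.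
  rewrite -[leLHS](powRr0 (enorm y)); apply: ler_powR => //.
  rewrite -[leLHS]sqrtr1; apply: ler_wsqrtr.
  apply: le_trans (coord_sqr_le y (Ordinal N0)).
  by have /andP[] := yb (Ordinal N0); nra.
have y2 : `|y| <= 2.
  apply: rV_norm_ler => // i; rewrite ger0_norm; have /andP[] := yb i => //.
  by move=> h _; apply: le_trans h.
have := hM _ y2; rewrite ger0_norm; last by rewrite divr_ge0 ?(ltW (U0 y))// mulr_ge0 ?(ltW (X0 y)).
have X2 : 0 < U y `^ (- q - 1) * U y `^ (- q - 1) by rewrite mulr_gt0.
rewrite ler_pdivrMr// => H.
apply: (@le_trans _ _ (U y `^ (- q - 1) * U y `^ (- q - 1) / U y)).
  rewrite ler_pdivlMr// ler_pdivrMl//; apply: (le_trans H).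
  by rewrite ler_pM2r// lerDl.
rewrite (_ : enorm y `^ alpha / U y * _ = enorm y `^ alpha *
  (U y `^ (- q - 1) * U y `^ (- q - 1) / U y)); last by ring.
by apply: ler_peMl => //; rewrite divr_ge0 ?(ltW X2) ?(ltW (U0 y)).
Qed.

Lemma powR_eventually_le (R : realType) (d A B r0 : R) : 0 < d -> 0 < B ->
  exists2 r, r0 <= r /\ 0 < r & A * r `^ (- d) < B.
Proof.
move=> d0 B0; pose b := (`|A| / B + 1).
have b0 : 0 < b by rewrite ltr_wpDl// divr_ge0// ltW.
have b1 : 0 < b `^ d^-1 by exact: powR_gt0.
pose r := b `^ d^-1 + `|r0|.
have r0' : 0 < r by rewrite ltr_pwDl.
exists r; first by split=> //; rewrite /r; have := ler_norm r0; lra.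
have rd : b <= r `^ d.
  rewrite -[leLHS](powRr1 (ltW b0)) -(mulVf (lt0r_neq0 d0)) powRrM.
  by apply: ge0_ler_powR; rewrite ?nnegrE ?(ltW d0) ?(ltW b1) ?(ltW r0')// lerDl.
rewrite powRN ltr_pdivrMr ?powR_gt0//.
apply: (@lt_le_trans _ _ (B * b)); last by rewrite ler_pM2l.
rewrite /b mulrDr mulrCA mulfV ?(gt_eqF B0)// !mulr1.
have := ler_norm A; lra.
Qed.

Lemma instability (R : realType) N (alpha : R) (U : 'rV[R]_N -> R) :
  (0 < N)%N -> 0 <= alpha -> alphaN R N < alpha -> positive_solution alpha U ->
  (mu1 alpha U < 0)%E.
Proof.
move=> N0 a0 aN sU; have [cU [C0 C00 CU] _] := sU.
have U0 y : 0 < U y by exact: lt_le_trans (CU y).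
have cUc := Ck_continuous cU.
have cV := potential_continuous a0 cUc U0.
rewrite ltNge; apply/negP => mu0.
have stab0 g : smooth g -> bounded_support g -> RN_int (fun y => g y ^+ 2) = 1 ->
    0 <= RN_int (rayleigh (potential alpha U) g).
  move=> sg bg g1; rewrite -lee_fin -integral_RN_EFin; last exact: Cc_rayleigh.
  apply: (le_trans mu0); apply: ereal_inf_lbound; exists g => //.
  split; first exact: smooth_test_function.
  rewrite integral_RN_EFin ?g1//; apply: CcX2; split=> //.
  exact: Ck_continuous (sg 0%N).
have stab f : Ck 1 f -> bounded_support f ->
    0 <= RN_int (rayleigh (potential alpha U) f).
  apply: stable_C1 => // g sg bg; exact: rayleigh_ge0_normalize.
have [q [l [q0 q9 hl l2 hd]]] := exponent_choice a0 aN.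
set d := _ - N%:R in hd.
have [c c0 hc] := @cutoff_energy_lower_bound R N alpha q U N0 a0 cUc U0.
pose C := 1 + (l - q) ^+ 2 / (l * (2 * q + 1) - q ^+ 2).
pose M : R := 2 * (32 / flat 0 (flat 0 1)) ^+ 2.
pose K := (2 - l) / 2.
have Cp : 0 < C.
  by rewrite /C ltr_pwDl// divr_ge0 ?sqr_ge0// ltW// subr_gt0.
have Mp : 0 < M by rewrite /M mulr_gt0// exprn_gt0// divr_gt0// flat00_gt0.
have Kp : 0 < K by rewrite /K divr_gt0// subr_gt0.
pose p := 2 * q / 3.
pose B := 16 * C * M / K.
have Bp : 0 < B.
  by apply: divr_gt0 => //; apply: mulr_gt0 => //; exact: mulr_gt0.
(* The powers of r collect into r^(-p (alpha + 2) - 2 + N) = r^(-d), and A gathers the factors free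
   of r. *)
pose A := 16 * C * M * B `^ p * 4 ^+ N.
have [r [rN r0] rA] := powR_eventually_le A (4 * N%:R + 1) hd (mulr_gt0 Kp c0).
have H1 := @cutoff_energy_estimate R N alpha q l r C M K U a0 sU stab q0 q9 hl l2 r0
  erefl erefl erefl.
have H2 := hc r rN.
have : K * c <= A * r `^ (- d).
  rewrite -(ler_pM2l Kp) in H2; apply: (le_trans H2); apply: (le_trans H1).
  rewrite le_eqVlt; apply/orP; left; apply/eqP.
  have r_ := ltW r0.
  have E1 : r `^ alpha * r ^+ 2 = r `^ (alpha + 2).
    by rewrite powRD ?(gt_eqF r0) ?implybT// powR_mulrn.
  have E2 : (r `^ (alpha + 2) / B) `^ (- p) = r `^ (- (p * (alpha + 2))) * B `^ p.
    rewrite powRM ?powR_ge0 ?invr_ge0 ?(ltW Bp)// -powRrM mulrN (mulrC _ p).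
    by rewrite -powR_inv1 ?(ltW Bp)// -powRrM mulN1r opprK.
  have E3 : r `^ (- d) = r `^ (- (p * (alpha + 2))) * (r ^+ 2)^-1 * r ^+ N.
    have -> : - d = - (p * (alpha + 2)) + (- 2) + N%:R by rewrite /d /p; ring.
    have rp (s t : R) : r `^ (s + t) = r `^ s * r `^ t.
      by rewrite powRD// (gt_eqF r0) implybT.
    by rewrite !rp (powRN r 2) (powR_mulrn 2 r_) powR_mulrn.
  rewrite -/p -/B E1 E2 E3 /A exprMn; ring.
by rewrite leNgt rA.
Qed.

(** * Hardy's inequality *)

(** Expand the square of grad phi + s h phi y with h = 1 / (|y|^2 + e) and subtract the divergence
    of s h phi^2 y. The shift e makes this field C^1 at the origin, and its error term s (s + 2) e
    h^2 phi^2 has the favourable sign. *)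
Lemma hardy_regularized (R : realType) N (s e : R) (phi : 'rV[R]_N -> R) :
  0 <= s -> N%:R = 2 * s + 2 -> 0 < e -> smooth phi -> bounded_support phi ->
  Cc (fun y => (sqn y + e)^-1 * phi y ^+ 2) /\
  s ^+ 2 * RN_int (fun y => (sqn y + e)^-1 * phi y ^+ 2) <= RN_int (grad_sqr phi).
Proof.
move=> s0 NE e0 sp bp.
have re (y : 'rV[R]_N) : 0 < sqn y + e by rewrite ltr_wpDl// sqn_ge0.
pose h (y : 'rV[R]_N) := (sqn y + e)^-1.
have h0 y : 0 < h y by rewrite invr_gt0.
have ch k : Ck k h.
  have := @Ck_powR R N k (-1) (fun y => sqn y + e).
  rewrite (_ : (fun y => _ `^ _) = h); last first.
    by apply/funext => y; rewrite powR_inv1// ltW.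
  by apply => //; apply: CkD; [exact: Ck_sqn|exact: Ck_cst].
have dh i y : is_derive y (delta_mx ord0 i) h (- (h y) ^+ 2 * (2 * y ord0 i)).
  have de : is_derive y (delta_mx ord0 i) (fun y : 'rV[R]_N => sqn y + e) (2 * y ord0 i).
    have := @is_deriveD _ _ _ (@sqn R N) (cst e) y _ _ _ (is_derive_sqn i y) (is_derive_cst _ _ _).
    by rewrite addr0.
  have n0 : (fun y : 'rV[R]_N => sqn y + e) y != 0 by rewrite gt_eqF.
  split; first exact: (@derivableV _ _ _ y _ n0 (@ex_derive _ _ _ _ _ _ _ de)).
  rewrite (@deriveV _ _ _ y _ n0 (@ex_derive _ _ _ _ _ _ _ de)).
  by rewrite (@derive_val _ _ _ _ _ _ _ de) scaler_mul /h exprVn.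
pose F i (y : 'rV[R]_N) := s * y ord0 i * h y * phi y * phi y.
have cF i : Ck 1 (F i).
  do 2 (apply: CkM => //); apply: CkM => //; apply: CkM; [exact: Ck_cst|exact: Ck_coord].
have bF i : bounded_support (F i) by exact: bounded_supportMl.
have dF i y : partial i (F i) y = s * h y * phi y ^+ 2 -
    2 * s * h y ^+ 2 * phi y ^+ 2 * y ord0 i ^+ 2 +
    2 * s * h y * phi y * (y ord0 i * partial i phi y).
  have d1 : is_derive y (delta_mx ord0 i) (fun z : 'rV[R]_N => s * z ord0 i) s.
    have := @is_deriveZ _ _ _ _ s y _ _ (is_derive_coord i i y).
    by rewrite eqxx scaler_mul mulr1.
  have dp := Ck_is_derive i y (sp 1%N).
  apply: partialE; apply: (is_derive_eq
    (is_deriveM (is_deriveM (is_deriveM d1 (dh i y)) dp) dp)).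
  by rewrite !scaler_mul !fctE; ring.
have [CD ID] := RN_int_divergence cF bF.
set D := (fun y => \sum_i _) in CD ID.
have Cp : Cc phi by split=> //; exact: Ck_continuous (sp 0%N).
have Ch : Cc (fun y => h y * phi y ^+ 2).
  by apply: CcM; [exact: Ck_continuous (ch 0%N)|exact: CcX2].
split=> //.
have CG := Cc_grad_sqr (sp 1%N) bp.
rewrite -RN_intZ// -[leRHS]addr0 -ID -RN_intD//.
apply: le_RN_int; [exact: CcZ|exact: CcD|] => y.
have -> : D y = N%:R * (s * h y * phi y ^+ 2) - 2 * s * h y ^+ 2 * phi y ^+ 2 * sqn y +
    2 * s * h y * phi y * (\sum_i y ord0 i * partial i phi y).
  rewrite /D; under eq_bigr do rewrite dF.
  by rewrite !big_split /= sumr_const card_ord -(mulr_natl (s * h y * phi y ^+ 2)) sumrN -!mulr_sumr.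
have := sum_sqr_linear (s * h y * phi y) 1 (fun i => y ord0 i) (fun i => partial i phi y).
rewrite -/(sqn y) -/(grad_sqr phi y); set B := \sum_i y ord0 i * _ => E.
have {E} : 0 <= (s * h y * phi y) ^+ 2 * sqn y + 2 * (s * h y * phi y) * 1 * B +
    1 ^+ 2 * grad_sqr phi y.
  by rewrite -E; apply: sumr_ge0 => i _; exact: sqr_ge0.
rewrite -/(h y) NE => H.
have hE : h y * sqn y = 1 - e * h y.
  by rewrite /h; field; rewrite gt_eqF.
have K : 0 <= h y * phi y ^+ 2 * (s * (s + 2) * (e * h y)).
  apply: mulr_ge0; first by apply: mulr_ge0; [exact: ltW|exact: sqr_ge0].
  apply: mulr_ge0; first by apply: mulr_ge0 => //; lra.
  by apply: mulr_ge0; exact: ltW.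
rewrite -subr_ge0.
rewrite (_ : _ - _ = ((s * h y * phi y) ^+ 2 * sqn y + 2 * (s * h y * phi y) * 1 * B +
    1 ^+ 2 * grad_sqr phi y) + h y * phi y ^+ 2 * (s * (s + 2) * (1 - h y * sqn y))).
  apply: addr_ge0 => //; rewrite hE (_ : 1 - (1 - e * h y) = e * h y)//; ring.
ring.
Qed.

(** No limit of integrals is taken as e tends to 0: V (|y|^2 + e) <= s^2 + M e on the support
    compares the numbers W and G directly for each e. *)
Lemma hardy_stable (R : realType) N (s : R) (V phi : 'rV[R]_N -> R) :
  0 < s -> N%:R = 2 * s + 2 -> continuous V ->
  (forall y, V y * sqn y <= s ^+ 2) -> smooth phi -> bounded_support phi ->
  0 <= RN_int (rayleigh V phi).
Proof.
move=> s0 NE cV hV sp bp.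
have s2 : 0 < s ^+ 2 by rewrite exprn_gt0.
have Cp : Cc phi by split=> //; exact: Ck_continuous (sp 0%N).
have CG := Cc_grad_sqr (sp 1%N) bp.
have CVp : Cc (fun y => V y * phi y ^+ 2) by apply: CcM => //; exact: CcX2.
rewrite /rayleigh RN_intB// subr_ge0.
set G := RN_int (grad_sqr phi); set W := RN_int _.
have [K hK] := bp; have [M M0 hM] := continuous_bounded_ball K cV.
have key e : 0 < e -> s ^+ 2 * W <= (s ^+ 2 + M * e) * G.
  move=> e0; have [C1 H] := hardy_regularized (ltW s0) NE e0 sp bp.
  have Me : 0 <= s ^+ 2 + M * e by rewrite addr_ge0 ?sqr_ge0// mulr_ge0// ltW.
  apply: le_trans (ler_wpM2l Me H).
  rewrite mulrCA; apply: ler_wpM2l; first exact: ltW.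
  rewrite -RN_intZ//; apply: le_RN_int => //; first exact: CcZ.
  move=> y; have [yK|yK] := leP `|y| K; last by rewrite hK// expr0n/= !mulr0.
  rewrite [leRHS]mulrA; apply: ler_wpM2r; first exact: sqr_ge0.
  rewrite ler_pdivlMr ?ltr_wpDl ?sqn_ge0// mulrDr lerD//.
  by apply: ler_wpM2r; [exact: ltW|apply: le_trans (hM _ yK); exact: ler_norm].
rewrite leNgt; apply/negP => GW.
have G0 : 0 <= G.
  have := key 1 ltr01.
  have C0 := CcZ 0 CG; have := le_RN_int C0 CG.
  rewrite RN_intZ// mul0r => -> // y; rewrite mul0r.
  by apply: sumr_ge0 => i _; exact: sqr_ge0.
(* If G < W, this e turns s^2 (W - G) <= M e G into 2 e (M G + 1) <= e M G. *)
pose e := s ^+ 2 * (W - G) / (2 * (M * G + 1)).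
have MG : 0 < M * G + 1 by rewrite ltr_wpDl// mulr_ge0.
have e0 : 0 < e by rewrite divr_gt0 ?mulr_gt0 ?subr_gt0.
have := key e e0; rewrite mulrDl -lerBlDl -mulrBr (_ : s ^+ 2 * (W - G) = 2 * e * (M * G + 1)).
  by move=> H; have := mulr_gt0 e0 MG; nra.
by rewrite /e; field; rewrite gt_eqF.
Qed.

(** * The radial equation *)

Lemma is_derive_ge0_le (R : realType) (f df : R -> R) (a b : R) : a <= b ->
  (forall x : R, a < x < b -> is_derive x 1 f (df x)) ->
  (forall x : R, a < x < b -> 0 <= df x) ->
  (forall x : R, a <= x <= b -> {for x, continuous f}) -> f a <= f b.
Proof.
move=> ab dfE df0 cf.
apply: (@ger0_derive1_ndecr _ f a b) => //.
- by move=> x; rewrite in_itv /= => /dfE [].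
- by move=> x; rewrite in_itv /= => xab; rewrite derive1E; have [_ ->] := dfE x xab; exact: df0.
- by apply: continuous_in_subspaceT => x; rewrite inE /= in_itv /= => /cf.
Qed.

(** The primitive vanishing at 0. Integrating from -1 makes 0 an interior point, so the derivative
    there is two-sided. *)
Definition prim (R : realType) (g : R -> R) (x : R) : R :=
  \int[@lebesgue_measure R]_(t in `[-1, x]) g t -
  \int[@lebesgue_measure R]_(t in `[-1, 0]) g t.

Lemma prim0 (R : realType) (g : R -> R) : prim g 0 = 0.
Proof. exact: subrr. Qed.

Lemma is_derive_prim (R : realType) (g : R -> R) (x : R) : continuous g ->
  - 1 < x -> is_derive x 1 (prim g) (g x).
Proof.
move=> cg x1.
have xx : x < x + 1 by rewrite ltrDl.
have ig : (@lebesgue_measure R).-integrable `[(-1 : R), (x + 1)] (EFin \o g).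
  by apply: continuous_compact_integrable; [exact: segment_compact|exact: continuous_subspaceT].
have [d1 d2] := @continuous_FTC1_closed _ g (-1) x (x + 1) xx ig x1 (cg x).
have h : is_derive x 1 (fun x : R => \int[@lebesgue_measure R]_(t in `[-1, x]) g t) (g x).
  by split; [exact: d1|rewrite -derive1E; exact: d2].
have := @is_deriveB _ _ _ _ (cst (\int[@lebesgue_measure R]_(t in `[-1, 0]) g t)) x 1 _ _ h
  (is_derive_cst _ _ _).
by rewrite subr0.
Qed.

Lemma max0_continuous (R : realType) : continuous (fun x : R => Num.max x 0).
Proof.
apply: continuous_norm_le => y e e0.
have := near_norm_le y e0; apply: filterS => z; apply: le_trans.
rewrite ler_norml; have := ler_norm (y - z); have := ler_norm (z - y); rewrite distrC.
by move=> h1 h2; rewrite /Num.max; case: ltP => y0; case: ltP => z0; apply/andP; split;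
  have := normr_ge0 (y - z); lra.
Qed.

Lemma max0_powR_continuous (R : realType) (a : R) : 0 < a ->
  continuous (fun x : R => (Num.max x 0) `^ a).
Proof.
move=> a0; have -> : (fun x : R => (Num.max x 0) `^ a) = (fun x : R => `|x| `^ a) \o (fun x : R => Num.max x 0).
  by apply/funext => x /=; rewrite ger0_norm// le_max lexx orbT.
move=> x; apply: (@continuous_comp _ _ _ (fun x : R => Num.max x 0) (fun x : R => `|x| `^ a)).
  exact: max0_continuous.
exact: powR_norm_continuous.
Qed.

Lemma is_derive_max0_powR (R : realType) (a t : R) : 0 < t ->
  is_derive t 1 (fun x : R => (Num.max x 0) `^ a) (a * t `^ (a - 1)).
Proof.
move=> t0; apply: (@near_eq_is_derive _ R R (fun z : R => z `^ a)).
  by near=> z; rewrite (max_idPl _)// ltW//; near: z; exact: lt_nbhsr.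
exact: is_derive1_powR.
Unshelve. all: by end_near.
Qed.

Lemma continuousM_R (R : realType) (f g : R -> R) : continuous f -> continuous g ->
  continuous (fun x : R => f x * g x).
Proof. by move=> cf cg x; exact: cvgM (cf x) (cg x). Qed.

(** [Num.max t 0] extends the weight t^(a-1) by 0 to t < 0, continuously when a > 1. *)
Definition wprim (R : realType) (a : R) (g : R -> R) : R -> R :=
  prim (fun t : R => (Num.max t 0) `^ (a - 1) * g t).

(* x^-a \int_0^x t^(a-1) g(t) dt, extended to x <= 0 by its limit g(0) / a at 0. *)
Definition avg (R : realType) (a : R) (g : R -> R) (x : R) : R :=
  if 0 < x then wprim a g x / x `^ a else g 0 / a.

Lemma is_derive_wprim (R : realType) (a : R) (g : R -> R) (x : R) : 1 < a ->
  continuous g -> 0 <= x -> is_derive x 1 (wprim a g) (x `^ (a - 1) * g x).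
Proof.
move=> a1 cg x0.
have := @is_derive_prim _ (fun t : R => (Num.max t 0) `^ (a - 1) * g t) x.
rewrite (max_idPl x0); apply; last by lra.
by apply: continuousM_R => //; apply: max0_powR_continuous; lra.
Qed.

(** h' <= e t^(a-1) integrates to h x <= e x^a / a; this is read off from monotonicity of the
    difference. *)
Lemma weighted_le (R : realType) (a e x : R) (h gam : R -> R) : 1 < a -> 0 < x ->
  h 0 = 0 -> (forall t : R, 0 <= t -> is_derive t 1 h (t `^ (a - 1) * gam t)) ->
  (forall t : R, 0 < t < x -> gam t <= e) -> a * (h x / x `^ a) <= e.
Proof.
move=> a1 x0 h0 dh ge.
have a0 : 0 < a by lra.
have xa : 0 < x `^ a by exact: powR_gt0.
suff : h x <= e * (x `^ a / a).
  by move=> H; rewrite mulrA ler_pdivrMr// -ler_pdivlMl//; lra.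
pose k (t : R) : R := e * ((Num.max t 0) `^ a / a) - h t.
have kc t : 0 <= t -> {for t, continuous k}.
  move=> t0; have h1 := max0_powR_continuous a0.
  have c1 : {for t, continuous (fun t : R => e * ((Num.max t 0) `^ a / a))}.
    by apply: (continuousM_R _ (continuousM_R h1 _)); move=> z; exact: cst_continuous.
  exact: cvgB c1 (is_derive_continuous (dh t t0)).
have : k 0 <= k x.
  apply: (@is_derive_ge0_le _ k (fun t : R => t `^ (a - 1) * (e - gam t)) 0 x (ltW x0)).
  - move=> t /andP[t0 tx].
    have d1 : is_derive t 1 (fun t : R => (Num.max t 0) `^ a) (a * t `^ (a - 1)).
      exact: is_derive_max0_powR.
    have d2 := @is_deriveZ _ _ _ _ (e / a) t 1 _ d1.
    have d3 := @is_deriveB _ _ _ _ _ t 1 _ _ d2 (dh t (ltW t0)).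
    rewrite (_ : k = (e / a) \*: (fun t : R => (Num.max t 0) `^ a) - h); last first.
      by apply/funext => z; rewrite /k !fctE /= scaler_mul; ring.
    apply: (is_derive_eq d3); rewrite scaler_mul; field; exact: lt0r_neq0.
  - move=> t /andP[t0 tx]; rewrite mulr_ge0 ?powR_ge0// subr_ge0 ge//.
    by rewrite t0.
  - by move=> t /andP[t0 _]; exact: kc.
rewrite /k (max_idPl (ltW x0)) (max_idPl (lexx 0)) powR0 ?gt_eqF// h0 mul0r mulr0 subr0.
by rewrite subr_ge0.
Unshelve. all: by end_near.
Qed.

Lemma avg_sub_le (R : realType) (a e x : R) (g1 g2 : R -> R) : 1 < a -> 0 <= x ->
  continuous g1 -> continuous g2 ->
  (forall t : R, 0 <= t <= x -> g1 t - g2 t <= e) ->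
  a * (avg a g1 x - avg a g2 x) <= e.
Proof.
move=> a1 x0 c1 c2 h; have a0 : 0 < a by lra.
rewrite /avg; case: ltP => xp; last first.
  rewrite -mulrBl mulrCA mulfV ?gt_eqF// mulr1; apply: h.
  by rewrite lexx.
rewrite -mulrBl; apply: (@weighted_le _ a e x (fun t : R => wprim a g1 t - wprim a g2 t)
  (fun t : R => g1 t - g2 t)) => //.
- by rewrite /wprim !prim0 subrr.
- move=> t t0; have := @is_deriveB _ _ _ _ _ t 1 _ _ (is_derive_wprim a1 c1 t0) (is_derive_wprim a1 c2 t0).
  by rewrite -mulrBr.
- by move=> t /andP[t0 tx]; apply: h; rewrite !ltW.
Qed.

Lemma avg_le (R : realType) (a b x : R) (g : R -> R) : 1 < a -> 0 <= x ->
  continuous g -> (forall t : R, 0 <= t <= x -> g t <= b) -> a * avg a g x <= b.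
Proof.
move=> a1 x0 c1 h; have a0 : 0 < a by lra.
rewrite /avg; case: ltP => xp; last first.
  by rewrite mulrCA mulfV ?gt_eqF// mulr1; apply: h; rewrite lexx.
apply: (@weighted_le _ a b x (wprim a g) g) => //; first exact: prim0.
- by move=> t t0; exact: is_derive_wprim.
- by move=> t /andP[t0 tx]; apply: h; rewrite !ltW.
Qed.

Lemma avg_ge (R : realType) (a b x : R) (g : R -> R) : 1 < a -> 0 <= x ->
  continuous g -> (forall t : R, 0 <= t <= x -> b <= g t) -> b <= a * avg a g x.
Proof.
move=> a1 x0 c1 h; have a0 : 0 < a by lra.
rewrite /avg; case: ltP => xp; last first.
  by rewrite mulrCA mulfV ?gt_eqF// mulr1; apply: h; rewrite lexx.
rewrite -lerN2 -mulrN -mulNr.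
apply: (@weighted_le _ a (- b) x (fun t : R => - wprim a g t) (fun t : R => - g t)) => //.
- by rewrite /wprim prim0 oppr0.
- move=> t t0; have := @is_deriveN _ _ _ _ t 1 _ (is_derive_wprim a1 c1 t0).
  by rewrite -mulrN.
- by move=> t /andP[t0 tx]; rewrite lerN2; apply: h; rewrite !ltW.
Qed.

(** The average m solves x m' + a m = g; with v' = c m and g = v^-2 this is the radial equation. *)
Lemma is_derive_avg (R : realType) (a x : R) (g : R -> R) : 1 < a -> 0 < x ->
  continuous g -> is_derive x 1 (avg a g) ((g x - a * avg a g x) / x).
Proof.
move=> a1 x0 cg.
apply: (@near_eq_is_derive _ R R (fun z : R => wprim a g z * z `^ (- a))).
  near=> z; rewrite /avg ifT; first by rewrite powRN.
  by near: z; exact: lt_nbhsr.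
apply: (is_derive_eq (is_deriveM (is_derive_wprim a1 cg (ltW x0)) (is_derive1_powR (- a) x0))).
have xa : x `^ a != 0 by rewrite gt_eqF// powR_gt0.
have E1 : x `^ (- a - 1) = (x `^ a)^-1 / x.
  by rewrite powRB ?powRr1 ?(ltW x0)// ?powRN// (gt_eqF x0) implybT.
have E2 : x `^ (a - 1) = x `^ a / x.
  by rewrite powRB ?powRr1 ?(ltW x0)// (gt_eqF x0) implybT.
rewrite !scaler_mul E1 E2 powRN /avg x0; field.
by rewrite xa gt_eqF.
Unshelve. all: by end_near.
Qed.

Lemma avg_continuous (R : realType) (a : R) (g : R -> R) : 1 < a -> continuous g ->
  continuous (avg a g).
Proof.
move=> a1 cg x; have a0 : 0 < a by lra.
have [x0|x0|x0] := ltgtP x 0; last 1 first.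
- rewrite x0; apply/cvgrPdist_le => e e0.
  have ae : 0 < a * e by rewrite mulr_gt0.
  have /cvgrPdist_le /(_ _ ae) /nbhs_ballP [r /= r0 hr] := cg 0.
  have r2 : 0 < r / 2 by rewrite divr_gt0.
  near=> z; rewrite {1}/avg ltxx.
  have [z0|z0] := ltP 0 z; last by rewrite /avg ltNge z0 /= subrr normr0 ltW.
  have zr : `|z| < r.
    apply: (@le_lt_trans _ _ (r / 2)); last by rewrite ltr_pdivrMr//; lra.
    have : `|0 - z| <= r / 2 by near: z; exact: (near_norm_le (0 : R) r2).
    by rewrite sub0r normrN.
  have H t : 0 <= t <= z -> `|g 0 - g t| <= a * e.
    move=> /andP[t0 tz]; apply: hr; rewrite -ball_normE /= sub0r normrN ger0_norm//.
    by rewrite (le_lt_trans tz)// (le_lt_trans _ zr)// ler_norm.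
  have H1 : a * avg a g z <= g 0 + a * e.
    by apply: avg_le => // [|t /H]; rewrite ?(ltW z0)// ler_norml; lra.
  have H2 : g 0 - a * e <= a * avg a g z.
    by apply: avg_ge => // [|t /H]; rewrite ?(ltW z0)// ler_norml; lra.
  rewrite -(ler_pM2l a0) -[X in X * `|_|]gtr0_norm// -normrM mulrBr mulrCA mulfV ?gt_eqF// mulr1.
  by rewrite ler_norml; lra.
- apply: (@is_derive_continuous _ _ _ 0).
  apply: (@near_eq_is_derive _ R R (cst (g 0 / a))).
  near=> z; rewrite /avg ifF//; apply/negbTE; rewrite -leNgt ltW//.
  by near: z; exact: lt_nbhsl.
- exact: is_derive_continuous (is_derive_avg a1 x0 cg).
Unshelve. all: by end_near.
Qed.

(** Truncating s^-2 below 1 makes it globally Lipschitz. The solution starts at 1 and is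
    nondecreasing on [0, oo), so there the truncation is inactive. *)
Definition inv_sqr_above1 (R : realType) (s : R) : R := (Num.max s 1) ^- 2.

Lemma inv_sqr_above1_bounds (R : realType) (s : R) : 0 <= inv_sqr_above1 s <= 1.
Proof.
have h : 1 <= Num.max s 1 by rewrite le_max lexx orbT.
by rewrite /inv_sqr_above1 invr_ge0 exprn_ge0 ?invf_le1 ?exprn_gt0 ?exprn_ege1//; lra.
Qed.

Lemma inv_sqr_above1_lipschitz (R : realType) (s t : R) :
  `|inv_sqr_above1 s - inv_sqr_above1 t| <= 2 * `|s - t|.
Proof.
rewrite /inv_sqr_above1; set x := Num.max s 1; set y := Num.max t 1.
have x1 : 1 <= x by rewrite le_max lexx orbT.
have y1 : 1 <= y by rewrite le_max lexx orbT.
have xy : `|x - y| <= `|s - t|.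
  rewrite /x /y ler_norml; have h1 := ler_norm (s - t); have h2 := ler_norm (t - s).
  rewrite distrC in h2; have h3 := normr_ge0 (s - t).
  by case: (leP s 1) => hs; case: (leP t 1) => ht; apply/andP; split; lra.
have -> : x ^- 2 - y ^- 2 = (y - x) * ((x + y) / (x ^+ 2 * y ^+ 2)).
  by field; rewrite !gt_eqF//; lra.
have q0 : 0 <= (x + y) / (x ^+ 2 * y ^+ 2).
  by rewrite divr_ge0 ?mulr_ge0 ?exprn_ge0 ?addr_ge0//; lra.
have q2 : (x + y) / (x ^+ 2 * y ^+ 2) <= 2.
  have x2 : x <= x ^+ 2 by rewrite expr2; nra.
  have y2 : y <= y ^+ 2 by rewrite expr2; nra.
  have xx0 : 0 < x ^+ 2 by rewrite exprn_gt0//; lra.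
  have yy0 : 0 < y ^+ 2 by rewrite exprn_gt0//; lra.
  by rewrite ler_pdivrMr ?mulr_gt0//; nra.
rewrite normrM distrC (ger0_norm q0) mulrC.
by apply: ler_pM.
Qed.

Lemma inv_sqr_above1_continuous (R : realType) : continuous (@inv_sqr_above1 R).
Proof.
apply: continuous_norm_le => y e e0.
have e2 : 0 < e / 2 by rewrite divr_gt0.
have := near_norm_le y e2; apply: filterS => z yz.
by apply: (le_trans (inv_sqr_above1_lipschitz _ _)); lra.
Qed.

(** Since (x^a v')' = c x^(a-1) v^-2, one integration gives v' = c [ode_slope a v], with no
    singularity left at 0. *)
Definition ode_slope (R : realType) (a : R) (v : R -> R) : R -> R :=
  avg a (@inv_sqr_above1 R \o v).

Definition ode_step (R : realType) (a c : R) (v : R -> R) (x : R) : R :=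
  1 + prim (fun t : R => c * ode_slope a v t) x.

Lemma comp_inv_sqr_continuous (R : realType) (v : R -> R) : continuous v ->
  continuous (@inv_sqr_above1 R \o v).
Proof. by move=> cv x; apply: continuous_comp; [exact: cv|exact: inv_sqr_above1_continuous]. Qed.

Lemma ode_slope_continuous (R : realType) (a : R) (v : R -> R) : 1 < a ->
  continuous v -> continuous (ode_slope a v).
Proof. by move=> a1 cv; apply: avg_continuous => //; exact: comp_inv_sqr_continuous. Qed.

Lemma is_derive_ode_step (R : realType) (a c : R) (v : R -> R) (x : R) : 1 < a ->
  continuous v -> - 1 < x -> is_derive x 1 (ode_step a c v) (c * ode_slope a v x).
Proof.
move=> a1 cv x1.
have cg : continuous (fun t : R => c * ode_slope a v t).
  by apply: continuousM_R; [move=> z; exact: cst_continuous|exact: ode_slope_continuous].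
have := @is_deriveD _ _ _ (cst (1 : R)) _ x 1 _ _ (is_derive_cst _ _ _) (is_derive_prim cg x1).
by rewrite add0r.
Qed.

Lemma ode_step0 (R : realType) (a c : R) (v : R -> R) : ode_step a c v 0 = 1.
Proof. by rewrite /ode_step prim0 addr0. Qed.

Lemma ode_slope_bounds (R : realType) (a x : R) (v : R -> R) : 1 < a -> 0 <= x ->
  continuous v -> 0 <= ode_slope a v x /\ a * ode_slope a v x <= 1.
Proof.
move=> a1 x0 cv; have a0 : 0 < a by lra.
have cF := comp_inv_sqr_continuous cv.
split; last by apply: avg_le => // t _; have /andP[] := inv_sqr_above1_bounds (v t).
rewrite -(pmulr_rge0 _ a0); apply: avg_ge => // t _.
by have /andP[] := inv_sqr_above1_bounds (v t).
Qed.

(* [max x 0] makes every iterate continuous on the whole line. *)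
Definition ode_iter (R : realType) (a c : R) (n : nat) : R -> R :=
  iter n (fun (v : R -> R) (x : R) => ode_step a c v (Num.max x 0)) (cst 1).

Lemma ode_step_max_continuous (R : realType) (a c : R) (v : R -> R) : 1 < a ->
  continuous v -> continuous (fun x : R => ode_step a c v (Num.max x 0)).
Proof.
move=> a1 cv x; apply: (@continuous_comp _ _ _ (fun x : R => Num.max x 0) (ode_step a c v)).
  exact: max0_continuous.
apply: is_derive_continuous (is_derive_ode_step c a1 cv _).
by apply: (@lt_le_trans _ _ 0); rewrite ?ltrN10// le_max lexx orbT.
Qed.

Lemma ode_iter_continuous (R : realType) (a c : R) n : 1 < a ->
  continuous (ode_iter a c n).
Proof.
move=> a1; elim: n => [|n IH] /=; first by move=> x; exact: cst_continuous.
exact: ode_step_max_continuous.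
Qed.

Lemma is_derive_expR_scale (R : realType) (k l x : R) :
  is_derive x 1 (fun t : R => k * expR (l * t)) (k * l * expR (l * x)).
Proof.
have d1 : is_derive x 1 (fun t : R => l * t) l.
  by apply: (is_derive_eq (@is_deriveZ _ _ _ (@id R) l x 1 1 (is_derive_id _ _))); exact: mulr1.
have d2 := @is_derive1_comp _ expR _ x _ _ (is_derive_expR _) d1.
apply: (is_derive_eq (@is_deriveZ _ _ _ _ k x 1 _ d2)).
by rewrite scaler_mul; ring.
Qed.

(* The weight exp(4ct/a) makes the Picard map a contraction with ratio 1/2 on [0, oo). *)
Lemma ode_step_contract (R : realType) (a c e : R) (v w : R -> R) : 1 < a -> 0 < c ->
  continuous v -> continuous w -> 0 <= e ->
  (forall t : R, 0 <= t -> `|v t - w t| <= e * expR (4 * c / a * t)) ->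
  forall x : R, 0 <= x ->
    `|ode_step a c v x - ode_step a c w x| <= e / 2 * expR (4 * c / a * x).
Proof.
move=> a1 c0 cv cw e0 h x x0; have a0 : 0 < a by lra.
set l := 4 * c / a in h *.
have l0 : 0 < l by rewrite divr_gt0// mulr_gt0.
have slope (v1 w1 : R -> R) (t : R) : continuous v1 -> continuous w1 ->
    (forall t : R, 0 <= t -> `|v1 t - w1 t| <= e * expR (l * t)) -> 0 <= t ->
    a * (ode_slope a v1 t - ode_slope a w1 t) <= 2 * e * expR (l * t).
  move=> cv1 cw1 h1 t0; apply: avg_sub_le => //.
  - exact: comp_inv_sqr_continuous.
  - exact: comp_inv_sqr_continuous.
  - move=> s /andP[s0 st] /=; apply: (le_trans (ler_norm _)).
    apply: (le_trans (inv_sqr_above1_lipschitz _ _)).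
    rewrite -mulrA; apply: ler_wpM2l => //; apply: (le_trans (h1 s s0)).
    by apply: ler_wpM2l => //; rewrite ler_expR ler_pM2l.
have half (v1 w1 : R -> R) : continuous v1 -> continuous w1 ->
    (forall t : R, 0 <= t -> `|v1 t - w1 t| <= e * expR (l * t)) ->
    ode_step a c v1 x - ode_step a c w1 x <= e / 2 * expR (l * x).
  move=> cv1 cw1 h1.
  pose k (t : R) : R := e / 2 * expR (l * t) - (ode_step a c v1 t - ode_step a c w1 t).
  have dk (t : R) : 0 <= t -> is_derive t 1 k (e / 2 * l * expR (l * t) -
      (c * ode_slope a v1 t - c * ode_slope a w1 t)).
    move=> t0; have t1 : - 1 < t by lra.
    exact: (@is_deriveB _ _ _ _ _ t 1 _ _ (is_derive_expR_scale (e / 2) l t)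
      (@is_deriveB _ _ _ _ _ t 1 _ _ (is_derive_ode_step c a1 cv1 t1)
        (is_derive_ode_step c a1 cw1 t1))).
  have : k 0 <= k x.
    apply: (@is_derive_ge0_le _ k (fun t : R => e / 2 * l * expR (l * t) -
      (c * ode_slope a v1 t - c * ode_slope a w1 t)) 0 x x0) => [t /andP[t0 _]|t /andP[t0 _]|t /andP[t0 _]].
    - exact: dk (ltW t0).
    - have := slope _ _ t cv1 cw1 h1 (ltW t0).
      rewrite subr_ge0 -mulrBr => H.
      rewrite (_ : e / 2 * l * expR (l * t) = c / a * (2 * e * expR (l * t))); last first.
        by rewrite /l; field; rewrite gt_eqF.
      rewrite -mulrA ler_pM2l// ler_pdivlMl//.
    - exact: is_derive_continuous (dk t t0).
  rewrite /k !ode_step0 subrr subr0 mulr0 expR0 mulr1.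
  have : 0 <= e / 2 by lra.
  lra.
rewrite ler_norml; apply/andP; split; last exact: half.
rewrite lerNl opprB; apply: half => // t t0; rewrite distrC; exact: h.
Qed.

Lemma ode_iter_step_close (R : realType) (a c : R) n x : 1 < a -> 0 < c -> 0 <= x ->
  `|ode_iter a c n.+1 x - ode_iter a c n x| <= (2 ^+ n)^-1 * expR (4 * c / a * x).
Proof.
move=> a1 c0; have a0 : 0 < a by lra.
have l0 : 0 < 4 * c / a by rewrite divr_gt0// mulr_gt0.
elim: n x => [|n IH] x x0.
  rewrite expr0 invr1 mul1r /= (max_idPl x0).
  have c1 : continuous (cst (1 : R) : R -> R) by move=> z; exact: cst_continuous.
  rewrite -[X in `|_ - X|]/(1 : R).
  (* The first iterate is squeezed between 1 and exp(4cx/a), its slope being at most c/a. *)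
  pose k (t : R) : R := 1 * expR (4 * c / a * t) - ode_step a c (cst 1) t.
  have dk (t : R) : 0 <= t -> is_derive t 1 k (1 * (4 * c / a) * expR (4 * c / a * t) -
      c * ode_slope a (cst 1) t).
    move=> t0; have t1 : - 1 < t by lra.
    exact: (@is_deriveB _ _ _ _ _ t 1 _ _ (is_derive_expR_scale 1 _ t)
      (is_derive_ode_step c a1 c1 t1)).
  have hk : k 0 <= k x.
    apply: (@is_derive_ge0_le _ k (fun t : R => 1 * (4 * c / a) * expR (4 * c / a * t) -
      c * ode_slope a (cst 1) t) 0 x x0) => [t /andP[t0 _]|t /andP[t0 _]|t /andP[t0 _]].
    - exact: dk (ltW t0).
    - have [_ H] := ode_slope_bounds a1 (ltW t0) c1.
      have lt0 : 0 <= 4 * c / a * t by apply: mulr_ge0; exact: ltW.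
      have E1 : 1 <= expR (4 * c / a * t) by apply: le_trans (expR_ge1Dx _); rewrite lerDl.
      rewrite subr_ge0 mul1r -(ler_pM2l a0) mulrCA.
      apply: (@le_trans _ _ (c * 1)); first by rewrite ler_pM2l.
      rewrite (_ : a * _ = c * (4 * expR (4 * c / a * t))); last by field; rewrite gt_eqF.
      by rewrite ler_pM2l//; lra.
    - exact: is_derive_continuous (dk t t0).
  have hs : ode_step a c (cst 1) 0 <= ode_step a c (cst 1) x.
    apply: (@is_derive_ge0_le _ (ode_step a c (cst 1)) (fun t : R => c * ode_slope a (cst 1) t) 0 x x0) => [t /andP[t0 _]|t /andP[t0 _]|t /andP[t0 _]].
    - by apply: is_derive_ode_step => //; lra.
    - have [H _] := ode_slope_bounds a1 (ltW t0) c1.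
      by rewrite mulr_ge0// ltW.
    - by apply: is_derive_continuous (is_derive_ode_step c a1 c1 _); lra.
  rewrite ode_step0 in hs.
  rewrite ger0_norm ?subr_ge0//.
  by move: hk; rewrite /k ode_step0 mulr0 expR0 !mul1r; lra.
rewrite [X in `|X - _|]/= [X in `|_ - X|]/= (max_idPl x0).
have := @ode_step_contract R a c (2 ^+ n)^-1 (ode_iter a c n.+1) (ode_iter a c n) a1 c0
  (@ode_iter_continuous R a c n.+1 a1) (@ode_iter_continuous R a c n a1) _ IH x x0.
rewrite -invfM -exprSr; apply.
by rewrite invr_ge0 exprn_ge0.
Qed.

(** The intervals of radius 2 e / 2^n around u n are nested; the supremum of their left ends lies in
    all of them, which gives the rate. *)
Lemma geometric_limit (R : realType) (u : nat -> R) (e : R) : 0 <= e ->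
  (forall n, `|u n.+1 - u n| <= (2 ^+ n)^-1 * e) ->
  exists l, forall n, `|l - u n| <= 2 * ((2 ^+ n)^-1 * e).
Proof.
move=> e0 hu.
pose d n : R := (2 ^+ n)^-1 * e.
have dS n : d n = 2 * d n.+1.
  by rewrite /d exprS invfM; field; rewrite expf_neq0.
have d0 n : 0 <= d n by rewrite mulr_ge0// invr_ge0 exprn_ge0.
have incr n k : u n - 2 * d n <= u (n + k)%N - 2 * d (n + k)%N.
  elim: k => [|k IH]; first by rewrite addn0.
  apply: (le_trans IH); rewrite addnS.
  have := hu (n + k)%N; rewrite -/(d _) ler_norml => /andP[h _].
  by have := dS (n + k)%N; have := d0 (n + k).+1; lra.
have decr n k : u (n + k)%N + 2 * d (n + k)%N <= u n + 2 * d n.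
  elim: k => [|k IH]; first by rewrite addn0.
  apply: le_trans IH; rewrite addnS.
  have := hu (n + k)%N; rewrite -/(d _) ler_norml => /andP[_ h].
  by have := dS (n + k)%N; have := d0 (n + k).+1; lra.
have AB n m : u n - 2 * d n <= u m + 2 * d m.
  apply: (le_trans (incr n m)); apply: le_trans (decr m n); rewrite addnC.
  by have := d0 (m + n)%N; lra.
pose S := range (fun n => u n - 2 * d n).
have hS : has_sup S.
  split; first by exists (u 0%N - 2 * d 0%N), 0%N.
  by exists (u 0%N + 2 * d 0%N) => _ [n _ <-].
exists (sup S) => n; rewrite -/(d n) ler_norml; apply/andP; split.
  have : u n - 2 * d n <= sup S by apply: ub_le_sup; [exact: hS.2|exists n].
  lra.
have : sup S <= u n + 2 * d n by apply: ge_sup; [exact: hS.1|move=> _ [m _ <-]].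
lra.
Qed.

Lemma half_pow_small (R : realType) (A e : R) : 0 < e -> exists n, (2 ^+ n)^-1 * A < e.
Proof.
move=> e0.
pose n := (Num.truncn (`|A| / e)).+1; exists n.
have n2 : (n%:R : R) <= 2 ^+ n by rewrite -natrX ler_nat ltnW// ltn_expl.
have hn : `|A| / e < n%:R by exact: truncnS_gt.
have p0 : (0 : R) < 2 ^+ n by rewrite exprn_gt0.
rewrite mulrC ltr_pdivrMr//; apply: (le_lt_trans (ler_norm A)).
by move: hn; rewrite ltr_pdivrMr// => /lt_le_trans; apply; rewrite mulrC ler_pM2l.
Qed.

Lemma ode_solution (R : realType) (a c : R) : 1 < a -> 0 < c ->
  exists v m : R -> R, [/\ v 0 = 1 /\ m 0 = a^-1, continuous m,
    forall x : R, - 1 < x -> is_derive x 1 v (c * m x),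
    forall x : R, 0 <= x -> 1 <= v x &
    forall x : R, 0 < x -> is_derive x 1 m ((v x ^- 2 - a * m x) / x)].
Proof.
move=> a1 c0; have a0 : 0 < a by lra.
have l0 : 0 < 4 * c / a by rewrite divr_gt0// mulr_gt0.
pose E (x : R) : R := expR (4 * c / a * Num.max x 0).
have E0 x : 0 <= E x by exact: expR_ge0.
have m0 (x : R) : 0 <= Num.max x 0 by rewrite le_max lexx orbT.
pose u n : R -> R := ode_iter a c n.
have umax n x : u n x = u n (Num.max x 0).
  by rewrite /u; case: n => [|n] //=; rewrite (max_idPl (m0 x)).
have ustep n x : `|u n.+1 x - u n x| <= (2 ^+ n)^-1 * E x.
  by rewrite (umax n) (umax n.+1); exact: ode_iter_step_close.
have uc n : continuous (u n) by exact: ode_iter_continuous.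
have /choice [v hv] : forall x, exists l, forall n, `|l - u n x| <= 2 * ((2 ^+ n)^-1 * E x).
  by move=> x; apply: geometric_limit.
have vc : continuous v.
  apply: continuous_norm_le => x e e0.
  have Eb y : `|x - y| <= 1 -> E y <= E (`|x| + 1).
    move=> xy; rewrite ler_expR ler_pM2l// (max_idPl (_ : 0 <= `|x| + 1)) ?addr_ge0//.
    rewrite ge_max addr_ge0// andbT; have := ler_norm (y - x); rewrite distrC.
    by have := ler_norm x; lra.
  have e4 : 0 < e / 4 by rewrite divr_gt0.
  have [n hn] := half_pow_small (2 * E (`|x| + 1)) e4.
  have e2 : 0 < e / 4 by rewrite divr_gt0.
  have un := uc n x.
  move/cvgrPdist_le: un => /(_ _ e2) un.
  have h1 := near_norm_le x (@ltr01 R).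
  near=> y.
  have y1 : `|x - y| <= 1 by near: y; exact: h1.
  have yu : `|u n x - u n y| <= e / 4 by near: y; exact: un.
  have p0 : 0 <= (2 ^+ n)^-1 :> R by rewrite invr_ge0 exprn_ge0.
  have bx : `|v x - u n x| <= e / 4.
    apply: (le_trans (hv x n)); apply: le_trans (ltW hn); rewrite mulrCA.
    apply: ler_wpM2l => //; apply: ler_wpM2l => //; apply: Eb.
    by rewrite subrr normr0.
  have byy : `|v y - u n y| <= e / 4.
    apply: (le_trans (hv y n)); apply: le_trans (ltW hn); rewrite mulrCA.
    by apply: ler_wpM2l => //; apply: ler_wpM2l => //; exact: Eb.
  have := ler_distD (u n x) (v x) (v y); have := ler_distD (u n y) (u n x) (v y).
  by rewrite (distrC (u n y)); lra.
have fixed x : 0 <= x -> ode_step a c v x = v x.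
  move=> x0; apply/eqP; rewrite -subr_eq0 -normr_eq0; apply/eqP.
  apply/eqP; rewrite eq_le normr_ge0 andbT leNgt; apply/negP => pos.
  have [n hn] := half_pow_small (2 * E x) pos.
  have H : forall t : R, 0 <= t -> `|v t - u n t| <= 2 * (2 ^+ n)^-1 * expR (4 * c / a * t).
    by move=> t t0; have := hv t n; rewrite /E (max_idPl t0) mulrA.
  have p0 : 0 <= 2 * (2 ^+ n)^-1 :> R by rewrite mulr_ge0// invr_ge0 exprn_ge0.
  have H1 := ode_step_contract a1 c0 vc (uc n) p0 H x0.
  have H2 := hv x n.+1.
  rewrite /u /= (max_idPl x0) -/(ode_iter a c n) -/(u n) in H2.
  have := ler_distD (ode_step a c (u n) x) (ode_step a c v x) (v x).
  rewrite (distrC (ode_step a c (u n) x) (v x)).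
  have e1 : E x = expR (4 * c / a * x) by rewrite /E (max_idPl x0).
  rewrite -e1 in H1.
  have e2 : 2 * ((2 ^+ n.+1)^-1 * E x) = (2 ^+ n)^-1 * E x.
    by rewrite exprS invfM; field; rewrite expf_neq0.
  rewrite e2 in H2.
  have e3 : 2 * (2 ^+ n)^-1 / 2 * E x = (2 ^+ n)^-1 * E x.
    by field; rewrite expf_neq0.
  rewrite e3 in H1.
  by rewrite mulrCA in hn; lra.
have step1 x : 0 <= x -> 1 <= ode_step a c v x.
  move=> x0; rewrite -(ode_step0 a c v).
  apply: (@is_derive_ge0_le _ (ode_step a c v) (fun t : R => c * ode_slope a v t) 0 x x0) => [t /andP[t0 _]|t /andP[t0 _]|t /andP[t0 _]].
  - by apply: is_derive_ode_step => //; lra.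
  - have [H _] := ode_slope_bounds a1 (ltW t0) vc.
    by rewrite mulr_ge0// ltW.
  - by apply: is_derive_continuous (is_derive_ode_step c a1 vc _); lra.
have cF := comp_inv_sqr_continuous vc.
(* The iterates, and with them v, are constant on x <= 0. The Picard image of v agrees with v for x
   >= 0 and is moreover differentiable across 0. *)
exists (ode_step a c v), (ode_slope a v); split.
- split; first exact: ode_step0.
  rewrite /ode_slope /avg ltxx /= /inv_sqr_above1 -(fixed 0)// ode_step0 maxxx.
  by rewrite expr1n invr1 mul1r.
- exact: ode_slope_continuous.
- by move=> x x1; exact: is_derive_ode_step.
- exact: step1.
- move=> x x0; have := is_derive_avg a1 x0 cF; congr is_derive.
  congr ((_ - _) / _); rewrite /= fixed ?(ltW x0)// /inv_sqr_above1.
  by rewrite (max_idPl _)// -fixed ?(ltW x0)// step1 ?(ltW x0).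
Unshelve. all: by end_near.
Qed.

(** * The stable radial solution *)

Lemma continuous_atM (R : realType) (f g : R -> R) (t : R) : {for t, continuous f} ->
  {for t, continuous g} -> {for t, continuous (fun x : R => f x * g x)}.
Proof. by move=> cf cg; exact: cvgM cf cg. Qed.

Lemma continuous_atD (R : realType) (f g : R -> R) (t : R) : {for t, continuous f} ->
  {for t, continuous g} -> {for t, continuous (fun x : R => f x + g x)}.
Proof. by move=> cf cg; exact: cvgD cf cg. Qed.

Lemma continuous_atB (R : realType) (f g : R -> R) (t : R) : {for t, continuous f} ->
  {for t, continuous g} -> {for t, continuous (fun x : R => f x - g x)}.
Proof. by move=> cf cg; exact: cvgB cf cg. Qed.

(* Integrates t f' + p f >= 0 through the factor t^p, which vanishes at 0. *)
Lemma euler_ineq_ge0 (R : realType) (p : R) (f df : R -> R) : 0 < p ->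
  (forall t : R, 0 < t -> is_derive t 1 f (df t)) ->
  (forall t : R, 0 <= t -> {for t, continuous f}) ->
  (forall t : R, 0 < t -> 0 <= t * df t + p * f t) ->
  forall x : R, 0 < x -> 0 <= f x.
Proof.
move=> p0 dfE cf h x x0.
pose F (t : R) : R := (Num.max t 0) `^ p * f t.
have : F 0 <= F x.
  apply: (@is_derive_ge0_le _ F (fun t : R => t `^ (p - 1) * (t * df t + p * f t)) 0 x (ltW x0))
    => [t /andP[t0 _]|t /andP[t0 _]|t /andP[t0 _]].
  - have d1 : is_derive t 1 (fun t : R => (Num.max t 0) `^ p) (p * t `^ (p - 1)).
      exact: is_derive_max0_powR.
    apply: (is_derive_eq (is_deriveM d1 (dfE t t0))).
    have E : t `^ p = t `^ (p - 1) * t.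
      by rewrite powRB ?powRr1 ?(ltW t0)// ?(gt_eqF t0) ?implybT// divfK// gt_eqF.
    by rewrite !scaler_mul (max_idPl (ltW t0)) E; ring.
  - by rewrite mulr_ge0 ?powR_ge0// h.
  - apply: continuous_atM; [exact: max0_powR_continuous|exact: cf].
rewrite /F (max_idPl (ltW x0)) (max_idPl (lexx 0)) powR0 ?gt_eqF// mul0r.
by rewrite pmulr_rge0// powR_gt0.
Unshelve. all: by end_near.
Qed.

Lemma real_roots (R : realType) (n Q : R) : 0 < n -> 0 < Q -> 8 * Q <= n ^+ 2 ->
  exists l1 l2 : R, [/\ 0 < l1, 0 < l2, l1 + l2 = n & l1 * l2 = 2 * Q].
Proof.
move=> n0 Q0 h; pose d := Num.sqrt (n ^+ 2 - 8 * Q).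
have d0 : 0 <= d by exact: sqrtr_ge0.
have d2 : d ^+ 2 = n ^+ 2 - 8 * Q by rewrite sqr_sqrtr// subr_ge0.
have dn : d < n by nra.
exists ((n - d) / 2), ((n + d) / 2); split; [lra|lra|by field|].
by rewrite (_ : _ * _ = (n ^+ 2 - d ^+ 2) / 4); [rewrite d2; field|field].
Qed.

(* B t^(1/3), with B^3 = 1/Q, is the singular solution. The operator linearised there factors as
   (k t d/dt + l1)(k t d/dt + l2), and convexity of s^-2 makes its value at the difference
   nonnegative. *)
Lemma singular_comparison (R : realType) (a c k n Q : R) (v m : R -> R) :
  0 < k -> 0 < n -> a = 1 + n / k -> c = (k ^+ 2)^-1 ->
  Q = k / 3 * (k / 3 + n) -> 8 * Q <= n ^+ 2 ->
  v 0 = 1 -> continuous m ->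
  (forall x : R, - 1 < x -> is_derive x 1 v (c * m x)) ->
  (forall x : R, 0 <= x -> 1 <= v x) ->
  (forall x : R, 0 < x -> is_derive x 1 m ((v x ^- 2 - a * m x) / x)) ->
  forall x : R, 0 <= x -> x <= Q * v x ^+ 3.
Proof.
move=> k0 n0 aE cE QE h8 v0 cm dv v1 dm x; rewrite le_eqVlt => /predU1P[<-|x0].
  by rewrite v0 expr1n mulr1 QE mulr_ge0//; lra.
have Q0 : 0 < Q by rewrite QE mulr_gt0//; lra.
(* With D = k t d/dt the equation reads (D^2 + n D) v = t v^-2. On t^(1/3) the left operator is
   multiplication by Q, and linearising at b adds 2 t b^-3 = 2 Q; hence the roots of sum n and
   product 2 Q. *)
have [l1 [l2 [l10 l20 lS lP]]] := real_roots n0 Q0 h8.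
have t3 : 0 < (3^-1 : R) by rewrite invr_gt0.
pose B := Q^-1 `^ 3^-1.
have B0 : 0 < B by rewrite powR_gt0// invr_gt0.
have B3 : B ^+ 3 = Q^-1.
  rewrite -powR_mulrn ?powR_ge0// -powRrM mulVf ?powRr1//.
  by rewrite invr_ge0 ltW.
pose b (t : R) : R := B * (Num.max t 0) `^ 3^-1.
have b3 t : 0 <= t -> t = Q * b t ^+ 3.
  move=> t0; rewrite /b (max_idPl t0) exprMn B3 mulrA mulfV ?gt_eqF// mul1r.
  by rewrite -powR_mulrn ?powR_ge0// -powRrM mulVf ?powRr1.
have b0 t : 0 <= b t by rewrite mulr_ge0 ?powR_ge0// ltW.
have cb : continuous b.
  by apply: continuousM_R; [move=> z; exact: cst_continuous|exact: max0_powR_continuous].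
have db (t : R) : 0 < t -> is_derive t 1 b (b t / (3 * t)).
  move=> t0.
  have d1 : is_derive t 1 (fun t : R => (Num.max t 0) `^ 3^-1) (3^-1 * t `^ (3^-1 - 1)).
      exact: is_derive_max0_powR.
  apply: (is_derive_eq (@is_deriveZ _ _ _ _ B t 1 _ d1)).
  rewrite scaler_mul /b (max_idPl (ltW t0)) powRB ?powRr1 ?(ltW t0)//; last first.
    by rewrite (gt_eqF t0) implybT.
  by field; rewrite gt_eqF.
have cv (t : R) : 0 <= t -> {for t, continuous v}.
  by move=> t0; apply: is_derive_continuous (dv t _); lra.
pose w (t : R) : R := v t - b t.
have dw (t : R) : 0 < t -> is_derive t 1 w (c * m t - b t / (3 * t)).
  by move=> t0; apply: is_deriveB; [apply: dv; lra|exact: db].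
have cw (t : R) : 0 <= t -> {for t, continuous w}.
  by move=> t0; apply: continuous_atB; [exact: cv|exact: cb].
(* w1 = k t w' + l2 w. One first-order inequality, with l1, gives w1 >= 0, and a second one, with
   l2, gives w >= 0. *)
pose w1 (t : R) : R := (k * c) * (t * m t) - (k / 3) * b t + l2 * w t.
pose dw1 (t : R) : R := (k * c) * (t * ((v t ^- 2 - a * m t) / t) + m t) -
   (k / 3) * (b t / (3 * t)) + l2 * (c * m t - b t / (3 * t)).
have w1_ge0 : forall t : R, 0 < t -> 0 <= w1 t.
  apply: (@euler_ineq_ge0 _ (l1 / k) w1 dw1); first exact: divr_gt0.
  - move=> t t0.
    have e1 : is_derive t 1 (fun t : R => t * m t) (t * ((v t ^- 2 - a * m t) / t) + m t).
      apply: (is_derive_eq (@is_deriveM _ _ (@id R) m t 1 _ _ (is_derive_id _ _) (dm t t0))).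
      by rewrite !scaler_mul mulr1.
    have e2 := @is_deriveZ _ _ _ _ (k * c) t 1 _ e1.
    have e3 := @is_deriveZ _ _ _ _ (k / 3) t 1 _ (db t t0).
    have e4 := @is_deriveZ _ _ _ _ l2 t 1 _ (dw t t0).
    exact: (@is_deriveD _ _ _ _ _ t 1 _ _ (@is_deriveB _ _ _ _ _ t 1 _ _ e2 e3) e4).
  - move=> t t0.
    have cc (z s : R) : {for s, continuous (fun _ : R => z)} by exact: cst_continuous.
    have k1 : {for t, continuous (fun t : R => (k * c) * (t * m t))}.
      apply: continuous_atM; first exact: cc.
      apply: continuous_atM; last exact: cm.
      exact: (is_derive_continuous (is_derive_id t (1 : R))).
    have k2 : {for t, continuous (fun t : R => k / 3 * b t)} by apply: continuous_atM; [exact: cc|exact: cb].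
    have k3 : {for t, continuous (fun t : R => l2 * w t)} by apply: continuous_atM; [exact: cc|exact: cw].
    by apply: continuous_atD => //; exact: continuous_atB.
  - move=> t t0; rewrite /w1 /dw1 /w.
    have vt : 1 <= v t by apply: v1; exact: ltW.
    have E : t * (k * c * (t * ((v t ^- 2 - a * m t) / t) + m t) - k / 3 * (b t / (3 * t)) +
       l2 * (c * m t - b t / (3 * t))) +
      l1 / k * (k * c * (t * m t) - k / 3 * b t + l2 * (v t - b t)) =
      (t * v t ^- 2 - Q * b t + l1 * l2 * (v t - b t)) / k.
      rewrite aE cE QE -lS; field.
      by rewrite !gt_eqF//; lra.
    rewrite E lP divr_ge0 ?(ltW k0)//.
    rewrite [X in X * _](b3 t (ltW t0)).
    move: (v t) (b t) vt (b0 t) => p r p1 r0.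
    have p0 : 0 < p by lra.
    (* With t = Q r^3 this is the gap between p^-2 and its tangent at r, made explicit: r^3 / p^2 -
       r + 2 (p - r). *)
    rewrite (_ : _ + _ = Q * ((p - r) ^+ 2 * (2 * p + r) / p ^+ 2)); last first.
      by field; rewrite gt_eqF.
    apply: mulr_ge0; first exact: ltW.
    apply: divr_ge0; last exact: sqr_ge0.
    by apply: mulr_ge0; [exact: sqr_ge0|lra].
have w_ge0 : 0 <= w x.
  apply: (@euler_ineq_ge0 _ (l2 / k) w (fun t : R => c * m t - b t / (3 * t))) => //.
    exact: divr_gt0.
  move=> t t0.
  rewrite (_ : _ + _ = w1 t / k); first by rewrite divr_ge0 ?(ltW k0)// w1_ge0.
  by rewrite /w1 cE; field; rewrite !gt_eqF.
have bv : b x <= v x by rewrite -subr_ge0.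
rewrite [leLHS](b3 x (ltW x0)) ler_pM2l// lerXn2r ?nnegrE//.
by apply: le_trans (b0 x) bv.
Unshelve. all: by end_near.
Qed.

(** With s = sqrt 6, n^2 - 8 g n - 8 g^2 = (n - g (4 + 2 s)) (n + g (2 s - 4)), and alpha <= alpha_N
    says that the first factor is nonnegative. *)
Lemma exponent_condition (R : realType) N (alpha : R) : 0 <= alpha ->
  alpha <= alphaN R N ->
  8 * ((alpha + 2) / 3 * ((alpha + 2) / 3 + (N%:R - 2))) <= (N%:R - 2) ^+ 2.
Proof.
move=> a0; rewrite /alphaN; set s := Num.sqrt 6.
have s0 : 0 <= s by exact: sqrtr_ge0.
have s2 : s ^+ 2 = 6 by rewrite sqr_sqrtr.
have sg : 2 < s by nra.
rewrite ler_pdivlMr; last by lra.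
move=> H; set g := (alpha + 2) / 3; set n := N%:R - 2.
have g0 : 0 < g by rewrite /g; lra.
have gn : g * (4 + 2 * s) <= n by rewrite /g /n; lra.
have E : n ^+ 2 - 8 * (g * (g + n)) = (n - g * (4 + 2 * s)) * (n + g * (2 * s - 4)) +
   g ^+ 2 * (4 * (s ^+ 2 - 6)) by ring.
rewrite -subr_ge0 E s2 subrr !mulr0 addr0 mulr_ge0 ?subr_ge0//.
have : 0 <= g * (2 * s - 4) by rewrite mulr_ge0 ?(ltW g0)//; lra.
have : 0 <= g * (4 + 2 * s) by rewrite mulr_ge0 ?(ltW g0)//; lra.
lra.
Qed.

Lemma continuous_at_normP (R : realType) (V W : normedModType R) (f : V -> W) (y : V) :
  {for y, continuous f} <->
  (forall e, 0 < e -> \forall z \near y, `|f y - f z| <= e).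
Proof. by split=> [/cvgrPdist_le h e /h|h]; [|apply/cvgrPdist_le]. Qed.

(** Continuity of g at 0 suffices. It yields the derivatives at the origin, where the radial powers
    need not be differentiable. *)
Lemma is_derive_mul_id (R : realType) (g : R -> R) : {for 0, continuous g} ->
  is_derive (0 : R) 1 (fun s : R => g s * s) (g 0).
Proof.
move=> cg.
have H : (fun h : R => h^-1 *: (((fun s : R => g s * s) \o shift (0 : R)) (h *: (1 : R)) -
    g 0 * 0)) @ 0^' --> g 0.
  apply/cvgrPdist_le => e e0.
  move/cvgrPdist_le: cg => /(_ e e0) cg.
  near=> h.
  have h0 : h != 0 by near: h; exact: nbhs_dnbhs_neq.
  have hg : `|g 0 - g h| <= e by near: h; apply: nbhs_dnbhs.
  rewrite /shift /= addr0 mulr0 subr0 !scaler_mul mulr1.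
  by rewrite mulrCA mulVf// mulr1.
split; [by apply/cvg_ex; exists (g 0)|exact: cvg_lim H].
Unshelve. all: by end_near.
Qed.

Lemma continuous_line (R : realType) N (f : 'rV[R]_N -> R) (v : 'rV[R]_N) : continuous f ->
  {for (0 : R), continuous (fun s : R => f (s *: v))}.
Proof.
move=> cf; apply: (@continuous_comp _ _ _ (fun s : R => s *: v) f); last exact: cf.
exact: (@scalel_continuous _ _ v 0).
Qed.

Lemma sqn0 (R : realType) N : sqn (0 : 'rV[R]_N) = 0.
Proof. by rewrite /sqn big1// => i _; rewrite mxE expr0n. Qed.

Lemma sqn_gt0 (R : realType) N (y : 'rV[R]_N) : y != 0 -> 0 < sqn y.
Proof.
move=> y0; rewrite lt_neqAle sqn_ge0 andbT eq_sym; apply: contra y0 => /eqP h.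
apply/eqP/rowP => i; rewrite mxE; apply/eqP; rewrite -sqrf_eq0.
by apply/eqP; apply/eqP; rewrite eq_le sqr_ge0 andbT -h coord_sqr_le.
Qed.

Lemma sqn_delta (R : realType) N (i : 'I_N) (s : R) :
  sqn (s *: (delta_mx ord0 i : 'rV[R]_N)) = s * s.
Proof.
rewrite /sqn (bigD1 i)//= big1 ?addr0 => [|j ji].
  by rewrite !mxE !eqxx mulr1 expr2.
by rewrite !mxE (negbTE ji) andbF mulr0 expr0n.
Qed.

Lemma enorm_powR (R : realType) N (y : 'rV[R]_N) (p : R) :
  enorm y `^ p = sqn y `^ (p / 2).
Proof.
rewrite /enorm -/(sqn y) -powR12_sqrt ?sqn_ge0// -powRrM.
by congr (_ `^ _); rewrite mulrC.
Qed.

Lemma is_derive_enorm_powR (R : realType) N (y : 'rV[R]_N) (p : R) i : y != 0 ->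
  is_derive y (delta_mx ord0 i) (fun z : 'rV[R]_N => enorm z `^ p)
    (p * (enorm y `^ p / sqn y) * y ord0 i).
Proof.
move=> y0; have s0 := sqn_gt0 y0.
rewrite (_ : (fun z => _) = (fun z : 'rV[R]_N => sqn z `^ (p / 2))); last first.
  by apply/funext => z; rewrite enorm_powR.
have := is_derive_powR_dir (p / 2) i (@Ck_sqn R N 1) s0.
rewrite partial_sqn enorm_powR; congr is_derive.
rewrite powRB ?powRr1 ?(ltW s0)//; last by rewrite (gt_eqF s0) implybT.
by field; rewrite gt_eqF.
Qed.

Lemma radial_weight_split (R : realType) N (alpha : R) (y : 'rV[R]_N) : 0 <= alpha ->
  enorm y `^ (alpha + 2) = enorm y `^ alpha * sqn y.
Proof.
move=> a0; have [->|y0] := eqVneq y 0.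
  by rewrite sqn0 mulr0 enorm_powR sqn0 powR0// gt_eqF//; lra.
rewrite powRD; first by rewrite (powR_mulrn 2) ?sqrtr_ge0// enorm_sqr.
by apply/implyP => _; rewrite sqrtr_eq0 -ltNge sqn_gt0.
Qed.

(* U(y) = v(|y|^(alpha+2)) turns the radial equation into
   x v'' + a v' = c v^-2, with c m = v'. *)
Lemma radial_solution (R : realType) N (alpha a c : R) (v m : R -> R) :
  0 <= alpha -> 2 < N%:R :> R ->
  a = 1 + (N%:R - 2) / (alpha + 2) -> c = ((alpha + 2) ^+ 2)^-1 ->
  m 0 = a^-1 -> v 0 = 1 -> continuous m ->
  (forall x : R, - 1 < x -> is_derive x 1 v (c * m x)) ->
  (forall x : R, 0 <= x -> 1 <= v x) ->
  (forall x : R, 0 < x -> is_derive x 1 m ((v x ^- 2 - a * m x) / x)) ->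
  positive_solution alpha (fun y : 'rV[R]_N => v (enorm y `^ (alpha + 2))).
Proof.
move=> al0 N2 aE cE m0 v0 cm dv v1 dm.
set k := alpha + 2 in aE cE *.
have k0 : 0 < k by rewrite /k; lra.
have k_neq0 : k != 0 by rewrite gt_eqF.
have a0 : 0 < a by rewrite aE ltr_pwDl// divr_ge0 ?(ltW k0)//; lra.
pose rho (y : 'rV[R]_N) := enorm y `^ k.
pose w (y : 'rV[R]_N) := enorm y `^ alpha.
pose U (y : 'rV[R]_N) := v (rho y).
have rho0 y : 0 <= rho y by exact: powR_ge0.
have rhoE y : rho y = w y * sqn y by exact: radial_weight_split.
have cw : continuous w by exact: enorm_powR_continuous.
have crho : continuous rho by apply: enorm_powR_continuous; exact: ltW.
have dvr y : is_derive (rho y) 1 v (c * m (rho y)).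
  by apply: dv; apply: lt_le_trans (rho0 y).
have cU : continuous U.
  by move=> y; apply: (continuous_comp (crho y)); exact: is_derive_continuous (dvr y).
have cmr : continuous (fun y => m (rho y)).
  by move=> y; apply: (continuous_comp (crho y)); exact: cm.
have U1 y : 1 <= U y by exact: v1.
have rho00 : rho 0 = 0 by rewrite rhoE sqn0 mulr0.
have drho i y : is_derive y (delta_mx ord0 i) rho (k * w y * y ord0 i).
  have [->|y0] := eqVneq y 0.
    apply: line_derive; rewrite mxE mulr0.
    have cg : {for (0 : R), continuous (fun s : R => w (s *: (delta_mx ord0 i : 'rV[R]_N)) * s)}.
      apply: continuous_atM; first exact: continuous_line.
      exact: (is_derive_continuous (is_derive_id (0 : R) (1 : R))).
    have := is_derive_mul_id cg; rewrite mulr0; congr is_derive.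
    by apply/funext => s; rewrite add0r rhoE sqn_delta mulrA.
  have s0 := sqn_gt0 y0.
  apply: (is_derive_eq (is_derive_enorm_powR k i y0)).
  by rewrite -/(rho y) rhoE; field; rewrite gt_eqF.
pose P (y : 'rV[R]_N) := c * k * (m (rho y) * w y).
have cP : continuous P.
  apply: continuousM_rV; first by move=> y; exact: cst_continuous.
  exact: continuousM_rV.
have dU i y : is_derive y (delta_mx ord0 i) U (P y * y ord0 i).
  apply: (is_derive_eq (is_derive_comp_dir (dvr y) (drho i y))).
  by rewrite /P; ring.
(* L is the radial derivative r d/dr of m(rho) w, rewritten by the equation for m; up to the factor
   c k, it is the part of the Hessian of U along y. *)
pose L (y : 'rV[R]_N) := (k * ((U y * U y)^-1 - a * m (rho y)) + alpha * m (rho y)) * w y.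
have cL : continuous L.
  have cc z : continuous (fun _ : 'rV[R]_N => z : R) by move=> y; exact: cst_continuous.
  have cD (f g : 'rV[R]_N -> R) : continuous f -> continuous g -> continuous (fun y => f y + g y).
    by move=> cf cg y; exact: cvgD (cf y) (cg y).
  apply: continuousM_rV => //; apply: (cD); last exact: continuousM_rV.
  apply: continuousM_rV => //.
  have -> : (fun y => (U y * U y)^-1 - a * m (rho y)) =
     (fun y => 1 / (U y * U y) + (- a) * m (rho y)).
    by apply/funext => y; rewrite div1r mulNr.
  apply: (cD); last exact: continuousM_rV.
  apply: continuousM_V => //; first exact: continuousM_rV.
  by move=> y; have := U1 y => h; rewrite mulf_neq0// gt_eqF//; lra.
(* The initial values v 0 = 1 and m 0 = 1/a cancel the first part, and alpha w(0) = 0 cancels the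
   second. This makes the second derivatives continuous at the origin. *)
have L0 : L 0 = 0.
  rewrite /L /U rho00 v0 m0 mulfV ?gt_eqF// mulr1 invr1 subrr mulr0 add0r.
  have [->|al] := eqVneq alpha 0; first by rewrite !mul0r.
  by rewrite /w enorm_powR sqn0 powR0 ?mulr0// mulf_neq0// invr_neq0.
pose S (j i : 'I_N) (y : 'rV[R]_N) :=
  c * k * (L y * (y ord0 j * y ord0 i / sqn y) + m (rho y) * w y * (j == i)%:R).
have dP i j y : is_derive y (delta_mx ord0 j) (fun z => P z * z ord0 i) (S j i y).
  have [->|y0] := eqVneq y 0.
    apply: line_derive.
    have cg := @continuous_line R N _ (delta_mx ord0 j) cP.
    have := @is_deriveZ _ _ _ _ (j == i)%:R (0 : R) (1 : R) _ (is_derive_mul_id cg).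
    rewrite scale0r /S L0 mul0r add0r scaler_mul.
    have -> : (j == i)%:R * P 0 = c * k * (m (rho 0) * w 0 * (j == i)%:R) by rewrite /P; ring.
    congr is_derive; apply/funext => s; rewrite add0r !mxE eqxx /= scaler_mul eq_sym; ring.
  have s0 := sqn_gt0 y0.
  have w0 : 0 < w y.
    by rewrite /w enorm_powR powR_gt0.
  have rp : 0 < rho y by rewrite rhoE mulr_gt0.
  have d1 := is_derive_comp_dir (dm _ rp) (drho j y).
  have d2 := is_deriveM d1 (is_derive_enorm_powR alpha j y0).
  have d3 := @is_deriveZ _ _ _ _ (c * k) y _ _ d2.
  apply: (is_derive_eq (is_deriveM d3 (is_derive_coord j i y))).
  rewrite !scaler_mul !fctE /S /L -/(w y) -/(U y) rhoE /= rhoE.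
  have u0 : U y != 0 by rewrite gt_eqF//; apply: lt_le_trans (U1 y).
  rewrite -/(U y) -/(w y) scaler_mul; field.
  by rewrite u0 !gt_eqF.
have cS j i : continuous (S j i).
  have cc z : continuous (fun _ : 'rV[R]_N => z : R) by move=> y; exact: cst_continuous.
  have cD (f g : 'rV[R]_N -> R) : continuous f -> continuous g -> continuous (fun y => f y + g y).
    by move=> cf cg y; exact: cvgD (cf y) (cg y).
  apply: continuousM_rV => //; apply: (cD); last first.
    by apply: continuousM_rV => //; exact: continuousM_rV.
  have bnd y : `|L y * (y ord0 j * y ord0 i / sqn y)| <= `|L y|.
    rewrite normrM ler_piMr//.
    (* At 0 the quotient takes the default value 0. *)
    have [->|y0] := eqVneq y 0; first by rewrite !mxE !mul0r normr0.
    have s0 := sqn_gt0 y0.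
    rewrite normrM normfV (gtr0_norm s0) ler_pdivrMr// mul1r.
    have h1 := coord_sqr_le y i; have h2 := coord_sqr_le y j.
    rewrite ler_norml; nra.
  move=> y; have [->|y0] := eqVneq y 0.
    move: (0 : 'rV[R]_N) L0 => z Lz.
    have hc : L z * (z ord0 j * z ord0 i / sqn z) = 0 by rewrite Lz mul0r.
    apply/continuous_at_normP => e e0.
    have /continuous_at_normP /(_ e e0) := cL z.
    apply: filterS => x; rewrite hc Lz !sub0r !normrN => hx.
    exact: le_trans (bnd x) hx.
  have s0 := sqn_gt0 y0.
  have ci i0 : continuous (fun z : 'rV[R]_N => z ord0 i0) by exact: coord_continuous.
  have cs : continuous (@sqn R N) by exact: (Ck_continuous (@Ck_sqn R N 0)).
  exact: cvgM (cL y) (cvgM (cvgM (ci j y) (ci i y)) (cvgV (lt0r_neq0 s0) (cs y))).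
split.
- apply: (@CkS _ _ _ _ (fun i y => P y * y ord0 i)) => // i.
  apply: (@CkS _ _ _ _ (fun j => S j i)) => //.
  by apply: continuousM_rV => //; exact: coord_continuous.
- by exists 1.
- move=> y; rewrite /laplacian -/(U y) -/(w y).
  have pE i : partial i (partial i U) y = S i i y.
    have -> : partial i U = (fun z => P z * z ord0 i) by apply/funext => z; apply: partialE.
    exact/partialE.
  under eq_bigr do rewrite pE /S eqxx mulr1.
  rewrite -mulr_sumr big_split /= sumr_const card_ord -mulr_sumr -mulr_suml.
  have -> : \sum_(i < N) y ord0 i * y ord0 i = sqn y.
    by apply: eq_bigr => i _; rewrite expr2.
  have -> : L y * (sqn y / sqn y) = L y.
    have [->|y0] := eqVneq y 0; first by rewrite L0 mul0r.
    by rewrite mulfV ?mulr1// gt_eqF// sqn_gt0.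
  rewrite -[X in _ + X]mulr_natl /L cE.
  have u0 : U y != 0 by rewrite gt_eqF//; apply: lt_le_trans (U1 y).
  have aE' : a * k = k + (N%:R - 2) by rewrite aE; field.
  (* The trace leaves a multiple of alpha + N - a k, which is 0: this is what fixes a. *)
  rewrite (_ : _ * _ = w y / U y ^+ 2 + k^-1 * (m (rho y) * w y) * (alpha + N%:R - a * k)); last first.
    by field; rewrite u0 k_neq0.
  by rewrite aE' /k (_ : _ - _ = 0) ?mulr0 ?addr0//; ring.
Qed.

Lemma stable_solution_exists (R : realType) N (alpha : R) : (8 <= N)%N ->
  0 <= alpha -> alpha <= alphaN R N ->
  exists U : 'rV[R]_N -> R, positive_solution alpha U /\ (0 <= mu1 alpha U)%E.
Proof.
move=> N8 al0 alN.
have N8' : (8 : R) <= N%:R by rewrite ler_nat.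
have k0 : 0 < alpha + 2 by lra.
have n0 : 0 < N%:R - 2 :> R by lra.
pose a : R := 1 + (N%:R - 2) / (alpha + 2).
pose c : R := ((alpha + 2) ^+ 2)^-1.
have a1 : 1 < a by rewrite ltrDl divr_gt0.
have c0 : 0 < c by rewrite invr_gt0 exprn_gt0.
have [v [m [[v0 m0] cm dv v1 dm]]] := ode_solution a1 c0.
have N2 : 2 < N%:R :> R by lra.
have sU := @radial_solution R N alpha a c v m al0 N2 erefl erefl m0 v0 cm dv v1 dm.
set U := (fun y : 'rV[R]_N => _) in sU.
exists U; split=> //.
have [cU _ _] := sU.
have U0 y : 0 < U y by apply: lt_le_trans (v1 _ (powR_ge0 _ _)).
have cV := potential_continuous al0 (Ck_continuous cU) U0.
have h8 := exponent_condition al0 alN.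
apply: le_ereal_inf_tmp => _ [phi [tphi _] <-].
have bphi := test_function_bounded_support tphi; have sphi : smooth phi := tphi.1.
rewrite /energy integral_RN_EFin; last exact: (Cc_rayleigh cV (sphi 1%N) bphi).
rewrite lee_fin.
apply: (@hardy_stable R N ((N%:R - 2) / 2) (potential alpha U) phi) => //.
- by rewrite divr_gt0.
- by field.
(* The comparison gives |y|^(alpha+2) <= Q U^3, so V |y|^2 <= 2 Q <= ((N - 2) / 2)^2. *)
- move=> y; have H := singular_comparison k0 n0 erefl erefl erefl h8 v0 cm dv v1 dm
    (powR_ge0 (enorm y) (alpha + 2)).
  rewrite -/(U y) radial_weight_split// in H.
  rewrite /potential mulrAC ler_pdivrMr ?exprn_gt0//.
  move: ((alpha + 2) / 3 * _) H h8 => Q H h8.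
  have U3 : 0 < U y ^+ 3 by rewrite exprn_gt0.
  apply: (@le_trans _ _ (2 * Q * U y ^+ 3)); first by rewrite -!mulrA ler_pM2l.
  by apply: ler_wpM2r; [exact: ltW|lra].
Qed.

Theorem theorem1p4 (R : realType) (N : nat) (alpha : R) :
  ((1 <= N <= 7)%N /\ 0 <= alpha \/ (8 <= N)%N /\ alphaN R N < alpha ->
   forall U : 'rV[R]_N -> R, positive_solution alpha U ->
     (mu1 alpha U < 0)%E) /\
  ((8 <= N)%N -> 0 <= alpha <= alphaN R N ->
   exists U : 'rV[R]_N -> R,
     positive_solution alpha U /\ (0 <= mu1 alpha U)%E).
Proof.
have s0 : 0 <= Num.sqrt 6 :> R by exact: sqrtr_ge0.
have s2 : Num.sqrt 6 ^+ 2 = 6 :> R by rewrite sqr_sqrtr.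
have [sg sl] : 2 < Num.sqrt 6 :> R /\ Num.sqrt 6 < 5 / 2 :> R by split; nra.
have den : 0 < 4 + 2 * Num.sqrt 6 :> R by lra.
split=> [[[/andP[N1 N7] al0]|[N8 alN]] U sU|N8 /andP[al0 alN]].
(* For N <= 7 the numerator of alpha_N is at most 7 - 4 sqrt 6 < 0, so alpha >= 0 already exceeds
   alpha_N. *)
- apply: instability => //; apply: lt_le_trans al0.
  rewrite /alphaN ltr_pdivrMr// mul0r.
  have : (N%:R : R) <= 7 by rewrite ler_nat.
  lra.
- have N8' : (8 : R) <= N%:R by rewrite ler_nat.
  (* For N >= 8 the numerator is at least 10 - 4 sqrt 6 > 0, so alpha > alpha_N implies alpha >=
     0. *)
  apply: instability => //; first exact: leq_trans N8.
  apply: le_trans (ltW alN); rewrite /alphaN divr_ge0 ?(ltW den)//.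
  lra.
- exact: stable_solution_exists.
Qed.
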